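(* Let $d,m\ge 1$ be integers and $n=(m+1)d$. Let $c_1=\left(1+\frac1m\right)^{1/d}$ and let $c_2$ satisfy $1<c_2<c_1$. Let $(\beta_{1,1},\ldots,\beta_{1,m})\in\mathbb{R}^m$ be such that $$\min_{1\le\ell\le m}\beta_{1,\ell}>(3d)^{\frac{c_2}{c_2-1}}\quad\text{and}\quad \Big(\min_{1\le\ell\le m}\beta_{1,\ell}\Big)^{c_1}>\Big(\max_{1\le\ell\le m}\beta_{1,\ell}\Big)^{c_2}.$$ For $i\in\{2,\ldots,d\}$ let $(\beta_{i,1},\ldots,\beta_{i,m})\in\mathbb{R}^m$ be such that for all $i\in\{1,\ldots,d-1\}$: $$\Big(\min_{1\le\ell\le m}\beta_{i,\ell}\Big)^{c_1}>\max_{1\le\ell\le m}\beta_{i+1,\ell}\quad\text{and}\quad \min_{1\le\ell\le m}\beta_{i+1,\ell}>\Big(\max_{1\le\ell\le m}\beta_{i,\ell}\Big)^{c_2}.$$ Then there exists a subspace $A$ of dimension $d$ in $\mathbb{R}^n$ such that for all $e\in\{1,\ldots,n-1\}$ and all integers $k$ with $1+g(d,e,n)\le k\le\min(d,e)$ and $e<k(m+1)$, we have $A\in\mathcal{I}_n(d,e)_{k-g(d,e,n)}$ and $$\mu_n(A|e)_{k-g(d,e,n)}=\frac{1}{\displaystyle\sum_{q=1+\max(0,e-mk)}^{k}\frac{1}{K_{q+d-k,\,v_q}}},$$ where $v_1,\ldots,v_k$ are defined from the Euclidean division $e=kv+u$ of $e$ by $k$ ($0\le u<k$) by $v_q=v+1$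 if $1\le q\le u$ and $v_q=v$ if $u+1\le q\le k$, and where for all $i\in\{1,\ldots,d\}$ and $v\in\{1,\ldots,m\}$ $$K_{i,v}=\max_{0\le\ell\le m-v}\beta_{i,\ell+1}\beta_{i,\ell+2}\cdots\beta_{i,\ell+v}.$$
   Context: Norms on $\mathbb{R}^n$ and its exterior powers are Euclidean (the standard basis of each exterior power being orthonormal). A subspace of $\mathbb{R}^n$ is rational if it has a basis of vectors with rational coordinates; $\mathcal{R}_n(e)$ is the set of rational subspaces of dimension $e$ of $\mathbb{R}^n$. The height of $B\in\mathcal{R}_n(e)$ is $H(B)=\|X_1\wedge\cdots\wedge X_e\|$ for any $\mathbb{Z}$-basis $X_1,\ldots,X_e$ of $B\cap\mathbb{Z}^n$ (equivalently, the Euclidean norm of a vector of Plücker coordinates of $B$ with coprime integer entries). Put $g(d,e,n)=\max(0,d+e-n)$. For $1\le j\le \min(d,e)-g(d,e,n)$, a subspace $A$ of dimension $d$ of $\mathbb{R}^n$ is $(e,j)$-irrational if $\dim(A\cap B)<j+g(d,e,n)$ for all $B\in\mathcal{R}_n(e)$; $\mathcal{I}_n(d,e)_j$ is the set of all $(e,j)$-irrational subspaces of dimension $d$ of $\mathbb{R}^n$. For nonzero $X,Y\in\mathbb{R}^n$, $\omega(X,Y)=\|X\wedge Y\|/(\|X\|\,\|Y\|)$. For subspaces $A,B$ of dimensions $d,e$, define inductively $\omega_1(A,B)=\min\{\omega(X,Y): X\in A\setminus\{0\},Y\in B\setminus\{0\}\}$, attained at $(X_1,Y_1)$, and, for $j<\min(d,e)$,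 $\omega_{j+1}(A,B)=\min\{\omega(X,Y): X\in A_j\setminus\{0\},Y\in B_j\setminus\{0\}\}$, attained at $(X_{j+1},Y_{j+1})$, where $A_j$ (resp. $B_j$) is the orthogonal complement of $\mathrm{Span}(X_1,\ldots,X_j)$ in $A$ (resp. of $\mathrm{Span}(Y_1,\ldots,Y_j)$ in $B$). Set $\psi_j(A,B)=\omega_{j+g(d,e,n)}(A,B)$. For $d,e\in\{1,\ldots,n-1\}$, $1\le j\le\min(d,e)-g(d,e,n)$ and $A\in\mathcal{I}_n(d,e)_j$, the exponent $\mu_n(A|e)_j\in[0,+\infty]$ is the supremum of the set of $\mu>0$ such that there are infinitely many $B\in\mathcal{R}_n(e)$ with $\psi_j(A,B)\le H(B)^{-\mu}$. *)

(* Defs.v *)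
From HB Require Import structures.
From mathcomp Require Import all_boot all_order all_algebra.
From mathcomp Require Import all_classical all_reals all_analysis.

Set Implicit Arguments.
Unset Strict Implicit.
Unset Printing Implicit Defensive.

Import Order.TTheory GRing.Theory Num.Theory.

Local Open Scope classical_set_scope.
Local Open Scope ring_scope.

Section Euclidean.
Context {R : realType} {n : nat}.
Implicit Types (X Y : 'rV[R]_n).

Definition dotp X Y : R := \sum_(i < n) X 0 i * Y 0 i.

(* The library norm `|X| on matrices is the sup norm, hence this definition. *)
Definition enorm X : R := Num.sqrt (\sum_(i < n) X 0 i ^+ 2).

(* The strictly increasing maps f index the standard basis
   e_(f 0) /\ ... /\ e_(f (e - 1)) of the e-th exterior power of R^n; the
   coordinates of the wedge product of the rows of M in this basis are the
   maximal minors of M. *)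
Definition increasing (e : nat) (f : {ffun 'I_e -> 'I_n}) : bool :=
  [forall i : 'I_e, forall j : 'I_e, (i < j)%N ==> (f i < f j)%N].

Definition wedge_coord (e : nat) (M : 'M[R]_(e, n)) (f : {ffun 'I_e -> 'I_n})
  : R := \det (colsub f M).

Definition wedge_norm (e : nat) (M : 'M[R]_(e, n)) : R :=
  Num.sqrt (\sum_(f : {ffun 'I_e -> 'I_n} | increasing f) wedge_coord M f ^+ 2).

Definition omega X Y : R := wedge_norm (col_mx X Y) / (enorm X * enorm Y).

End Euclidean.

Section Rational.
Context {R : realType} {n : nat}.
Implicit Types (B : {vspace 'rV[R]_n}).

Definition rational_space B : Prop :=
  exists s : seq 'rV[rat]_n, basis_of B [seq map_mx (@ratr R) v | v <- s].

Definition rational_spaces (e : nat) : set {vspace 'rV[R]_n} :=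
  [set B | rational_space B /\ \dim B = e].

(* The rows of X form a Z-basis of the intersection of B with Z^n. *)
Definition zbasis B (e : nat) (X : 'M[int]_(e, n)) : Prop :=
  injective (fun a : 'rV[int]_e => a *m X) /\
  [set v : 'rV[int]_n | map_mx (@intmul R 1) v \in B] =
    range (fun a : 'rV[int]_e => a *m X).

(* The value does not depend on the Z-basis picked by xget; one exists
   whenever B is rational. *)
Definition height B : R :=
  wedge_norm (map_mx (@intmul R 1)
    (xget 0 [set X : 'M[int]_(\dim B, n) | zbasis B X])).

End Rational.

Definition gdef (d e n : nat) : nat := (d + e - n)%N.

Section Angles.
Context {R : realType} {n : nat}.
Implicit Types (A B : {vspace 'rV[R]_n}) (S T : set 'rV[R]_n).

Definition orthocomp_in A (s : seq 'rV[R]_n) : set 'rV[R]_n :=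
  [set X | X \in A /\ forall Y, Y \in span s -> dotp X Y = 0].

Definition omega_minimizers S T : set ('rV[R]_n * 'rV[R]_n) :=
  [set p | [/\ S p.1, p.1 != 0, T p.2, p.2 != 0 &
    forall X Y, S X -> X != 0 -> T Y -> Y != 0 -> omega p.1 p.2 <= omega X Y]].

(* The sequence (X_1, Y_1), ..., (X_j, Y_j) of pairs attaining the successive
   minima; the minima do not depend on the pairs picked by xget. *)
Fixpoint omega_pairs A B (j : nat) : seq ('rV[R]_n * 'rV[R]_n) :=
  if j is i.+1 then
    let s := omega_pairs A B i in
    rcons s (xget (0, 0) (omega_minimizers (orthocomp_in A (unzip1 s))
                                           (orthocomp_in B (unzip2 s))))
  else [::].

(* Meaningful for 1 <= j <= minn (\dim A) (\dim B). *)
Definition omegaj (j : nat) A B : R :=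
  let p := last (0, 0) (omega_pairs A B j) in omega p.1 p.2.

Definition psi (j : nat) A B : R := omegaj (j + gdef (\dim A) (\dim B) n)%N A B.

Definition irrational_spaces (d e j : nat) : set {vspace 'rV[R]_n} :=
  [set A | \dim A = d /\
    forall B, rational_spaces e B -> (\dim (A :&: B) < j + gdef d e n)%N].

(* The supremum is taken in [0, +oo], so that it is 0 for the empty set. *)
Definition mu_exponent A (e j : nat) : \bar R :=
  maxe 0%E (ereal_sup [set x%:E | x in [set x : R | 0 < x /\
    infinite_set [set B | rational_spaces e B /\
                          psi j A B <= height B `^ (- x)]]]).

End Angles.

Section Sequences.
Context {R : realType}.

(* b 1, ..., b m; the default element b 1 belongs to the range as 1 <= m. *)
Definition min_upto (m : nat) (b : nat -> R) : R :=
  \big[Num.min/b 1%N]_(1 <= l < m.+1) b l.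

Definition max_upto (m : nat) (b : nat -> R) : R :=
  \big[Num.max/b 1%N]_(1 <= l < m.+1) b l.

Definition window_prod (b : nat -> R) (v l : nat) : R :=
  \prod_(1 <= s < v.+1) b (l + s)%N.

Definition Kmax (m : nat) (beta : nat -> nat -> R) (i v : nat) : R :=
  \big[Num.max/window_prod (beta i) v 0]_(0 <= l < (m - v).+1)
    window_prod (beta i) v l.

End Sequences.

Definition vpart (e k q : nat) : nat :=
  if (q <= e %% k)%N then (e %/ k).+1 else (e %/ k)%N.

(* Main.v *)
Require Import Defs.
From HB Require Import structures.
From mathcomp Require Import all_boot all_order all_algebra all_fingroup.
From mathcomp Require Import all_classical all_reals all_analysis.
From mathcomp Require Import ring lra zify.

(** The space A is spanned by d vectors, one in each of d blocks of m + 1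
    coordinates.  The vector of a block is (1, sigma_1, ..., sigma_m), where the
    sigma_l share out the terms of a lacunary series of powers 2 ^ - s_t, the
    t-th term going to the coordinate 1 + (t mod m).  Cutting the series after
    the term N and multiplying by 2 ^ s_N gives an integer vector X_N, and X_N
    is a multiple of X_(N-1) plus a vector of the standard basis.  Hence, for
    v <= m, the span V of X_N, ..., X_(N+v-1) is also spanned by X_N and v - 1
    standard basis vectors: its height is about 2 ^ s_N, while its distance to
    the limit vector is about 2 ^ - s_(N+v).  The exponents s_N are the integer
    parts of a sequence alpha_N whose ratios alpha_(N+v) / alpha_N are at most
    K_(i,v) (exponent_sequence).  These ratios reach K_(i,v) simultaneously in
    all blocks, at times tau that are common to the blocks and that come back
    infinitely often for each pair (e, k).

    At such a time, the direct sum of the spaces V of the last k blocks, with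
    dimensions v_1, ..., v_k, has height 2 ^ (tau * sum of 1 / K) and its k-th
    angle with A is at most 2 ^ - tau, up to constants (omegaj_upper_bound);
    blocks with v_q = m + 1 are contained in the sum and cost nothing.  So the
    exponent is at least the announced value.

    Conversely, let B be a rational space of dimension e and height 2 ^ h whose
    k-th angle with A is at most 2 ^ - p.  By choosing a maximal minor, k of the
    blocks are found such that each of their limit vectors is close to B, once
    the coordinates of the other blocks are added to B (frame_projection).  An
    integer vector whose distance to B is less than 1 / H(B) lies in B, because
    the minors of the two together are integers less than 1 (int_point_near);
    adding coordinate vectors to B does not spoil this (extend_coord).  If p
    exceeded the predicted multiple of h, the gaps between the K_(i,v), which
    follow from the hypotheses on beta (window_max_gap, window_max_gap_row),
    would put v_q consecutive truncations of the q-th selected block into the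
    enlarged space.  As the v_q add up to e, the enlarged space is then exactly
    the direct sum of the spaces V and of the other blocks.  Its covolume
    gives a lower bound of h, its distance to the limit vectors an upper bound
    of p, and these contradict the assumption on p (inverse_max_sum_le).
    The selection of the last k blocks is the best one since K_(i,v) grows with
    i.  The same bound applies with p arbitrarily large, which gives
    irrationality; and since there are finitely many rational spaces of bounded
    height (finite_height_le), it bounds the exponent (mu_exponent_value). *)

Set Implicit Arguments.
Unset Strict Implicit.
Unset Printing Implicit Defensive.

Import Order.TTheory GRing.Theory Num.Theory.

Local Open Scope ring_scope.

(** * Maximal minors *)

Section Minors.
Context {R : comNzRingType}.

Lemma det_colsub_col_mx r n (x : 'rV[R]_n) (M : 'M[R]_(r, n))
    (f : 'I_(1 + r) -> 'I_n) :
  \det (colsub f (col_mx x M)) =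
  \sum_j x 0 (f j) * ((-1) ^+ j * \det (colsub (f \o lift j) M)).
Proof.
rewrite (expand_det_row _ ord0); apply: eq_bigr => j _; congr (_ * _).
  by rewrite mxE /col_mx mxE; case: splitP => // k _; rewrite (ord1 k).
rewrite /cofactor add0n; congr (_ * \det _).
apply/matrixP => a b; rewrite !mxE /=; case: splitP => k.
  by rewrite (ord1 k).
by move=> e; congr (M _ _); apply: val_inj; case: e.
Qed.

Lemma det_colsub_not_inj r n (M : 'M[R]_(r, n)) (f : 'I_r -> 'I_n) :
  ~ injective f -> \det (colsub f M) = 0.
Proof.
move=> /injectiveP /injectivePn [i [j ij fij]].
rewrite -det_tr; apply: (determinant_alternate ij) => k.
by rewrite !mxE fij.
Qed.

End Minors.

Lemma increasing_inj r n (f : {ffun 'I_r -> 'I_n}) :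
  increasing f -> injective f.
Proof.
move=> /forallP fi i j fij; apply: val_inj; apply: contra_eq (erefl (f i)).
move: (fi i) (fi j) => /forallP/(_ j)/implyP h1 /forallP/(_ i)/implyP h2 ne.
by case: (ltngtP i j) ne => // /[dup] ij _ _; [move: (h1 ij)|move: (h2 ij)];
  rewrite fij ltnn.
Qed.

(** Reduces minors along arbitrary columns to minors along increasing
    columns, which are the coordinates of the exterior power. *)
Lemma inj_sort r n (f : 'I_r -> 'I_n) : injective f ->
  exists (g : {ffun 'I_r -> 'I_n}) (s : {perm 'I_r}),
    increasing g /\ f =1 g \o s.
Proof.
case: r f => [|r] f finj.
  exists [ffun i => f i], 1%g; split; last by case.
  by apply/forallP; case.
have [n0|n0] := posnP n; first by have := ltn_ord (f ord0); rewrite [in X in (_ < X)%N]n0.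
pose s0 := sort (fun i j : 'I_n => (i <= j)%N) (codom f).
have sz : size s0 = r.+1 by rewrite size_sort size_codom card_ord.
have us : uniq s0 by rewrite sort_uniq; apply/injectiveP.
pose y0 := f ord0.
pose g := [ffun i : 'I_r.+1 => nth y0 s0 i].
have gi : increasing g.
  apply/forallP => i; apply/forallP => j; apply/implyP => ij; rewrite !ffunE.
  have : sorted (fun i j : 'I_n => (i <= j)%N) s0.
    by apply: sort_sorted => a b; exact: leq_total.
  move=> /(sorted_ltn_nth (fun _ _ _ => @leq_trans _ _ _) y0).
  move=> /(_ i j); rewrite !inE !sz => /(_ (ltn_ord i) (ltn_ord j) ij).
  rewrite leq_eqVlt => /orP[/eqP e|//].
  have /eqP := val_inj e; rewrite nth_uniq ?sz ?ltn_ord // => /eqP e'.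
  by rewrite e' ltnn in ij.
have ginj := increasing_inj gi.
have fg i : exists j, f i == g j.
  have : f i \in s0 by rewrite mem_sort codom_f.
  move=> /(nthP y0)[j]; rewrite sz => jr e.
  by exists (Ordinal jr); rewrite ffunE /= e.
pose t i := xchoose (fg i).
have tE i : f i = g (t i) by exact/eqP/(xchooseP (fg i)).
have tinj : injective t by move=> a b e; apply: finj; rewrite !tE e.
by exists g, (perm tinj); split => // i /=; rewrite permE.
Qed.

Section MinorBound.
Context {R : realType}.

(** Bounding the minors along all maps of columns, increasing or not, avoids
    reordering columns when a row is added; the Euclidean norm of the wedge
    product is comparable to the best such bound. *)
Definition minors_le r n (M : 'M[R]_(r, n)) (H : R) :=
  forall f : 'I_r -> 'I_n, `|\det (colsub f M)| <= H.

Lemma minors_le_increasing r n (M : 'M[R]_(r, n)) (H : R) : 0 <= H ->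
  (forall g : {ffun 'I_r -> 'I_n}, increasing g -> `|\det (colsub g M)| <= H) ->
  minors_le M H.
Proof.
move=> H0 h f; have [|/det_colsub_not_inj ->] := pselect (injective f); last first.
  by rewrite normr0.
move=> /inj_sort[g [s [gi fE]]].
have -> : colsub f M = colsub g M *m perm_mx s^-1.
  rewrite -col_permE; apply/matrixP => a b; rewrite !mxE fE /=.
  by rewrite ?invgK.
rewrite det_mulmx det_perm normrM normrX normrN1 expr1n mulr1; exact: h.
Qed.

Lemma wedge_norm_ge r n (M : 'M[R]_(r, n)) : minors_le M (wedge_norm M).
Proof.
apply: minors_le_increasing; first exact: sqrtr_ge0.
move=> g gi; rewrite -sqrtr_sqr ler_wsqrtr // (bigD1 g) //=.
by rewrite /wedge_coord lerDl sumr_ge0 // => f _; exact: sqr_ge0.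
Qed.

Lemma wedge_norm_le r n (M : 'M[R]_(r, n)) (H : R) : minors_le M H ->
  wedge_norm M <= #|{ffun 'I_r -> 'I_n}|%:R * H.
Proof.
move=> h.
have [f0|/card_gt0P [f0 _]] := posnP #|{ffun 'I_r -> 'I_n}|.
  rewrite f0 mul0r /wedge_norm big1 ?sqrtr0 // => f.
  by have := card0_eq f0 f; rewrite inE.
have H0 : 0 <= H by apply: le_trans (h f0).
rewrite -(@ger0_norm _ (_ * H)) ?mulr_ge0 // -sqrtr_sqr ler_wsqrtr //.
rewrite exprMn expr2 -mulrA; apply: (@le_trans _ _ (#|{ffun 'I_r -> 'I_n}|%:R * H ^+ 2)).
  rewrite mulr_natl -sumr_const; apply: (@le_trans _ _ (\sum_(f | increasing f) H ^+ 2)).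
    apply: ler_sum => f _; rewrite /wedge_coord -real_normK ?num_real //.
    by rewrite lerXn2r ?nnegrE // h.
  rewrite big_mkcond /=; apply: ler_sum => f _; case: ifP => // _; exact: sqr_ge0.
have n1 : 1 <= #|{ffun 'I_r -> 'I_n}|%:R :> R.
  by rewrite ler1n; apply/card_gt0P; exists f0.
by rewrite ler_wpM2l // ler_peMl // sqr_ge0.
Qed.

Lemma det_le_rows r (M : 'M[R]_r) (b : 'I_r -> R) :
  (forall i j, `|M i j| <= b i) -> `|\det M| <= r`!%:R * \prod_i b i.
Proof.
move=> Mb; rewrite /determinant; apply: le_trans (ler_norm_sum _ _ _) _.
rewrite mulr_natl -[X in _ *+ X]card_Sn -sumr_const; apply: ler_sum => t _.
rewrite normrM normrX normrN1 expr1n mul1r normr_prod.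
by apply: ler_prod => i _; rewrite normr_ge0 Mb.
Qed.

Lemma row_free_minor r n (M : 'M[R]_(r, n)) : row_free M ->
  exists f : 'I_r -> 'I_n, \det (colsub f M) != 0.
Proof.
rewrite -row_leq_rank -mxrank_tr => fr.
have rf : row_full M^T by rewrite /row_full eqn_leq rank_leq_col.
have u := fullrowsub_unit rf.
exists (fullrankfun rf); rewrite -unitfE -unitmxE.
by rewrite -unitmx_tr (_ : _^T = rowsub (fullrankfun rf) M^T) //; apply/matrixP => a b; rewrite !mxE.
Qed.

(** The wedge product x /\ M only depends on x modulo the rows of M. This is
    how a small distance between x and the row space becomes a small minor. *)
Lemma det_colsub_addrow r n (x y : 'rV[R]_n) (M : 'M[R]_(r, n)) f :
  (y <= M)%MS ->
  \det (colsub f (col_mx x M)) = \det (colsub f (col_mx (x - y) M)).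
Proof.
move=> /submxP[u yE].
have -> : col_mx (x - y) M = block_mx 1%:M (- u) 0 1%:M *m col_mx x M.
  by rewrite mul_block_col !mul1mx mul0mx add0r yE mulNmx.
by rewrite -mulmx_colsub det_mulmx det_ublock !det1 !mul1r.
Qed.

Lemma minors_le_addrow r n (x : 'rV[R]_n) (M : 'M[R]_(r, n)) (H eta : R) :
  0 <= eta -> (forall i, `|x 0 i| <= eta) -> minors_le M H ->
  minors_le (col_mx x M) ((1 + r)%:R * (eta * H)).
Proof.
move=> e0 xe h f; rewrite det_colsub_col_mx.
apply: le_trans (ler_norm_sum _ _ _) _.
rewrite mulr_natl -[X in _ *+ X]card_ord -sumr_const; apply: ler_sum => j _.
rewrite !normrM normrX normrN1 expr1n mul1r.
by apply: ler_pM => //.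
Qed.

Lemma row_free_col_mx r n (x : 'rV[R]_n) (M : 'M[R]_(r, n)) :
  row_free M -> ~~ (x <= M)%MS -> row_free (col_mx x M).
Proof.
move=> Mf xM; rewrite -row_leq_rank -addsmxE addsmxC add1n -{1}(eqP Mf).
suff : (M < M + x)%MS by rewrite ltmxErank => /andP[].
by rewrite /ltmx addsmxSl /=; apply: contra xM; apply: submx_trans; exact: addsmxSr.
Qed.

End MinorBound.

(** * Integer matrices and points near a rational space *)

Lemma basis_mx (F : fieldType) n r (A : {vspace 'rV[F]_n}) (t : r.-tuple 'rV[F]_n) :
  basis_of A t ->
  row_free (\matrix_(i < r) t`_i) /\
  forall X, (X \in A) = (X <= \matrix_(i < r) t`_i)%MS.
Proof.
move=> tA; split.
  apply: inj_row_free => u uM; have /freeP fr := basis_free tA.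
  apply/rowP => i; rewrite mxE; apply: (fr (u 0)).
  by rewrite -[RHS]uM mulmx_sum_row; apply: eq_bigr => j _; rewrite rowK.
move=> X; apply/idP/submxP => [XA|[u ->]].
  exists (\row_i coord t i X); rewrite {1}(coord_basis tA XA) mulmx_sum_row.
  by apply: eq_bigr => i _; rewrite mxE rowK.
rewrite mulmx_sum_row memv_suml // => i _; rewrite rowK memvZ //.
by apply: (basis_mem tA); rewrite mem_nth // size_tuple.
Qed.

Section IntegerMatrices.
Context {R : realType}.

Notation toR := (map_mx (@intmul R 1)).

Lemma det_toR r (M : 'M[int]_r) : \det (toR M) = (\det M)%:~R.
Proof. by rewrite -(det_map_mx (intmul (1 : R))). Qed.

Lemma toR_mul m n p (A : 'M[int]_(m, n)) (B : 'M[int]_(n, p)) :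
  toR (A *m B) = toR A *m toR B.
Proof. exact: (map_mxM (intmul (1 : R))). Qed.

Lemma toR_inj m n : injective (toR : 'M[int]_(m, n) -> 'M[R]_(m, n)).
Proof.
move=> A B /matrixP e; apply/matrixP => i j.
by have := e i j; rewrite !mxE => /intr_inj.
Qed.

Lemma minor_toR r n (Z : 'M[int]_(r, n)) f :
  \det (colsub f (toR Z)) = (\det (colsub f Z))%:~R.
Proof. by rewrite -det_toR; congr (\det _); apply/matrixP => i j; rewrite !mxE. Qed.

Lemma norm_int_ge1 (z : int) : z%:~R != 0 :> R -> 1 <= `|z%:~R : R|.
Proof. by rewrite intr_eq0 -intr_norm ler1z => z0; rewrite -gtz0_ge1 normr_gt0. Qed.

Lemma minors_ge1 r n (Z : 'M[int]_(r, n)) (H : R) :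
  row_free (toR Z) -> minors_le (toR Z) H -> 1 <= H.
Proof.
move=> /row_free_minor[f]; rewrite minor_toR => /norm_int_ge1 h1 h.
by apply: le_trans h1 _; rewrite -minor_toR.
Qed.

(** The minors of Z together with x are integers, and they are unchanged when
    the near point y is subtracted from x, so they are all less than 1. *)
Lemma int_point_near r n (Z : 'M[int]_(r, n)) (x : 'rV[int]_n)
    (y : 'rV[R]_n) (H eta : R) :
  row_free (toR Z) -> minors_le (toR Z) H -> (y <= toR Z)%MS -> 0 <= eta ->
  (forall i, `|(x 0 i)%:~R - y 0 i| <= eta) ->
  (1 + r)%:R * (eta * H) < 1 -> (toR x <= toR Z)%MS.
Proof.
move=> Zf ZH yZ e0 xy lt1; apply: contraT => xZ.
have /row_free_minor[f] := row_free_col_mx Zf xZ.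
have E : col_mx (toR x) (toR Z) = toR (col_mx x Z) by rewrite map_col_mx.
rewrite E minor_toR => /norm_int_ge1; rewrite -minor_toR -E.
rewrite (det_colsub_addrow _ _ yZ) leNgt => /negP[]; apply: le_lt_trans lt1.
by apply: minors_le_addrow => // i; rewrite !mxE.
Qed.

Lemma row_col_mx_cases (T : Type) r n (x : 'rV[T]_n) (Z : 'M[T]_(r, n)) i :
  row i (col_mx x Z) = x \/ exists j, row i (col_mx x Z) = row j Z.
Proof.
case: (split_ordP i) => k ->; [left|right; exists k].
  by rewrite rowKu; apply/rowP => j; rewrite (ord1 k) mxE.
by rewrite rowKd.
Qed.

(** Expanding a minor along a coordinate vector leaves minors of the smaller
    matrix, so that adding coordinate vectors costs a bounded factor only. *)
Lemma extend_coord n (P : 'rV[int]_n -> Prop) r (Z : 'M[int]_(r, n)) (H : R)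
    (cs : seq 'I_n) :
  row_free (toR Z) -> minors_le (toR Z) H -> (forall i, P (row i Z)) ->
  (forall c, c \in cs -> P (delta_mx 0 c)) ->
  exists r' (Z' : 'M[int]_(r', n)),
    [/\ row_free (toR Z'), (r' <= r + size cs)%N,
        (toR Z <= toR Z')%MS /\
        forall c, c \in cs -> ((delta_mx 0 c : 'rV[R]_n) <= toR Z')%MS,
        minors_le (toR Z') ((1 + n)%:R ^+ size cs * H) & 
        forall i, P (row i Z')].
Proof.
move=> Zf ZH ZP; elim: cs => [|c cs IH] Pc.
  exists r, Z; split => //=; rewrite ?addn0 ?mul1r //.
have [c' Pc'|r' [Z' [Z'f rr' [ZZ' csZ'] Z'H Z'P]]] := IH.
  by apply: Pc; rewrite inE Pc' orbT.
have [cZ'|cZ'] := boolP ((delta_mx 0 c : 'rV[R]_n) <= toR Z')%MS.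
  exists r', Z'; split => //=; first by rewrite addnS leqW.
    split => // c'; rewrite inE => /orP[/eqP -> //|]; exact: csZ'.
  move=> f; apply: (le_trans (Z'H f)).
  rewrite exprS -mulrA ler_peMl ?(le_trans _ (Z'H f)) // ler1n.
  by [].
have dR : toR (delta_mx 0 c : 'rV[int]_n) = delta_mx 0 c.
  by apply/rowP => j; rewrite !mxE; case: (_ && _).
have E : toR (col_mx (delta_mx 0 c : 'rV[int]_n) Z') = col_mx (delta_mx 0 c) (toR Z').
  by rewrite map_col_mx dR.
exists (1 + r')%N, (col_mx (delta_mx 0 c) Z'); rewrite E; split => /=.
- by apply: row_free_col_mx.
- by rewrite add1n addnS ltnS.
- have sub : (toR Z' <= col_mx (delta_mx 0 c : 'rV[R]_n) (toR Z'))%MS.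
    by apply: submx_trans (addsmxSr (delta_mx 0 c : 'rV[R]_n) _) _; rewrite addsmxE.
  split; first exact: submx_trans sub.
  move=> c'; rewrite inE => /orP[/eqP ->|/csZ' h]; first by rewrite -addsmxE addsmxSl.
  exact: submx_trans h sub.
- have := @minors_le_addrow R r' n (delta_mx 0 c) (toR Z') _ 1 ler01 _ Z'H.
  move=> h f; apply: (le_trans (h _ f)).
    by move=> i; rewrite mxE; case: (_ && _); rewrite ?normr0 ?normr1.
  rewrite mul1r exprS -mulrA ler_wpM2r //; last first.
    by rewrite ler_nat leq_add2l; move: Z'f; rewrite -row_leq_rank => /leq_trans; apply; exact: rank_leq_col.
  have [f'] := row_free_minor Z'f; rewrite -normr_gt0 => /ltW h'.
  by apply: le_trans h' _.
- by move=> i; have [->|[j ->]] := row_col_mx_cases (delta_mx 0 c) Z' i; [apply: Pc; rewrite inE eqxx|].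
Qed.

(** The selected rows of W are independent, so if there are at least as many
    of them as rows of Z, they span the row space of Z. *)
Lemma span_selected_rows n (S : {set 'I_n}) (W : 'M[R]_n) r (Z : 'M[R]_(r, n)) :
  W \in unitmx -> (forall c, c \in S -> (row c W <= Z)%MS) ->
  row_free Z -> (r <= #|S|)%N ->
  forall y : 'rV[R]_n, (y <= Z)%MS ->
  exists t : 'rV[R]_n, (forall c, c \notin S -> t 0 c = 0) /\ y = t *m W.
Proof.
move=> Wu SZ Zf rS.
pose g : 'I_#|S| -> 'I_n := enum_val.
have ginj : injective g by apply: enum_val_inj.
pose D : 'M[R]_(#|S|, n) := rowsub g 1%:M.
have Df : row_free D.
  apply/row_freeP; exists D^T; apply/matrixP => a b; rewrite !mxE.
  rewrite (bigD1 (g a)) //= big1 => [|j ja]; rewrite !mxE; last first.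
    by rewrite eq_sym (negPf ja) mul0r.
  by rewrite eqxx mul1r addr0 eq_sym (inj_eq ginj).
have DZ : (D *m W <= Z)%MS.
  apply/row_subP => a; rewrite row_mul.
  have -> : row a D = delta_mx 0 (g a) by apply/rowP => j; rewrite !mxE eqxx eq_sym.
  by rewrite -rowE; apply: SZ; exact: enum_valP.
have ZD : (Z <= D *m W)%MS.
  have := mxrank_leqif_eq DZ; case=> _; rewrite mxrankMfree; last first.
    by rewrite row_free_unit.
  rewrite (eqP Zf) (eqP Df) => /esym e; move: (rS); rewrite leq_eqVlt.
  case/orP => [/eqP rE|lt]; last first.
    have := mxrankS DZ; rewrite mxrankMfree ?row_free_unit // (eqP Df) (eqP Zf).
    by rewrite leqNgt lt.
  by move/eqP: rE; rewrite eq_sym -e => /andP[].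
move=> y /submx_trans/(_ ZD)/submxP[u ->]; exists (u *m D); split; last by rewrite mulmxA.
move=> c cS; rewrite mxE big1 // => a _; rewrite !mxE.
case: eqP => [ga|]; rewrite ?mulr0 //.
by rewrite -ga (enum_valP a) in cS.
Qed.

(** The selected rows of W are, by the third hypothesis, a basis of the integer
    points of their span.  Completing Z by the coordinate vectors outside S
    gives a square integer matrix that is an integer multiple T * W of W, and
    det T is a nonzero integer. *)
Lemma det_le_minors n (S : {set 'I_n}) (W : 'M[int]_n) r (Z : 'M[int]_(r, n)) (H : R) :
  toR W \in unitmx ->
  (forall c, c \notin S -> row c W = delta_mx 0 c) ->
  (forall (x : 'rV[int]_n) (t : 'rV[R]_n),
     (forall c, c \notin S -> t 0 c = 0) -> toR x = t *m toR W ->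
     exists t' : 'rV[int]_n, t = toR t') ->
  (forall c, c \in S -> (toR (row c W) <= toR Z)%MS) ->
  row_free (toR Z) -> (r <= #|S|)%N -> minors_le (toR Z) H ->
  `|\det (toR W)| <= (1 + n)%:R ^+ n * H.
Proof.
move=> Wu WS Wprim SZ Zf rS ZH.
pose P (x : 'rV[int]_n) := exists t : 'rV[int]_n, x = t *m W.
have SZ' c : c \in S -> (row c (toR W) <= toR Z)%MS by rewrite -map_row; exact: SZ.
have ZP i : P (row i Z).
  have iZ : (toR (row i Z) <= toR Z)%MS by rewrite map_row row_sub.
  have [t [tS tE]] := span_selected_rows Wu SZ' Zf rS iZ.
  have [t' t'E] := Wprim _ _ tS tE.
  by exists t'; apply: toR_inj; rewrite toR_mul -t'E.
have [c|r' [Z' [Z'f r'n [ZZ' csZ'] Z'H Z'P]]] :=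
  extend_coord (cs := enum (~: S)) Zf ZH ZP.
  by rewrite mem_enum inE => cS; exists (delta_mx 0 c); rewrite -rowE WS.
have WZ' : (toR W <= toR Z')%MS.
  apply/row_subP => c; have [cS|cS] := boolP (c \in S).
    by rewrite -map_row; apply: submx_trans ZZ'; exact: SZ.
  rewrite -map_row WS //.
  have -> : toR (delta_mx 0 c : 'rV[int]_n) = delta_mx 0 c.
    by apply/rowP => j; rewrite !mxE; case: (_ && _).
  by apply: csZ'; rewrite mem_enum inE.
have r'E : r' = n.
  apply/eqP; rewrite eqn_leq; apply/andP; split.
    by rewrite -(eqP Z'f) rank_leq_col.
  by have := mxrankS WZ'; rewrite (eqP Z'f) mxrank_unit.
subst r'.
have /fin_all_exists [t tE] i : exists t : 'rV[int]_n, row i Z' = t *m W by apply: Z'P.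
pose T : 'M[int]_n := \matrix_i t i.
have Z'E : Z' = T *m W by apply/row_matrixP => i; rewrite row_mul rowK tE.
have h := Z'H id; have cid (M : 'M[R]_n) : colsub id M = M by apply/matrixP => i j; rewrite mxE.
rewrite cid in h; move: Z'f; rewrite row_free_unit unitmxE unitfE => dZ'.
have H0 : 0 <= H by have [f _] := row_free_minor Zf; apply: le_trans (ZH f).
apply: (@le_trans _ _ `|\det (toR Z')|).
  move: dZ'; rewrite Z'E toR_mul det_mulmx normrM mulf_eq0 negb_or => /andP[].
  move=> t0 _; apply: ler_peMl => //; move: t0; rewrite det_toR; exact: norm_int_ge1.
apply: (le_trans h); rewrite ler_wpM2r // ler_weXn2l ?ler1n //.
by rewrite -cardE; by rewrite -[X in (_ <= X)%N]card_ord max_card.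
Qed.

End IntegerMatrices.

(** * The Euclidean scalar product *)

Section DotProduct.
Context {R : realType} {n : nat}.
Implicit Types (X Y Z : 'rV[R]_n).

Lemma dotpC X Y : dotp X Y = dotp Y X.
Proof. by apply: eq_bigr => i _; rewrite mulrC. Qed.

Lemma dotpDl X Y Z : dotp (X + Y) Z = dotp X Z + dotp Y Z.
Proof. by rewrite /dotp -big_split; apply: eq_bigr => i _; rewrite mxE mulrDl. Qed.

Lemma dotpZl a X Y : dotp (a *: X) Y = a * dotp X Y.
Proof. by rewrite /dotp mulr_sumr; apply: eq_bigr => i _; rewrite mxE mulrA. Qed.

Lemma dotpNl X Y : dotp (- X) Y = - dotp X Y.
Proof. by rewrite -scaleN1r dotpZl mulN1r. Qed.

Lemma dotpDr X Y Z : dotp X (Y + Z) = dotp X Y + dotp X Z.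
Proof. by rewrite dotpC dotpDl !(dotpC X). Qed.

Lemma dotpZr a X Y : dotp X (a *: Y) = a * dotp X Y.
Proof. by rewrite dotpC dotpZl dotpC. Qed.

Lemma dotpNr X Y : dotp X (- Y) = - dotp X Y.
Proof. by rewrite dotpC dotpNl dotpC. Qed.

Definition dotpE := (dotpDl, dotpDr, dotpZl, dotpZr, dotpNl, dotpNr).

Lemma dotp0l Y : dotp 0 Y = 0.
Proof. by rewrite -(scale0r 0) dotpZl mul0r. Qed.

Lemma dotp_suml (I : finType) (F : I -> 'rV[R]_n) Y :
  dotp (\sum_i F i) Y = \sum_i dotp (F i) Y.
Proof. exact: (big_morph (dotp^~ Y) (fun X Z => dotpDl X Z Y) (dotp0l Y)). Qed.

Lemma dotp_ge0 X : 0 <= dotp X X.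
Proof. by apply: sumr_ge0 => i _; rewrite -expr2 sqr_ge0. Qed.

Lemma sqr_coord_le_dotp X i : X 0 i ^+ 2 <= dotp X X.
Proof.
rewrite /dotp (bigD1 i) //= -expr2 lerDl sumr_ge0 // => j _.
by rewrite -expr2 sqr_ge0.
Qed.

Lemma dotp_eq0 X : (dotp X X == 0) = (X == 0).
Proof.
apply/eqP/eqP => [X0|->]; last exact: dotp0l.
apply/rowP => i; rewrite mxE; apply/eqP; rewrite -sqrf_eq0 eq_le sqr_ge0.
by rewrite -X0 sqr_coord_le_dotp.
Qed.

Lemma dotp_gt0 X : (0 < dotp X X) = (X != 0).
Proof. by rewrite lt0r dotp_ge0 andbT dotp_eq0. Qed.

Lemma enorm_sqr X : enorm X ^+ 2 = dotp X X.
Proof.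
rewrite /enorm sqr_sqrtr; last by apply: sumr_ge0 => i _; exact: sqr_ge0.
by apply: eq_bigr => i _; rewrite expr2.
Qed.

Lemma sum_ord2_increasing (G : 'I_n -> 'I_n -> R) :
  \sum_(f : {ffun 'I_(1 + 1) -> 'I_n} | increasing f) G (f ord0) (f ord_max) =
  \sum_(i < n) \sum_(j < n | (i < j)%N) G i j.
Proof.
rewrite pair_big_dep /=.
rewrite (reindex (fun p : 'I_n * 'I_n =>
  [ffun k : 'I_(1 + 1) => if k == ord0 then p.1 else p.2])) /=.
  apply: eq_big => [[a b]|[a b] _]; last by rewrite !ffunE.
  apply/forallP/idP => [h|ab i].
    by move: (h ord0) => /forallP/(_ ord_max); rewrite !ffunE.
  apply/forallP => j; rewrite !ffunE; apply/implyP.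
  by case: i j => [[|[|i]] ?] [[|[|j]] ?].
exists (fun f : {ffun 'I_(1 + 1) -> 'I_n} => (f ord0, f ord_max)).
  by move=> [a b] _; rewrite !ffunE.
move=> f _; apply/ffunP => k; rewrite ffunE.
by case: k => [[|[|k]] kl] //=; congr (f _); apply: val_inj.
Qed.

(** Lagrange's identity. *)
Lemma wedge_norm2 X Y :
  wedge_norm (col_mx X Y) ^+ 2 = dotp X X * dotp Y Y - dotp X Y ^+ 2.
Proof.
rewrite sqr_sqrtr; last by apply: sumr_ge0 => f _; exact: sqr_ge0.
pose G i j := (X 0 i * Y 0 j - X 0 j * Y 0 i) ^+ 2.
have -> : \sum_(f : {ffun 'I_(1 + 1) -> 'I_n} | increasing f)
   wedge_coord (col_mx X Y) f ^+ 2 = 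
   \sum_(f : {ffun 'I_(1 + 1) -> 'I_n} | increasing f) G (f ord0) (f ord_max).
  apply: eq_bigr => f _; rewrite /wedge_coord /G; congr (_ ^+ 2).
  rewrite det_colsub_col_mx !big_ord_recl big_ord0 addr0 !det_mx11 !mxE /=.
  have -> : lift (ord0 : 'I_2) (ord0 : 'I_1) = ord_max by exact: val_inj.
  have -> : lift (ord_max : 'I_2) (ord0 : 'I_1) = ord0 by exact: val_inj.
  by rewrite expr0 expr1; ring.
rewrite sum_ord2_increasing.
have sw : \sum_(i < n) \sum_(j < n | (i < j)%N) G i j = \sum_(i < n) \sum_(j < n | (j < i)%N) G i j.
  rewrite (exchange_big_dep xpredT) //=; apply: eq_bigr => i _; apply: eq_bigr => j _.
  by rewrite /G -opprB sqrrN; congr (_ ^+ 2); ring.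
have tot : \sum_i \sum_j G i j = (dotp X X * dotp Y Y - dotp X Y ^+ 2) *+ 2.
  have e i : \sum_j G i j = X 0 i ^+ 2 * dotp Y Y + Y 0 i ^+ 2 * dotp X X
      - (X 0 i * Y 0 i) * dotp X Y *+ 2.
    rewrite /dotp !mulr_sumr -sumrMnl -big_split /= -sumrB; apply: eq_bigr => j _.
    by rewrite /G; ring.
  under eq_bigr do rewrite e.
  rewrite sumrB big_split /= -!mulr_suml sumrMnl -!mulr_suml.
  have -> : \sum_i X 0 i ^+ 2 = dotp X X by [].
  have -> : \sum_i Y 0 i ^+ 2 = dotp Y Y by [].
  have -> : \sum_i X 0 i * Y 0 i = dotp X Y by [].
  by ring.
apply: (@mulIf _ 2%:R); first by rewrite pnatr_eq0.
rewrite !mulr_natr -tot mulr2n {2}sw -big_split; apply: eq_bigr => i _ /=.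
rewrite [RHS](bigID (fun j : 'I_n => (i < j)%N)) /=; congr (_ + _).
rewrite [RHS](bigD1 i) ?ltnn //= [G i i]/G subrr expr0n add0r.
apply: eq_bigl => j; rewrite -leqNgt -val_eqE /= eq_sym; by case: ltngtP.
Qed.

End DotProduct.

(** * Pairs of vectors of minimal angle *)

Section Omega.
Import numFieldNormedType.Exports.
Local Open Scope classical_set_scope.
Local Open Scope ring_scope.
Context {R : realType} {n : nat}.
Implicit Types (X Y Z : 'rV[R]_n).

Lemma omega_ge0 X Y : 0 <= omega X Y.
Proof. by rewrite /omega divr_ge0 ?mulr_ge0 ?sqrtr_ge0. Qed.

Lemma omega_sqr X Y : X != 0 -> Y != 0 ->
  omega X Y ^+ 2 = 1 - dotp X Y ^+ 2 / (dotp X X * dotp Y Y).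
Proof.
rewrite -!dotp_gt0 => X0 Y0.
rewrite /omega expr_div_n wedge_norm2 exprMn !enorm_sqr mulrBl divff //.
by rewrite mulf_neq0 ?gt_eqF.
Qed.

Lemma omega_le_dist X Y : X != 0 -> Y != 0 ->
  omega X Y ^+ 2 * dotp X X <= dotp (X - Y) (X - Y).
Proof.
move=> X0 Y0; rewrite omega_sqr //; move: X0 Y0; rewrite -!dotp_gt0 => X0 Y0.
rewrite mulrBl mul1r !dotpE (dotpC Y X) -subr_ge0.
set a := dotp X X in X0 *; set b := dotp Y Y in Y0 *; set c := dotp X Y.
have -> : a - c + (- c - - b) - (a - c ^+ 2 / (a * b) * a) = (b - c) ^+ 2 / b.
  by field; rewrite !gt_eqF.
by rewrite divr_ge0 ?sqr_ge0 // ltW.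
Qed.

Lemma omega_nearest X Y : X != 0 -> Y != 0 ->
  exists t, dotp (X - t *: Y) (X - t *: Y) = omega X Y ^+ 2 * dotp X X.
Proof.
move=> X0 Y0; exists (dotp X Y / dotp Y Y); rewrite omega_sqr //.
move: X0 Y0; rewrite -!dotp_gt0 => X0 Y0.
rewrite !dotpE (dotpC Y X).
set a := dotp X X in X0 *; set b := dotp Y Y in Y0 *; set c := dotp X Y.
by field; rewrite !gt_eqF.
Qed.

Lemma mem_mx (A : {vspace 'rV[R]_n}) :
  exists M : 'M[R]_(\dim A, n), row_free M /\
    forall X, (X \in A) = (X <= M)%MS.
Proof. by exists (\matrix_i (vbasis A)`_i); apply: basis_mx; exact: vbasisP. Qed.

Lemma orthocomp_inP (A : {vspace 'rV[R]_n}) s X :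
  orthocomp_in A s X <-> X \in A /\ forall Y, Y \in s -> dotp X Y = 0.
Proof.
split=> [[XA h]|[XA h]]; split => // Y Ys; first by apply: h; exact: memv_span.
rewrite (coord_span (X := in_tuple s) Ys) dotpC dotp_suml big1 // => i _.
by rewrite dotpZl dotpC h ?mulr0 // mem_nth // size_tuple.
Qed.

(** Fewer than k orthogonality conditions cannot exclude a space of dimension
    k. *)
Lemma exists_orth k (F : 'M[R]_(k, n)) (s : seq 'rV[R]_n) : (size s < k)%N ->
  exists2 u : 'rV[R]_k, u != 0 & forall Y, Y \in s -> dotp (u *m F) Y = 0.
Proof.
move=> sk; pose N : 'M[R]_(k, size s) := \matrix_(i, j) dotp (row i F) s`_j.
have : kermx N != 0.
  rewrite kermx_eq0 -row_leq_rank -ltnNge; apply: leq_ltn_trans sk.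
  exact: rank_leq_col.
move=> /rowV0Pn[u /sub_kermxP uN u0]; exists u => // Y /(nthP 0)[j js <-].
have /rowP/(_ (Ordinal js)) := uN; rewrite !mxE => e; rewrite -[RHS]e.
rewrite mulmx_sum_row dotp_suml; apply: eq_bigr => i _.
by rewrite dotpZl mxE.
Qed.

Lemma continuous_sum (T : topologicalType) (I : Type) (r : seq I)
    (f : I -> T -> R) : (forall i, continuous (f i)) ->
  continuous (fun x => \sum_(i <- r) f i x).
Proof.
move=> fc; elim: r => [|a r IH] x.
  have -> : (fun x => \sum_(i <- [::]) f i x) = (fun=> 0).
    by apply/funext => y; rewrite big_nil.
  exact: cvg_cst.
have -> : (fun x => \sum_(i <- a :: r) f i x) = (f a \+ (fun x => \sum_(i <- r) f i x)).
  by apply/funext => y; rewrite big_cons.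
by apply: cvgD; [exact: fc | exact: IH].
Qed.

Lemma dotp_continuous : continuous (fun p : 'rV[R]_n * 'rV[R]_n => dotp p.1 p.2).
Proof.
apply: continuous_sum => i p; apply: cvgM.
  by apply: (@continuous_comp _ _ _ fst (fun X : 'rV[R]_n => X 0 i) p);
    [exact: cvg_fst|exact: coord_continuous].
by apply: (@continuous_comp _ _ _ snd (fun X : 'rV[R]_n => X 0 i) p);
    [exact: cvg_snd|exact: coord_continuous].
Qed.

Lemma dotp_continuousl Y : continuous (fun X => dotp X Y).
Proof.
apply: continuous_sum => i p; apply: (@cvgM _ _ (nbhs p) _ (fun X : 'rV[R]_n => X 0 i) (cst (Y 0 i))).
  exact: coord_continuous.
exact: cvg_cst.
Qed.

Lemma dotp_diag_continuous : continuous (fun X => dotp X X : R).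
Proof.
apply: continuous_sum => i p.
by apply: (@cvgM _ _ (nbhs p) _ (fun X : 'rV[R]_n => X 0 i) (fun X => X 0 i));
  exact: coord_continuous.
Qed.

Lemma closed_vspace (A : {vspace 'rV[R]_n}) : closed [set X : 'rV[R]_n | X \in A].
Proof.
have [M [_ MA]] := mem_mx A.
have -> : [set X : 'rV[R]_n | X \in A] =
    \bigcap_(i in [set: 'I_n]) [set X : 'rV[R]_n | dotp X (col i (cokermx M))^T = 0].
  apply/seteqP; split=> X /=.
    rewrite MA submxE => /eqP XM i _ /=; have /rowP/(_ i) := XM.
    by rewrite !mxE => e; rewrite -[RHS]e; apply: eq_bigr => j _; rewrite !mxE.
  move=> h; rewrite MA submxE; apply/eqP/rowP => i; rewrite !mxE -[RHS](h i) //.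
  by apply: eq_bigr => j _; rewrite !mxE.
apply: closed_bigI => i _.
apply: (@preimage_closed _ _ (fun X => dotp X _) [set x : R | x = 0]).
  by move=> X _; exact: dotp_continuousl.
exact: closed_eq.
Qed.

Lemma closed_orthocomp_in (A : {vspace 'rV[R]_n}) s : closed (orthocomp_in A s).
Proof.
have -> : orthocomp_in A s = [set X : 'rV[R]_n | X \in A] `&`
    \bigcap_(Y in [set Y : 'rV[R]_n | Y \in s]) [set X : 'rV[R]_n | dotp X Y = 0].
  apply/seteqP; split=> X; first by move/orthocomp_inP.
  by move=> h; apply/orthocomp_inP.
apply: closedI; first exact: closed_vspace.
apply: closed_bigI => Y _.
apply: (@preimage_closed _ _ (fun X => dotp X _) [set x : R | x = 0]).
  by move=> X _; exact: dotp_continuousl.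
exact: closed_eq.
Qed.

Lemma compact_unit_sphere (S : set 'rV[R]_n) :
  closed S -> compact (S `&` [set X : 'rV[R]_n | dotp X X = 1]).
Proof.
move=> cS; apply: bounded_closed_compact.
  exists 1; split => // x x1 X [_ /= X1].
  apply: le_trans (ltW x1); rewrite [leLHS]/Num.Def.normr /= mx_normrE.
  apply: bigmax_le => // -[i j] _ /=; rewrite (ord1 i).
  rewrite -(@ler_pXn2r _ 2%N) ?nnegrE // expr1n real_normK ?num_real //.
  by rewrite -X1 sqr_coord_le_dotp.
apply: closedI => //.
apply: (@preimage_closed _ _ (fun X => dotp X X) [set x : R | x = 1]).
  by move=> X _; exact: dotp_diag_continuous.
exact: closed_eq.
Qed.

(** The function omega only depends on the directions of its arguments, so it
    suffices to maximize the square of the scalar product on a product of two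
    unit spheres, which is compact. *)
Lemma omega_minimizers_nonempty (A B : {vspace 'rV[R]_n}) s t :
  (exists2 X, orthocomp_in A s X & X != 0) ->
  (exists2 Y, orthocomp_in B t Y & Y != 0) ->
  omega_minimizers (orthocomp_in A s) (orthocomp_in B t) !=set0.
Proof.
set S := orthocomp_in A s; set T := orthocomp_in B t.
have sZ (C : {vspace 'rV[R]_n}) u a X : orthocomp_in C u X -> orthocomp_in C u (a *: X).
  by case=> XC h; split => [|Y Yu]; rewrite ?memvZ // dotpZl h ?mulr0.
have unit X : X != 0 -> exists2 a, a != 0 & dotp (a *: X) (a *: X) = 1.
  rewrite -dotp_gt0 => X0; exists (Num.sqrt (dotp X X))^-1.
    by rewrite invr_eq0 sqrtr_eq0 -ltNge.
  rewrite dotpZl dotpZr mulrA -expr2 exprVn sqr_sqrtr ?mulVf ?gt_eqF //.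
  exact: ltW.
move=> [X0 SX0 X00] [Y0 TY0 Y00].
pose K (U : set 'rV[R]_n) := U `&` [set X : 'rV[R]_n | dotp X X = 1].
have KST0 : K S `*` K T !=set0.
  have [a _ aX] := unit _ X00; have [b _ bY] := unit _ Y00.
  by exists (a *: X0, b *: Y0); split; split => //; apply: sZ.
have KSTc : compact (K S `*` K T).
  by apply: compact_setX; apply: compact_unit_sphere; exact: closed_orthocomp_in.
have fc : {within K S `*` K T, continuous (fun p => dotp p.1 p.2 ^+ 2)}.
  apply: continuous_subspaceT => p.
  have -> : (fun p : 'rV[R]_n * 'rV[R]_n => dotp p.1 p.2 ^+ 2) =
     (fun p => dotp p.1 p.2 * dotp p.1 p.2) by apply/funext => q; rewrite expr2.
  by apply: cvgM; exact: dotp_continuous.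
have [[X Y] /set_mem[/= [SX X1] [TY Y1]] XYmax] := compact_EVT_max KST0 KSTc fc.
have ne0 Z : dotp Z Z = 1 -> Z != 0 by rewrite -dotp_eq0 => ->; exact: oner_neq0.
exists (X, Y); split; rewrite ?ne0 //= => X' Y' SX' X'0 TY' Y'0.
rewrite -(@ler_pXn2r _ 2%N) ?nnegrE ?omega_ge0 // !omega_sqr // ?(ne0 X) ?(ne0 Y) //.
rewrite X1 Y1 mulr1 divr1 lerD2l lerN2.
have [a a0 aX] := unit _ X'0; have [b b0 bY] := unit _ Y'0.
have := XYmax (a *: X', b *: Y').
rewrite inE /= => /(_ (conj (conj (sZ _ _ _ _ SX') aX) (conj (sZ _ _ _ _ TY') bY))).
apply: le_trans; rewrite dotpZl dotpZr.
rewrite dotpZl dotpZr in aX; rewrite dotpZl dotpZr in bY.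
rewrite ler_pdivrMr; last by rewrite mulr_gt0 ?dotp_gt0.
rewrite le_eqVlt; apply/orP; left; apply/eqP.
transitivity ((a * (a * dotp X' X')) * (b * (b * dotp Y' Y')) * dotp X' Y' ^+ 2).
  by rewrite aX bY !mul1r.
by ring.
Qed.

(** First-order optimality: if Z had a component along the second vector of
    the minimizing pair, then adding to the first vector a multiple of Z would
    decrease the angle. *)
Lemma omega_minimizer_orth (A B : {vspace 'rV[R]_n}) s t p Z :
  omega_minimizers (orthocomp_in A s) (orthocomp_in B t) p ->
  orthocomp_in A s Z -> dotp Z p.1 = 0 -> dotp Z p.2 = 0.
Proof.
case: p => X Y [/= SX X0 TY Y0 XYmin] SZ ZX; apply/eqP; apply: contraT => c0.
have Z0 : Z != 0 by apply: contraNneq c0 => ->; rewrite dotp0l.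
move: (X0) (Y0) (Z0); rewrite -!dotp_gt0 => pX pY pZ.
pose W := (dotp X Y / dotp X X) *: X + (dotp Z Y / dotp Z Z) *: Z.
pose w := dotp X Y ^+ 2 / dotp X X + dotp Z Y ^+ 2 / dotp Z Z.
have w1 : dotp X Y ^+ 2 / dotp X X < w.
  by rewrite ltrDl divr_gt0 // exprn_even_gt0.
have w0 : 0 < w by apply: le_lt_trans w1; rewrite divr_ge0 ?sqr_ge0 // ltW.
have WY : dotp W Y = w by rewrite /W dotpDl !dotpZl /w; ring.
have WW : dotp W W = w.
  rewrite /W !dotpE ZX (dotpC X Z) ZX /w; field.
  by rewrite !gt_eqF.
have SW : orthocomp_in A s W.
  case: SX SZ => XA Xs [ZA Zs]; split => [|V Vs]; first by rewrite memvD ?memvZ.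
  by rewrite /W dotpDl !dotpZl (Xs _ Vs) (Zs _ Vs) !mulr0 addr0.
have W0 : W != 0 by rewrite -dotp_gt0 WW.
have := XYmin _ _ SW W0 TY Y0.
rewrite -(@ler_pXn2r _ 2%N) ?nnegrE ?omega_ge0 // !omega_sqr // WY WW.
rewrite lerD2l lerN2 !invfM !mulrA ler_pM2r ?invr_gt0 //.
by rewrite expr2 mulfK ?gt_eqF // leNgt w1.
Qed.

End Omega.

(** * The successive angles of two subspaces *)

Section OmegaPairs.
Context {R : realType} {n : nat}.
Implicit Types (A B : {vspace 'rV[R]_n}) (X Y Z : 'rV[R]_n).

Lemma size_omega_pairs A B j : size (omega_pairs A B j) = j.
Proof. by elim: j => //= j IH; rewrite size_rcons IH. Qed.

Lemma exists_orthocomp_in A s : (size s < \dim A)%N ->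
  exists2 X, orthocomp_in A s X & X != 0.
Proof.
have [M [Mf MA]] := mem_mx A => sA.
have [u u0 us] := exists_orth M sA.
exists (u *m M); first by apply/orthocomp_inP; rewrite MA submxMl.
by apply: contraNneq u0 => uM; apply/eqP; apply: (row_free_inj Mf); rewrite uM mul0mx.
Qed.

Definition omega_pair A B i := last (0, 0) (omega_pairs A B i.+1).

Lemma omega_pair_minimizer A B i : (i < minn (\dim A) (\dim B))%N ->
  omega_minimizers (orthocomp_in A (unzip1 (omega_pairs A B i)))
                   (orthocomp_in B (unzip2 (omega_pairs A B i)))
                   (omega_pair A B i).
Proof.
rewrite leq_min => /andP[iA iB]; rewrite /omega_pair /= last_rcons; apply: xgetPex.
by apply: omega_minimizers_nonempty; apply: exists_orthocomp_in;
  rewrite size_map size_omega_pairs.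
Qed.

Lemma omega_pairs_map A B j :
  omega_pairs A B j = [seq omega_pair A B i | i <- iota 0 j].
Proof.
elim: j => // j IH; have -> : iota 0 j.+1 = rcons (iota 0 j) j by rewrite -cats1 -addn1 iotaD.
rewrite map_rcons -IH.
by rewrite /omega_pair /= last_rcons.
Qed.

Lemma orthocomp_in_pairsP A B i X :
  orthocomp_in A (unzip1 (omega_pairs A B i)) X <->
  X \in A /\ forall j, (j < i)%N -> dotp X (omega_pair A B j).1 = 0.
Proof.
rewrite omega_pairs_map /unzip1 -map_comp; split => [/orthocomp_inP[XA h]|[XA h]].
  split => // j ji; apply: h; apply/mapP; exists j => //.
  by rewrite mem_iota.
apply/orthocomp_inP; split => // Y /mapP[j]; rewrite mem_iota => ji ->.
exact: h.
Qed.

Lemma orthocomp_in_pairsP2 A B i Y :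
  orthocomp_in B (unzip2 (omega_pairs A B i)) Y <->
  Y \in B /\ forall j, (j < i)%N -> dotp Y (omega_pair A B j).2 = 0.
Proof.
rewrite omega_pairs_map /unzip2 -map_comp; split => [/orthocomp_inP[YB h]|[YB h]].
  split => // j ji; apply: h; apply/mapP; exists j => //.
  by rewrite mem_iota.
apply/orthocomp_inP; split => // Z /mapP[j]; rewrite mem_iota => ji ->.
exact: h.
Qed.

Lemma omega_pair_mono A B i j : (i <= j)%N -> (j < minn (\dim A) (\dim B))%N ->
  omega (omega_pair A B i).1 (omega_pair A B i).2 <=
  omega (omega_pair A B j).1 (omega_pair A B j).2.
Proof.
move=> ij jd; have [_ _ _ _ h] := omega_pair_minimizer (leq_ltn_trans ij jd).
have [/orthocomp_in_pairsP[XA X0] Xn0 /orthocomp_in_pairsP2[YB Y0] Yn0 _] :=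
  omega_pair_minimizer jd.
apply: h => //.
  by apply/orthocomp_in_pairsP; split => // l li; apply: X0; exact: leq_trans ij.
by apply/orthocomp_in_pairsP2; split => // l li; apply: Y0; exact: leq_trans ij.
Qed.

Lemma omegaj_ge0 j A B : 0 <= omegaj j A B.
Proof. exact: omega_ge0. Qed.

(** The successive minima increase, so the first vectors of the first k pairs,
    which are orthogonal, are all as close to B as the k-th minimum says. *)
Lemma omegaj_frame A B k : (k <= minn (\dim A) (\dim B))%N ->
  exists x y : 'I_k -> 'rV[R]_n,
    [/\ forall i, x i \in A, forall i, y i \in B,
        forall i j, dotp (x i) (x j) = (i == j)%:R &
        forall i, dotp (x i - y i) (x i - y i) <= omegaj k A B ^+ 2].
Proof.
case: k => [|k] kd; first by exists (fun _ => 0), (fun _ => 0); split => -[].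
have idx (i : 'I_k.+1) : (i < minn (\dim A) (\dim B))%N.
  by apply: leq_trans kd; exact: ltn_ord.
have minz (i : 'I_k.+1) := omega_pair_minimizer (idx i).
pose X (i : 'I_k.+1) := (omega_pair A B i).1.
pose Y (i : 'I_k.+1) := (omega_pair A B i).2.
have X0 i : X i != 0 by have [_] := minz i.
have Y0 i : Y i != 0 by have [_ _ _] := minz i.
have XA i : X i \in A by have [/orthocomp_in_pairsP[]] := minz i.
have YB i : Y i \in B by have [_ _ /orthocomp_in_pairsP2[]] := minz i.
have orth (i j : 'I_k.+1) : (j < i)%N -> dotp (X i) (X j) = 0.
  by have [/orthocomp_in_pairsP[_ h] _ _ _ _] := minz i; exact: h.
have /fin_all_exists [t tE] i := omega_nearest (X0 i) (Y0 i).
pose c i := (enorm (X i))^-1.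
have c2 i : c i ^+ 2 * dotp (X i) (X i) = 1.
  by rewrite /c exprVn enorm_sqr mulVf // gt_eqF ?dotp_gt0.
exists (fun i => c i *: X i), (fun i => c i *: (t i *: Y i)); split.
- by move=> i; rewrite memvZ.
- by move=> i; rewrite !memvZ.
- move=> i j; rewrite dotpZl dotpZr.
  have [->|] := eqVneq i j; first by rewrite mulrA -expr2 c2.
  rewrite -val_eqE neq_ltn => /orP[] ij; first by rewrite dotpC orth // !mulr0.
  by rewrite orth // !mulr0.
- move=> i; rewrite -scalerBr dotpZl dotpZr mulrA -expr2 tE mulrCA c2 mulr1.
  rewrite ler_pXn2r ?nnegrE ?omega_ge0 ?omegaj_ge0 //.
  rewrite /omegaj -/(omega_pair A B k); apply: omega_pair_mono => //.
  by rewrite -ltnS.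
Qed.

(** The component along each U of s is removed in turn.  As X is orthogonal to
    U, this can only bring the point nearer to X. *)
Lemma orthogonalize (B : {vspace 'rV[R]_n}) X Y (s : seq 'rV[R]_n) :
  Y \in B -> pairwise (fun U V => dotp U V == 0) s ->
  (forall U, U \in s -> [/\ U \in B, U != 0 & dotp X U = 0]) ->
  exists Y', [/\ Y' \in B, forall U, U \in s -> dotp Y' U = 0 &
    dotp (X - Y') (X - Y') <= dotp (X - Y) (X - Y)].
Proof.
move=> YB; elim: s => [|V s IH] /=; first by move=> _ _; exists Y.
move=> /andP[/allP Vs ps] h.
have [//|U Us|Y1 [Y1B Y1s le1]] := IH; first by apply: h; rewrite inE Us orbT.
have [VB V0 XV] := h V (mem_head _ _).
have vv : dotp V V != 0 by rewrite dotp_eq0.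
exists (Y1 - (dotp Y1 V / dotp V V) *: V); split.
- by rewrite memvB ?memvZ.
- move=> U; rewrite inE => /orP[/eqP ->|Us].
    by rewrite !dotpE mulfVK // subrr.
  by rewrite !dotpE Y1s // (eqP (Vs U Us)) mulr0 oppr0 addr0.
- apply: le_trans le1; rewrite -subr_ge0 !dotpE (dotpC Y1 X) (dotpC V X) XV.
  rewrite (dotpC V Y1).
  set a := dotp X Y1; set b := dotp Y1 V; set v := dotp V V.
  have -> : forall z, z = b ^+ 2 / v -> 0 <= z.
    by move=> z ->; rewrite divr_ge0 ?sqr_ge0 // dotp_ge0.
  by [].
  by field.
Qed.

(** One half of the min-max principle.  The row space of F contains some X that
    is orthogonal to the first vectors of the first k - 1 pairs; by optimality X
    is also orthogonal to their second vectors, and a point of B near X can be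
    made orthogonal to these. *)
Lemma omegaj_le A B k (F : 'M[R]_(k, n)) (delta : R) :
  (0 < k <= minn (\dim A) (\dim B))%N -> 0 <= delta < 1 ->
  row_free F -> (forall u : 'rV_k, u *m F \in A) ->
  (forall u : 'rV_k, exists2 Y, Y \in B &
     dotp (u *m F - Y) (u *m F - Y) <= delta ^+ 2 * dotp (u *m F) (u *m F)) ->
  omegaj k A B <= delta.
Proof.
case: k F => // k F /= kd /andP[d0 d1] Ff FA near.
have [_ _ _ _ min] := omega_pair_minimizer kd.
have [|u u0 us] := exists_orth F (s := unzip1 (omega_pairs A B k)).
  by rewrite size_map size_omega_pairs.
set X := u *m F in us.
have Xn0 : X != 0.
  by apply: contraNneq u0 => uM; apply/eqP; apply: (row_free_inj Ff); rewrite -/X uM mul0mx.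
have SX : orthocomp_in A (unzip1 (omega_pairs A B k)) X.
  by apply/orthocomp_inP; split => //; exact: FA.
have XY j : (j < k)%N -> dotp X (omega_pair A B j).2 = 0.
  move=> jk; have jd := ltn_trans jk kd.
  move/orthocomp_in_pairsP: SX => [XA h].
  apply: (omega_minimizer_orth (omega_pair_minimizer jd)); last exact: h.
  by apply/orthocomp_in_pairsP; split => // l lj; apply: h; exact: ltn_trans jk.
have [Y YB XYd] := near u.
pose s := [seq (omega_pair A B i).2 | i <- iota 0 k].
have [||Y' [Y'B Y's XY']] := @orthogonalize B X Y s YB.
- apply/(pairwiseP 0) => i j; rewrite !inE size_map size_iota => ik jk ij.
  rewrite !(nth_map 0%N) ?size_iota // !nth_iota // !add0n.
  have [_ _ /orthocomp_in_pairsP2[_ h] _ _] := omega_pair_minimizer (ltn_trans jk kd).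
  by rewrite dotpC h.
- move=> U /mapP[j]; rewrite mem_iota add0n => jk ->.
  have [_ _ /orthocomp_in_pairsP2[UB _] U0 _] := omega_pair_minimizer (ltn_trans jk kd).
  by split => //; exact: XY.
have {XYd}XY'd := le_trans XY' XYd.
have Y'0 : Y' != 0.
  apply: contraTneq XY'd => ->; rewrite subr0 -ltNge gtr_pMl ?dotp_gt0 //.
  by rewrite expr_lt1.
have TY : orthocomp_in B (unzip2 (omega_pairs A B k)) Y'.
  apply/orthocomp_in_pairsP2; split => // j jk; apply: Y's; apply/mapP; exists j => //.
  by rewrite mem_iota.
apply: (le_trans (min _ _ SX Xn0 TY Y'0)).
rewrite -(@ler_pXn2r _ 2%N) ?nnegrE ?omega_ge0 //.
have := le_trans (omega_le_dist Xn0 Y'0) XY'd.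
by rewrite ler_pM2r ?dotp_gt0.
Qed.

End OmegaPairs.

(** * Heights of rational subspaces *)

Section Heights.
Local Open Scope classical_set_scope.
Local Open Scope ring_scope.
Context {R : realType} {n : nat}.
Implicit Types B : {vspace 'rV[R]_n}.

Notation toR := (map_mx (@intmul R 1)).

Lemma toR1 r : toR (1%:M : 'M[int]_r) = 1%:M.
Proof. by rewrite map_mx1. Qed.

(** The rows of X are part of a Z-basis of Z^n, once they are independent. *)
Definition primitive e (X : 'M[int]_(e, n)) :=
  forall (x : 'rV[int]_n) (u : 'rV[R]_e), toR x = u *m toR X ->
    exists u' : 'rV[int]_e, u = toR u'.

Lemma primitive_zbasis e B (X : 'M[int]_(e, n)) :
  row_free (toR X) -> primitive X ->
  (forall x, (x \in B) = (x <= toR X)%MS) -> zbasis B X.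
Proof.
move=> Xf pX BX; split.
  move=> a b e'; apply: (@toR_inj R); apply: (row_free_inj Xf).
  by rewrite -!toR_mul e'.
apply/seteqP; split => [v|_ [a _ <-]] /=; last by rewrite BX toR_mul submxMl.
rewrite BX => /submxP[u uE]; have [a aE] := pX _ _ uE.
by exists a => //; apply: (@toR_inj R); rewrite toR_mul uE aE.
Qed.

(** The matrices of the two changes of basis are integer and inverse to each
    other, so their determinants are 1 or -1. *)
Lemma zbasis_wedge_norm e B (X Y : 'M[int]_(e, n)) :
  zbasis B X -> zbasis B Y ->
  wedge_norm (toR Y) = wedge_norm (toR X).
Proof.
move=> zX zY.
have comb (U V : 'M[int]_(e, n)) : zbasis B U -> zbasis B V ->
    exists T : 'M[int]_e, V = T *m U.
  move=> [_ rU] [_ rV].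
  have /fin_all_exists[t tE] i : exists t : 'rV[int]_e, row i V = t *m U.
    have : range (fun a : 'rV[int]_e => a *m V) (row i V).
      by exists (delta_mx 0 i) => //; rewrite rowE.
    by rewrite -rV rU => -[t _ <-]; exists t.
  exists (\matrix_i t i); apply/row_matrixP => i.
  by rewrite row_mul rowK tE.
have [T YT] := comb _ _ zX zY; have [T' XT'] := comb _ _ zY zX.
have TT : T' *m T = 1%:M.
  apply/row_matrixP => i; apply: (proj1 zX).
  by rewrite -!row_mul mul1mx -mulmxA -YT -XT'.
have /intUnitRing.unitzPl dT : \det T' * \det T = 1 by rewrite -det_mulmx TT det1.
have {dT} dT : (\det T) ^+ 2 = 1.
  by move: dT => /orP[] /eqP ->.
rewrite /wedge_norm; congr (Num.sqrt _); apply: eq_bigr => f _.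
rewrite /wedge_coord YT toR_mul -mulmx_colsub det_mulmx det_toR exprMn.
by rewrite -rmorphXn /= dT mul1r.
Qed.

Lemma common_denominator r (M : 'M[rat]_(r, n)) :
  exists (D : int) (N : 'M[int]_(r, n)), D != 0 /\ map_mx intr N = D%:~R *: M.
Proof.
pose D := \prod_(p : 'I_r * 'I_n) denq (M p.1 p.2).
exists D, (\matrix_(i, j) (numq (M i j) * \prod_(p | p != (i, j)) denq (M p.1 p.2))).
split; first by apply/prodf_neq0 => p _; exact: denq_neq0.
apply/matrixP => i j; rewrite !mxE /D [in RHS](bigD1 (i, j)) //= !intrM numqE.
by rewrite [RHS]mulrC mulrA.
Qed.

(** In the Smith normal form N = L D P of an integer matrix N with row space B,
    the first rows of P have the same span as N, and P is unimodular. *)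
Lemma rational_primitive_basis B : rational_space B ->
  exists X : 'M[int]_(\dim B, n),
    [/\ row_free (toR X), primitive X & forall x, (x \in B) = (x <= toR X)%MS].
Proof.
move=> [s bs]; have sz : size s = \dim B 
  by case/andP: (bs) => /eqP <- /eqP ->; rewrite size_map.
rewrite -sz; move: sz => _; set r := size s.
pose M : 'M[rat]_(r, n) := \matrix_i s`_i.
have [Mf BM] := @basis_mx _ _ r B [tuple of map (map_mx (@ratr R)) (in_tuple s)] bs.
have {Mf BM} [Mf BM] : row_free M /\ forall x, (x \in B) = (x <= map_mx (@ratr R) M)%MS.
  have e : \matrix_(i < r) [seq map_mx (@ratr R) v | v <- in_tuple s]`_i = map_mx (@ratr R) M.
    by apply/row_matrixP => i; rewrite -map_row !rowK (nth_map 0).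
  by move: Mf; rewrite -(row_free_map (@ratr R)) -e.
have [D [N [D0 NM]]] := common_denominator M.
have toRN : toR N = D%:~R *: map_mx (@ratr R) M.
  apply/matrixP => i j; have /matrixP/(_ i j) := NM; rewrite !mxE => e.
  by rewrite -[LHS](ratr_int R) e rmorphM /= ratr_int.
have BN x : (x \in B) = (x <= toR N)%MS.
  by rewrite BM toRN (eqmx_scale _ _) // intr_eq0.
have Nf : row_free (toR N).
  rewrite /row_free toRN (eqmx_scale _ _) ?intr_eq0 //.
  by rewrite -/(row_free _) row_free_map.
have [L Lu [P Pu [d _ NE]]] := int_Smith_normal_form N.
pose E : 'M[int]_(r, n) := \matrix_(i, j) (i == j :> nat)%:R.
pose Dg : 'M[int]_r := diag_mx (\row_i d`_i).
have NX : N = (L *m Dg) *m (E *m P).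
  rewrite NE !mulmxA; congr (_ *m _); rewrite -mulmxA; congr (_ *m _).
  by apply/matrixP => i j; rewrite mul_diag_mx !mxE mulr_natr.
have rn : (r <= n)%N by rewrite -(eqP Nf) rank_leq_col.
have EE : E *m E^T = 1%:M.
  apply/matrixP => i j; rewrite !mxE (bigD1 (widen_ord rn i)) //= big1.
    by rewrite !mxE eqxx mul1r addr0 eq_sym.
  move=> k; rewrite -val_eqE /= => ki; rewrite !mxE eq_sym (negPf ki) mul0r.
  by [].
have XG : (E *m P) *m (invmx P *m E^T) = 1%:M by rewrite mulmxA mulmxK // EE.
exists (E *m P); split.
- by apply/row_freeP; exists (toR (invmx P *m E^T)); rewrite -toR_mul XG toR1.
- move=> x u uE; exists (x *m (invmx P *m E^T)).
  by rewrite toR_mul uE -mulmxA -toR_mul XG toR1 mulmx1.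
have sub : (toR N <= toR (E *m P))%MS by rewrite NX toR_mul submxMl.
have : (toR N == toR (E *m P))%MS.
  have := mxrank_leqif_eq sub; case=> le <-; rewrite eqn_leq le /=.
  by rewrite (eqP Nf) rank_leq_row.
by move=> /eqmxP e x; rewrite BN e.
Qed.

Lemma rational_of_int r (X : 'M[int]_(r, n)) : row_free (toR X) ->
  exists B, rational_spaces r B /\ forall x, (x \in B) = (x <= toR X)%MS.
Proof.
move=> Xf; pose t := [tuple row i (toR X) | i < r].
have tE (i : 'I_r) : t`_i = row i (toR X) by rewrite -tnth_nth tnth_mktuple.
have tB : basis_of <<t>>%VS t.
  apply/andP; split; first by rewrite eqxx.
  apply/freeP => u u0 i.
  have : \row_j u j = 0.
    apply: (row_free_inj Xf); rewrite mul0mx mulmx_sum_row -[RHS]u0.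
    by apply: eq_bigr => j _; rewrite mxE tE.
  by move=> /rowP/(_ i); rewrite !mxE.
exists <<t>>%VS; split; last first.
  move=> x; have [_ ->] := basis_mx tB.
  by congr (_ <= _)%MS; apply/row_matrixP => i; rewrite rowK tE.
split; last exact: size_basis tB.
exists [seq row i (map_mx intr X) | i <- enum 'I_r].
rewrite -map_comp; congr (basis_of _ _): tB.
apply: eq_map => i; apply/rowP => j; rewrite !mxE /=.
by rewrite ratr_int.
Qed.

Lemma height_primitive e B (X : 'M[int]_(e, n)) :
  \dim B = e -> row_free (toR X) -> primitive X ->
  (forall x, (x \in B) = (x <= toR X)%MS) ->
  height B = wedge_norm (toR X).
Proof.
move=> eE; move: X; rewrite -{e}eE => X Xf pX BX.
have zX := primitive_zbasis Xf pX BX.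
apply: (zbasis_wedge_norm zX).
by apply: xgetPex; exists X.
Qed.

Lemma height_rational B : rational_space B ->
  exists X : 'M[int]_(\dim B, n),
    [/\ row_free (toR X), forall x, (x \in B) = (x <= toR X)%MS &
        height B = wedge_norm (toR X)].
Proof.
move=> /rational_primitive_basis[X [Xf pX BX]]; exists X; split => //.
exact: height_primitive pX BX.
Qed.

Lemma height_ge1 B : rational_space B -> 1 <= height B.
Proof.
move=> /height_rational[X [Xf _ ->]].
by apply: (minors_ge1 Xf); exact: wedge_norm_ge.
Qed.

(** Whether a row of Y lies in the row space of X is decided by minors that
    expand in terms of the maximal minors of X, hence of those of Y. *)
Lemma minors_determine_rowspace r (X Y : 'M[R]_(r, n)) :
  row_free X ->
  (forall f : 'I_r -> 'I_n, \det (colsub f X) = \det (colsub f Y)) ->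
  (Y <= X)%MS.
Proof.
move=> Xf XY; apply/row_subP => i; apply: contraT => iX.
have [f /eqP[]] := row_free_minor (row_free_col_mx Xf iX).
transitivity (\det (colsub f (col_mx (row i Y) Y))).
  by rewrite !det_colsub_col_mx; apply: eq_bigr => j _; rewrite XY.
rewrite (det_colsub_addrow _ _ (row_sub i Y)) subrr det_colsub_col_mx.
by rewrite big1 // => j _; rewrite mxE mul0r.
Qed.

(** A rational space is determined by its Pluecker coordinates with respect to
    a Z-basis, and these are bounded integers. *)
Lemma finite_height_le e (M : R) :
  finite_set [set B : {vspace 'rV[R]_n} | rational_spaces e B /\ height B <= M].
Proof.
set S := [set B | _].
pose K := `|Num.ceil M|%N.
(* Matrices of the right size are needed for all B; 0 is used outside S. *)
have /choice[X XP] : forall B, exists X : 'M[int]_(e, n), S B ->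
    [/\ row_free (toR X), forall x, (x \in B) = (x <= toR X)%MS &
        forall f : {ffun 'I_e -> 'I_n}, `|\det (colsub f X)| <= K%:Z].
  move=> B; have [[[rB eB] BM]|nS] := pselect (S B); last by exists 0.
  have [X] := height_rational rB; move: X; rewrite eB => X [Xf BX hB].
  exists X => _; split => // f; have := wedge_norm_ge (toR X) f.
  rewrite -hB => /le_trans/(_ BM).
  rewrite minor_toR -intr_norm => /le_trans/(_ (ceil_ge M)); rewrite ler_int => /le_trans; apply.
  exact: ler_norm.
(* The shift by K makes the minors nonnegative. *)
pose code B : {ffun {ffun 'I_e -> 'I_n} -> 'I_(K + K).+1} :=
  [ffun f : {ffun 'I_e -> 'I_n} => inord (absz (\det (colsub f (X B)) + K%:Z)%R)].
have inj : {in S &, injective code}.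
  move=> B C /set_mem SB /set_mem SC /ffunP BC.
  have [Bf BX Bb] := XP _ SB; have [Cf CX Cb] := XP _ SC.
  have e' (f : 'I_e -> 'I_n) : \det (colsub f (toR (X B))) = \det (colsub f (toR (X C))).
    rewrite !minor_toR; congr (_%:~R).
    have fE (Y : 'M[int]_(e, n)) : colsub [ffun i => f i] Y = colsub f Y.
      by apply/matrixP => i j; rewrite !mxE ffunE.
    have dec (b c : int) : `|b| <= K%:Z -> `|c| <= K%:Z ->
        (inord (absz (b + K%:Z)) : 'I_(K + K).+1) = inord (absz (c + K%:Z)) -> b = c.
      by move=> hb hc /(congr1 val) /=; rewrite !inordK; lia.
    have := BC [ffun i => f i]; rewrite !ffunE -!fE; apply: dec; [exact: Bb|exact: Cb].
  apply/vspaceP => x; rewrite BX CX.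
  by apply/idP/idP => /submx_trans; apply; apply: minors_determine_rowspace.
have /eq_finite_set <- := inj_card_eq inj.
exact: finite_finset.
Qed.

End Heights.

(** * Maximal products of consecutive terms *)

Section Windows.
Context {R : realType} (m : nat).
Implicit Types (b : nat -> R).

Lemma le_bigmax_list (I : eqType) (s : seq I) (F : I -> R) x i : i \in s ->
  F i <= \big[Num.max/x]_(j <- s) F j.
Proof.
elim: s => // a s IH; rewrite inE big_cons le_max => /orP[/eqP ->|/IH ->].
  by rewrite lexx.
by rewrite orbT.
Qed.

Lemma bigmin_list_le (I : eqType) (s : seq I) (F : I -> R) x i : i \in s ->
  \big[Num.min/x]_(j <- s) F j <= F i.
Proof.
elim: s => // a s IH; rewrite inE big_cons ge_min => /orP[/eqP ->|/IH ->].
  by rewrite lexx.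
by rewrite orbT.
Qed.

Lemma bigmax_list_attained (I : eqType) (s : seq I) (F : I -> R) x :
  \big[Num.max/x]_(j <- s) F j = x \/
  exists2 i, i \in s & \big[Num.max/x]_(j <- s) F j = F i.
Proof.
elim: s => [|a s IH]; first by left; rewrite big_nil.
rewrite big_cons /Num.max; case: ifP => _; last by right; exists a; rewrite ?mem_head.
case: IH => [->|[i si ->]]; [by left|right; exists i => //].
by rewrite inE si orbT.
Qed.

Lemma min_upto_le b l : (1 <= l <= m)%N -> min_upto m b <= b l.
Proof. by move=> lm; apply: bigmin_list_le; rewrite mem_index_iota. Qed.

Lemma max_upto_ge b l : (1 <= l <= m)%N -> b l <= max_upto m b.
Proof. by move=> lm; apply: le_bigmax_list; rewrite mem_index_iota. Qed.

Lemma min_le_max_upto b : (1 <= m)%N -> min_upto m b <= max_upto m b.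
Proof.
by move=> m1; apply: (@le_trans _ _ (b 1%N)); [apply: min_upto_le|apply: max_upto_ge];
  rewrite m1.
Qed.

Lemma window_prodS b v l : window_prod b v.+1 l = window_prod b v l * b (l + v.+1)%N.
Proof. by rewrite /window_prod big_nat_recr. Qed.

Lemma window_prod_recl b v l : window_prod b v.+1 l = b l.+1 * window_prod b v l.+1.
Proof.
rewrite /window_prod big_nat_recl // addn1; congr (_ * _).
by apply: eq_big_nat => i _; rewrite addnS addSn.
Qed.

Lemma window_prod0 b l : window_prod b 0 l = 1.
Proof. by rewrite /window_prod big_geq. Qed.

Lemma window_prod_bounds b v l : 0 <= min_upto m b -> (l + v <= m)%N ->
  min_upto m b ^+ v <= window_prod b v l <= max_upto m b ^+ v.
Proof.
move=> m0; elim: v => [|v IH] lv; first by rewrite window_prod0 !expr0 lexx.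
rewrite addnS in lv; have /andP[h1 h2] := IH (ltnW lv).
rewrite window_prodS addnS !exprSr.
have lm : (1 <= (l + v).+1 <= m)%N by [].
have b0 := le_trans m0 (min_upto_le b lm).
have w0 : 0 <= window_prod b v l by apply: le_trans h1; exact: exprn_ge0.
rewrite !ler_pM ?exprn_ge0 ?max_upto_ge ?min_upto_le //.
Qed.

Definition window_max b v := \big[Num.max/window_prod b v 0]_(0 <= l < (m - v).+1) window_prod b v l.

Lemma window_prod_le_max b v l : (l + v <= m)%N -> window_prod b v l <= window_max b v.
Proof. by move=> lv; apply: le_bigmax_list; rewrite mem_index_iota; lia. Qed.

Lemma window_max_attained b v : (v <= m)%N ->
  exists2 l, (l + v <= m)%N & window_max b v = window_prod b v l.
Proof.
move=> vm; rewrite /window_max.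
have [->|[l]] := bigmax_list_attained (index_iota 0 (m - v).+1) (window_prod b v) (window_prod b v 0).
  by exists 0%N.
by rewrite mem_index_iota => lv ->; exists l => //; lia.
Qed.

Lemma window_max0 b : window_max b 0 = 1.
Proof. by have [l _ ->] := window_max_attained b (leq0n m); rewrite window_prod0. Qed.

Lemma window_max_bounds b v : 0 <= min_upto m b -> (v <= m)%N ->
  min_upto m b ^+ v <= window_max b v <= max_upto m b ^+ v.
Proof. by move=> m0 vm; have [l lv ->] := window_max_attained b vm; exact: window_prod_bounds. Qed.

(** A window of maximal product and length v < m can be extended by one more
    term on at least one side. *)
Lemma window_max_step b v : 0 <= min_upto m b -> (v < m)%N ->
  min_upto m b * window_max b v <= window_max b v.+1.
Proof.
move=> m0 vm; have [l lv ->] := window_max_attained b (ltnW vm).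
have w0 : 0 <= window_prod b v l.
  by have /andP[h _] := window_prod_bounds m0 lv; apply: le_trans h; exact: exprn_ge0.
have [lv'|] := leqP (l + v.+1) m.
  apply: le_trans (window_prod_le_max b lv').
  by rewrite window_prodS mulrC ler_wpM2l // min_upto_le //; lia.
case: l lv w0 => [|l] lv w0 h; first lia.
have lv' : (l + v.+1 <= m)%N by lia.
apply: le_trans (window_prod_le_max b lv').
by rewrite window_prod_recl ler_wpM2r // min_upto_le //; lia.
Qed.

End Windows.

Section KInequalities.
Context (R : realType) (d m : nat) (c1 c2 : R) (beta : nat -> nat -> R).
Hypotheses (hd : (1 <= d)%N) (hm : (1 <= m)%N)
  (hc1 : c1 = (1 + 1 / m%:R) `^ (1 / d%:R))
  (hc2 : 1 < c2 < c1)
  (hbeta1 : min_upto m (beta 1%N) > (3 * d%:R) `^ (c2 / (c2 - 1)))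
  (hbeta1' : min_upto m (beta 1%N) `^ c1 > max_upto m (beta 1%N) `^ c2)
  (hbeta : forall i : nat, (1 <= i <= d - 1)%N ->
     min_upto m (beta i) `^ c1 > max_upto m (beta i.+1) /\
     min_upto m (beta i.+1) > max_upto m (beta i) `^ c2).

Let mn i := min_upto m (beta i).
Let mx i := max_upto m (beta i).

Let c2_gt1 : 1 < c2. Proof. by case/andP: hc2. Qed.
Let c1_gt1 : 1 < c1. Proof. by case/andP: hc2 => ? ?; lra. Qed.

Let d3 : (1 : R) <= 3 * d%:R.
Proof. have : (1 : R) <= d%:R by rewrite ler1n. lra. Qed.

Let mn1 : 1 < mn 1.
Proof.
apply: le_lt_trans hbeta1; rewrite -[leLHS](powRr0 (3 * d%:R)); apply: ler_powR => //.
by have := c2_gt1 => ?; rewrite divr_ge0 //; lra.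
Qed.

Ltac slra := move: c2_gt1 c1_gt1 d3 mn1 => ????; lra.
Let mn_mx i : mn i <= mx i. Proof. exact: min_le_max_upto. Qed.

Let mn_step i : (1 <= i < d)%N -> 1 < mn i -> mx i `^ c2 < mn i.+1 /\ mn i < mn i.+1.
Proof.
move=> /andP[i1 id] mi; have [|_ h] := hbeta (i := i); first by rewrite i1; lia.
split => //; apply: le_lt_trans h; apply: le_trans (mn_mx i) _.
by apply: le1r_powR; rewrite ltW // (lt_le_trans mi).
Qed.

Let mn_gt1 i : (1 <= i <= d)%N -> mn 1 <= mn i.
Proof.
case: i => // i; elim: i => [|i IH] id; first exact: lexx.
have h : mn 1 <= mn i.+1 by apply: IH; lia.
have q : (1 <= i.+1 < d)%N by lia.
by have [_ /ltW] := mn_step q (lt_le_trans mn1 h); exact: le_trans.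
Qed.

Let mx_step i j : (1 <= i < j)%N -> (j <= d)%N -> mx i `^ c2 < mn j.
Proof.
case: j => [|j]; first lia.
elim: j => [|j IH]; first lia.
move=> /andP[i1]; rewrite ltnS leq_eqVlt => /orP[/eqP <-|ij] jd.
  have q : (1 <= i < d)%N by lia.
  have q' : (1 <= i <= d)%N by lia.
  by have [] := mn_step q (lt_le_trans mn1 (mn_gt1 q')).
apply: (lt_trans (IH _ _)); try lia.
have q : (1 <= j.+1 < d)%N by lia.
have q' : (1 <= j.+1 <= d)%N by lia.
by have [] := mn_step q (lt_le_trans mn1 (mn_gt1 q')).
Qed.

Let mn1_pow : 3 * d%:R <= mn 1 `^ (c2 - 1).
Proof.
apply: (@le_trans _ _ ((3 * d%:R) `^ c2)); first by apply: le1r_powR; rewrite // ltW.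
have e : c2 = c2 / (c2 - 1) * (c2 - 1) :> R by rewrite divfK // subr_eq0 gt_eqF.
rewrite {1}e powRrM; apply: ge0_ler_powR; rewrite ?nnegrE ?powR_ge0 //.
- by rewrite subr_ge0 ltW.
- by apply: ltW; apply: lt_trans mn1.
- exact: ltW.
Qed.

Let mx_top i : (1 <= i <= d)%N -> mx i `^ c2 < mn 1 `^ (c1 ^+ i).
Proof.
case: i => // i; elim: i => [|i IH] id; first by rewrite expr1.
have {IH} h : mx i.+1 `^ c2 < mn 1 `^ (c1 ^+ i.+1) by apply: IH; lia.
have i1 : 1 < mn i.+1 by apply: (lt_le_trans mn1); apply: mn_gt1; lia.
have mx1 : 1 < mx i.+1 by apply: lt_le_trans i1 _.
have [|h' _] := hbeta (i := i.+1); first lia.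
have c20 : 0 < c2 by slra.
have c10 : 0 < c1 by slra.
have mx0 : 0 <= mx i.+2.
  by apply: le_trans (mn_mx _); apply: le_trans (mn_gt1 _); [slra|lia].
apply: (@lt_le_trans _ _ ((mn i.+1 `^ c1) `^ c2)).
  by apply: gt0_ltr_powR; rewrite ?nnegrE ?powR_ge0.
rewrite -powRrM mulrC powRrM exprS mulrC powRrM.
apply: ge0_ler_powR; rewrite ?nnegrE ?powR_ge0 ?ltW //.
apply: le_lt_trans h; apply: ge0_ler_powR; rewrite ?nnegrE ?(ltW c20) // ltW //; slra.
Qed.

Let c1_pow i : (i <= d)%N -> c1 ^+ i <= 1 + 1 / m%:R.
Proof.
move=> id; have m0 : (0 : R) < m%:R by rewrite ltr0n.
have m1 : (0 : R) <= 1 + 1 / m%:R by rewrite addr_ge0 // divr_ge0 // ltW.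
apply: (@le_trans _ _ (c1 ^+ d)); first by rewrite ler_weXn2l // ltW.
rewrite hc1 -powR_mulrn ?powR_ge0 // -powRrM divfK ?powRr1 //.
by rewrite pnatr_eq0 -lt0n.
Qed.

Let c1_le2 : c1 <= 2.
Proof.
have := c1_pow hd; rewrite expr1 => /le_trans; apply.
have : (1 : R) <= m%:R by rewrite ler1n.
by move=> m1; rewrite -[leRHS]/(1 + 1) lerD2l ler_pdivrMr; slra.
Qed.

(** As c2 < c1 <= 2, the exponent c2 / (c2 - 1) is at least 2, and the lower
    bound of the first row of beta is at least (3 d) ^ 2. *)
Lemma min_upto_ge9 i : (1 <= i <= d)%N -> 9 <= mn i.
Proof.
move=> id; apply: le_trans (mn_gt1 id); apply: le_trans (ltW hbeta1).
apply: (@le_trans _ _ ((3 * d%:R) `^ 2)).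
  rewrite powR_mulrn; last slra.
  have : (1 : R) <= d%:R by rewrite ler1n.
  by move=> d1; rewrite expr2; nra.
apply: ler_powR => //; have c20 : 0 < c2 - 1 by slra.
rewrite ler_pdivlMr //; have /andP[_ ?] := hc2; have ? := c1_le2; slra.
Qed.

Let three_d_mx i v : (1 <= i <= d)%N -> (0 < v)%N ->
  3 * d%:R * mx i ^+ v <= (mx i ^+ v) `^ c2.
Proof.
move=> id v0; have mi : 1 < mx i by apply: lt_le_trans mn1 _; apply: le_trans (mn_gt1 id) _.
have mv : mx i <= mx i ^+ v by rewrite ler_eXnr // ltW.
have -> : c2 = (c2 - 1) + 1 by slra.
rewrite powRD; last by apply/implyP => _; rewrite gt_eqF // (lt_trans _ (lt_le_trans mi mv)).
rewrite powRr1 ?exprn_ge0 //; last slra.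
rewrite ler_wpM2r ?exprn_ge0 //; first slra.
apply: le_trans mn1_pow _; apply: ge0_ler_powR; rewrite ?nnegrE; try slra.
by apply: le_trans mv; apply: le_trans (mn_gt1 id) _.
Qed.

Let powRXn (x y : R) v : 0 <= x -> (x ^+ v) `^ y = (x `^ y) ^+ v.
Proof. by move=> x0; rewrite -!powR_mulrn ?powR_ge0 // -!powRrM mulrC. Qed.

Let mx_ge0 i : (1 <= i <= d)%N -> 0 <= mx i.
Proof. by move=> id; apply: le_trans (mn_mx i); have := mn_gt1 id; slra. Qed.

(** The terms of any row are at most the power c1 ^ d / c2 of the smallest term
    of the first row, and c1 ^ d = 1 + 1 / m turns v factors into fewer than
    v + 1; the exponent c2 > 1 leaves room for the factor 3 d. *)
Lemma three_d_mx_le i j v : (1 <= i <= d)%N -> (1 <= j <= d)%N -> (v < m)%N ->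
  3 * d%:R * mx i ^+ v <= mn j ^+ v.+1.
Proof.
move=> id jd vm; apply: (@le_trans _ _ (mn 1 ^+ v.+1)); last first.
  by rewrite ler_pXn2r ?nnegrE ?mn_gt1 //; have := mn_gt1 jd; slra.
case: v vm => [|v] vm.
  rewrite expr0 mulr1 expr1; apply: le_trans mn1_pow _.
  by apply: ler1_powR; rewrite ?ltW //; have /andP[_ ?] := hc2; have ? := c1_le2; slra.
apply: le_trans (three_d_mx id _) _ => //.
rewrite powRXn ?mx_ge0 //.
apply: (@le_trans _ _ ((mn 1 `^ (1 + 1 / m%:R)) ^+ v.+1)).
  rewrite ler_pXn2r ?nnegrE ?powR_ge0 //; apply: le_trans (ltW (mx_top id)) _.
  by apply: ler_powR; [exact: ltW | apply: c1_pow; case/andP: id].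
rewrite -!powR_mulrn ?powR_ge0 //; last by slra.
rewrite -powRrM; apply: ler_powR; first exact: ltW.
have m0 : (0 : R) < m%:R by rewrite ltr0n.
have e : 1 / m%:R * v.+1%:R <= 1 :> R.
  by rewrite mulrAC ler_pdivrMr // !mul1r ler_nat ltnW.
rewrite mulrDl; have := @natr1 R v.+1; lra.
Qed.

Local Notation K i v := (window_max m (beta i) v).

Let mn_ge0 i : (1 <= i <= d)%N -> 0 <= mn i.
Proof. by move=> id; have := mn_gt1 id; slra. Qed.

(** Compares blocks that receive parts of e of different sizes. *)
Lemma window_max_gap i j v : (1 <= i <= d)%N -> (1 <= j <= d)%N -> (v < m)%N ->
  3 * d%:R * K i v <= K j v.+1.
Proof.
move=> id jd vm.
have /andP[_ h1] := window_max_bounds (mn_ge0 id) (ltnW vm).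
have /andP[h2 _] := window_max_bounds (mn_ge0 jd) vm.
apply: le_trans h2; apply: le_trans (three_d_mx_le id jd vm).
by rewrite ler_wpM2l //; slra.
Qed.

(** Compares blocks that receive equal parts of e; it also makes the last k
    blocks the optimal ones. *)
Lemma window_max_gap_row i j v : (1 <= i < j)%N -> (j <= d)%N -> (0 < v <= m)%N ->
  3 * d%:R * K i v <= K j v.
Proof.
move=> ij jd /andP[v0 vm].
have id : (1 <= i <= d)%N by lia.
have jd' : (1 <= j <= d)%N by lia.
have /andP[_ h1] := window_max_bounds (mn_ge0 id) vm.
have /andP[h2 _] := window_max_bounds (mn_ge0 jd') vm.
apply: le_trans h2; apply: (@le_trans _ _ (3 * d%:R * mx i ^+ v)).
  by rewrite ler_wpM2l //; slra.
apply: le_trans (three_d_mx id v0) _; rewrite powRXn ?mx_ge0 //.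
by rewrite ler_pXn2r ?nnegrE ?powR_ge0 ?mn_ge0 // ltW // mx_step.
Qed.

Lemma window_max_mono i j v : (1 <= i <= j)%N -> (j <= d)%N -> (0 < v <= m)%N ->
  K i v <= K j v.
Proof.
move=> /andP[i1]; rewrite leq_eqVlt => /orP[/eqP -> //|ij] jd vm.
have ij' : (1 <= i < j)%N by rewrite i1.
apply: le_trans (window_max_gap_row ij' jd vm).
have id : (1 <= i <= d)%N by lia.
have /andP[h _] := window_max_bounds (mn_ge0 id) (proj2 (andP vm)).
by rewrite ler_peMl // (le_trans _ h) // exprn_ge0 // mn_ge0.
Qed.

End KInequalities.

(** * The sequence of exponents *)

Section Exponents.
Context {R : realType} (m P : nat) (b : nat -> R) (v : nat -> nat).
Hypotheses (m1 : (1 <= m)%N) (b9 : 9 <= min_upto m b) (mP : (2 * m <= P)%N)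
  (vm : forall j, (1 <= v j <= m)%N)
  (KP : forall w, (w <= m)%N -> window_max m b w <= 4 ^+ P).

Let mn := min_upto m b.
Let mn0 : 0 <= mn. Proof. by apply: le_trans b9. Qed.
Let r w := (8 ^+ P / window_max m b w) `^ (P - w)%:R^-1.

Let K_ge1 w : (w <= m)%N -> 1 <= window_max m b w.
Proof.
move=> wm; have /andP[h _] := window_max_bounds mn0 wm; apply: le_trans h.
by rewrite exprn_ege1 //; apply: le_trans b9; rewrite ler1n.
Qed.

Let K_gt0 w : (w <= m)%N -> 0 < window_max m b w.
Proof. by move=> wm; apply: lt_le_trans (K_ge1 wm). Qed.

Let rX w : (w <= m)%N -> r w ^+ (P - w) = 8 ^+ P / window_max m b w.
Proof.
move=> wm; rewrite /r -powR_mulrn ?powR_ge0 // -powRrM mulVf.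
  by rewrite powRr1 // divr_ge0 ?exprn_ge0 // ltW // K_gt0.
by rewrite pnatr_eq0; lia.
Qed.

Let r_bounds w : (w <= m)%N -> 2 <= r w <= mn.
Proof.
move=> wm; have Pw : (0 < P - w)%N by lia.
have r0 : 0 <= r w by exact: powR_ge0.
apply/andP; split.
  rewrite -(@ler_pXn2r _ (P - w)) ?nnegrE // rX // ler_pdivlMr ?K_gt0 //.
  have -> : (8 : R) = 2 * 4 by ring.
  rewrite exprMn; apply: ler_pM; rewrite ?exprn_ge0 ?KP ?(ltW (K_gt0 wm)) //.
  by rewrite ler_weXn2l ?ler1n //; lia.
rewrite -(@ler_pXn2r _ (P - w)) ?nnegrE // rX // ler_pdivrMr ?K_gt0 //.
have /andP[h _] := window_max_bounds mn0 wm.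
apply: (@le_trans _ _ (mn ^+ (P - w) * mn ^+ w)); last by rewrite ler_wpM2l ?exprn_ge0.
rewrite -exprD subnK; last lia.
rewrite lerXn2r ?nnegrE //; apply: le_trans b9; lra.
Qed.

Let filler t := (t %% P < P - v (t %/ P))%N.

(** The sequence of ratios has periods of length P.  A period starts with equal
    filling ratios and ends with a window of beta of length v j and maximal
    product; the filling ratios are such that the product over the period is
    8 ^ P, whence the common times P * j.+1.  They lie between 2 and the minimum
    of beta, and P is so long that no m consecutive ratios meet two of the
    windows.  Hence the product of w <= m consecutive ratios is at most that of
    some window of beta of length w. *)
Lemma exponent_sequence : exists alpha : nat -> R,
  [/\ alpha 0 = 1,
      forall N, 2 * alpha N <= alpha N.+1,
      forall N w, (w <= m)%N -> alpha (N + w)%N <= window_max m b w * alpha N &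
      forall j, alpha (P * j.+1)%N = 8 ^+ (P * j.+1) /\
        alpha (P * j.+1)%N = window_max m b (v j) * alpha (P * j.+1 - v j)%N].
Proof.
have /choice[l lP] : forall w, exists l, (w <= m)%N ->
    (l + w <= m)%N /\ window_max m b w = window_prod b w l.
  move=> w; have [wm|nwm] := leqP w m; last by exists 0%N.
  by have [l ? ?] := window_max_attained b wm; exists l.
pose rho t := if filler t then r (v (t %/ P)) else
  b (l (v (t %/ P)) + (t %% P - (P - v (t %/ P))).+1)%N.
have P0 : (0 < P)%N by lia.
have divE j s : (s < P)%N -> ((P * j + s) %/ P = j)%N.
  by move=> sP; rewrite mulnC divnMDl // divn_small // addn0.
have modE j s : (s < P)%N -> ((P * j + s) %% P = s)%N.
  by move=> sP; rewrite mulnC modnMDl modn_small.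
have rhoF j s : (s < P - v j)%N -> rho (P * j + s)%N = r (v j).
  by move=> h; rewrite /rho /filler divE ?modE ?h //; lia.
have rhoG j s : (P - v j <= s < P)%N ->
    rho (P * j + s)%N = b (l (v j) + (s - (P - v j)).+1)%N.
  by move=> /andP[h h']; rewrite /rho /filler divE // modE // ltnNge h.
have rho_ge2 t : 2 <= rho t.
  rewrite (divn_eq t P) mulnC; have tP : (t %% P < P)%N by rewrite ltn_mod.
  have [h|h] := ltnP (t %% P) (P - v (t %/ P)).
    by rewrite rhoF //; have /andP[] := r_bounds (proj2 (andP (vm (t %/ P)))).
  rewrite rhoG ?h //; have /andP[v1 v2] := vm (t %/ P); have [lv _] := lP _ v2.
  apply: (@le_trans _ _ mn); first by apply: le_trans b9; lra.
  by apply: min_upto_le; lia.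
pose alpha N := \prod_(0 <= t < N) rho t.
have alphaD N w : alpha (N + w)%N = alpha N * \prod_(N <= t < N + w) rho t.
  by rewrite /alpha (big_cat_nat (n := N)) //= leq_addr.
have alpha0 N : 0 <= alpha N.
  by apply: prodr_ge0 => t _; apply: le_trans (rho_ge2 t); lra.
have win w N : (w <= m)%N -> \prod_(N <= t < N + w) rho t <= window_max m b w.
  elim: w N => [|w IH] N wm; first by rewrite addn0 big_geq // window_max0.
  have w0 M : 0 <= \prod_(M <= t < M + w) rho t.
    by apply: prodr_ge0 => t _; apply: le_trans (rho_ge2 t); lra.
  have rle t : filler t -> rho t <= mn.
    move=> f; rewrite /rho f.
    by have /andP[] := r_bounds (proj2 (andP (vm (t %/ P)))).
  have step := window_max_step mn0 wm.
  (* A window of ratios that neither starts nor ends with a filling ratio lies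
     inside a single window of beta, the fillings being longer than m. *)
  have [fN|gN] := boolP (filler N).
    rewrite big_ltn; last lia.
    apply: le_trans step; rewrite -addSnnS; apply: ler_pM => //.
    - by apply: le_trans (rho_ge2 N); lra.
    - by apply: rle.
    - by apply: IH; lia.
  have [fNw|gNw] := boolP (filler (N + w)).
    rewrite addnS big_nat_recr ?leq_addr //= mulrC.
    apply: le_trans step; apply: ler_pM => //.
    - by apply: le_trans (rho_ge2 _); lra.
    - by apply: rle.
    - by apply: IH; lia.
  have NE := divn_eq N P; set j := (N %/ P)%N in NE *; set s := (N %% P)%N in NE *.
  have sP : (s < P)%N by rewrite ltn_mod.
  have sv : (P - v j <= s)%N by rewrite leqNgt.
  have /andP[v1 v2] := vm j; have [lv _] := lP _ v2.
  have swP : (s + w < P)%N.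
    rewrite ltnNge; apply/negP => swP; move: gNw; rewrite /filler.
    have -> : (N + w = P * j.+1 + (s + w - P))%N by lia.
    rewrite divE ?modE; try lia.
    by have := vm j.+1; lia.
  have -> : \prod_(N <= t < N + w.+1) rho t = window_prod b w.+1 (l (v j) + (s - (P - v j)))%N.
    rewrite /window_prod big_add1 /= -[X in \prod_(X <= _ < _) _](add0n N) big_addn addKn.
    apply: eq_big_nat => i iw; rewrite NE mulnC addnC -addnA rhoG; last lia.
    by congr (b _); lia.
  by apply: window_prod_le_max; lia.
have group j : \prod_(P * j.+1 - v j <= t < P * j.+1) rho t = window_max m b (v j).
  have /andP[v1 v2] := vm j; have [lv ->] := lP _ v2.
  rewrite /window_prod big_add1 /= -[X in \prod_(X <= _ < _) _](add0n (P * j.+1 - v j)%N)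
    big_addn subKn; last by lia.
  apply: eq_big_nat => i iw.
  have -> : (i + (P * j.+1 - v j) = P * j + (P - v j + i))%N by lia.
  by rewrite rhoG; [congr (b _); lia|lia].
have fill j : \prod_(P * j <= t < P * j.+1 - v j) rho t = 8 ^+ P / window_max m b (v j).
  have /andP[v1 v2] := vm j.
  rewrite -[X in \prod_(X <= _ < _) _](add0n (P * j)%N) big_addn.
  have -> : (P * j.+1 - v j - P * j = P - v j)%N by lia.
  rewrite -rX // -[in RHS](subn0 (P - v j)%N) -prodr_const_nat.
  by apply: eq_big_nat => i ij; rewrite addnC rhoF.
have period j : alpha (P * j.+1)%N = alpha (P * j)%N * 8 ^+ P.
  have /andP[v1 v2] := vm j.
  have -> : alpha (P * j.+1)%N = alpha (P * j)%N * \prod_(P * j <= t < P * j.+1) rho t.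
    by rewrite mulnS addnC alphaD.
  congr (_ * _); rewrite (big_cat_nat (n := (P * j.+1 - v j)%N)) /=; try lia.
  by rewrite fill group divfK // gt_eqF // K_gt0.
exists alpha; split.
- by rewrite /alpha big_geq.
- move=> N; rewrite /alpha big_nat_recr //= mulrC.
  by apply: ler_wpM2l; [exact: alpha0 | exact: rho_ge2].
- by move=> N w wm; rewrite alphaD mulrC ler_wpM2r // win.
- move=> j; split.
    elim: j => [|j IH]; rewrite period ?IH.
      by rewrite muln0 {1}/alpha big_geq // mul1r muln1.
    by rewrite -exprD -mulnSr.
  have /andP[v1 v2] := vm j.
  rewrite -(group j) mulrC -{1}(@subnK (v j) (P * j.+1)); last by lia.
  rewrite alphaD subnK //; lia.
Qed.

End Exponents.

(** * Lacunary series and their truncations *)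

Section Lacunary.
Context (R : realType) (m : nat) (s : nat -> nat).
Hypotheses (m1 : (1 <= m)%N) (s_lt : forall N, (s N < s N.+1)%N).

(** The coordinate to which the term t of the lacunary series belongs; the
    coordinate 0 is reserved for the constant 1. *)
Definition axis (t : nat) : nat := (t %% m).+1.

(** The coordinate l of the integer vector 2 ^ s_N * (1, sigma_1, ..., sigma_m),
    the series being cut after the term N. *)
Definition trunc_coord (N l : nat) : nat :=
  if l == 0%N then (2 ^ s N)%N
  else (\sum_(0 <= t < N.+1 | axis t == l) 2 ^ (s N - s t))%N.

Definition partial_sum (N l : nat) : R := (trunc_coord N l)%:R / 2 ^+ s N.

Lemma s_mono M N : (M <= N)%N -> (s M <= s N)%N.
Proof.
move=> /subnK <-; elim: (N - M)%N => // k IH.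
by rewrite addSn; apply: leq_trans IH _; exact: ltnW.
Qed.

Lemma trunc_coord0 N : trunc_coord N 0 = (2 ^ s N)%N.
Proof. by []. Qed.

Lemma trunc_coordS N l : (0 < l)%N ->
  trunc_coord N.+1 l = (2 ^ (s N.+1 - s N) * trunc_coord N l + (axis N.+1 == l))%N.
Proof.
case: l => // l _; rewrite /trunc_coord /= big_mkcond big_nat_recr //= -big_mkcond.
rewrite subnn expn0; congr (_ + _)%N.
rewrite big_distrr /= big_nat_cond [RHS]big_nat_cond; apply: eq_bigr => t /andP[tN _].
by rewrite -expnD; congr (2 ^ _)%N; have := s_mono (M := t) (N := N); have := s_lt N; lia.
Qed.

Lemma trunc_coordS0 N :
  trunc_coord N.+1 0 = (2 ^ (s N.+1 - s N) * trunc_coord N 0)%N.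
Proof. by rewrite !trunc_coord0 -expnD subnK // ltnW. Qed.

(** The term N contributes 1, and all the earlier ones even numbers. *)
Lemma trunc_coord_odd N : odd (trunc_coord N (axis N)).
Proof.
case: N => [|N]; first by rewrite /trunc_coord /= big_mkcond big_nat1 eqxx subnn.
rewrite trunc_coordS // eqxx addn1 /= oddM oddX.
by rewrite subn_eq0 leqNgt s_lt.
Qed.

Let pow2_gt0 N : 0 < 2 ^+ s N :> R. Proof. exact: exprn_gt0. Qed.

Lemma partial_sum0 N : partial_sum N 0 = 1.
Proof. by rewrite /partial_sum trunc_coord0 natrX divff // gt_eqF. Qed.

Lemma partial_sumS N l : (0 < l)%N ->
  partial_sum N.+1 l = partial_sum N l + (axis N.+1 == l)%:R / 2 ^+ s N.+1.
Proof.
move=> l0; rewrite /partial_sum trunc_coordS // natrD mulrDl natrM natrX.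
congr (_ + _); rewrite -{2}(subnK (ltnW (s_lt N))) exprD.
by field; rewrite !gt_eqF ?exprn_gt0.
Qed.

Lemma partial_sum_le M N l : (M <= N)%N -> partial_sum M l <= partial_sum N l.
Proof.
have [->|l0] := posnP l; first by rewrite !partial_sum0.
move=> /subnK <-; elim: (N - M)%N => // k IH; rewrite addSn partial_sumS //.
by apply: le_trans IH _; rewrite lerDl divr_ge0 ?exprn_ge0.
Qed.

Lemma partial_sum_jump M N l : (M < N)%N -> axis N = l ->
  partial_sum M l + (2 ^+ s N)^-1 <= partial_sum N l.
Proof.
case: N => // N MN <-; rewrite partial_sumS // eqxx mul1r lerD2r.
exact: partial_sum_le.
Qed.

(** The quantity partial_sum N + 2 / 2 ^ s_(N+1) decreases with N, because
    s_(N+1) < s_(N+2). *)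
Lemma partial_sum_tail M N l : (M <= N)%N ->
  partial_sum N l <= partial_sum M l + 2 / 2 ^+ s M.+1.
Proof.
have [->|l0] := posnP l; first by rewrite !partial_sum0 lerDl divr_ge0 ?exprn_ge0.
move=> MN; apply: (@le_trans _ _ (partial_sum N l + 2 / 2 ^+ s N.+1)).
  by rewrite lerDl divr_ge0 ?exprn_ge0.
move/subnK: MN => <-; elim: (N - M)%N => // k; apply: le_trans.
rewrite addSn partial_sumS // -addrA lerD2l.
set u := 2 ^+ s (k + M).+1; set w := 2 ^+ s (k + M).+2.
have u0 : 0 < u by exact: pow2_gt0.
have uw : 2 * u <= w by rewrite -exprS ler_weXn2l // ?ler1n // s_lt.
have : 2 / w <= 1 / u.
  by rewrite ler_pdivrMr ?pow2_gt0 // mulrAC ler_pdivlMr // mul1r.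
have : (axis (k + M).+1 == l)%:R / u <= 1 / u.
  by rewrite ler_pM2r ?invr_gt0 // -[1]/(1%:R) ler_nat leq_b1.
lra.
Qed.

Lemma lacunary_limit : exists sigma : nat -> R,
  [/\ sigma 0%N = 1, forall l, 0 <= sigma l <= 2,
      forall N l, partial_sum N l <= sigma l &
      forall N l, sigma l <= partial_sum N l + 2 / 2 ^+ s N.+1].
Proof.
pose E l := [set partial_sum N l | N in [set: nat]]%classic.
have E0 l : (E l !=set0)%classic by exists (partial_sum 0 l); exists 0%N.
have Eub l M : ubound (E l) (partial_sum M l + 2 / 2 ^+ s M.+1).
  move=> _ [N _ <-]; have [NM|/ltnW MN] := leqP N M; last exact: partial_sum_tail.
  apply: le_trans (partial_sum_le l NM) _.
  by rewrite lerDl divr_ge0 ?exprn_ge0.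
have Ebd l : has_ubound (E l) by exists (partial_sum 0 l + 2 / 2 ^+ s 1); apply: Eub.
have lb N l : partial_sum N l <= sup (E l).
  by apply: ub_le_sup => //; exists N.
have ub N l : sup (E l) <= partial_sum N l + 2 / 2 ^+ s N.+1.
  by apply: ge_sup => //; exact: Eub.
have ps0 l : 0 <= partial_sum 0 l <= 1.
  rewrite divr_ge0 ?exprn_ge0 //= ler_pdivrMr // mul1r -natrX ler_nat.
  rewrite /trunc_coord; case: eqP => // _; rewrite big_mkcond big_nat1.
  by case: ifP => // _; rewrite subnn expn_gt0.
exists (fun l => sup (E l)); split => //.
- apply/eqP; rewrite eq_le -{2}(partial_sum0 0) lb andbT.
  have -> : E 0%N = [set (1 : R)]%classic.
    apply/seteqP; split => [_ [N _ <-]|_ ->]; first by rewrite /= partial_sum0.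
    by exists 0%N => //; rewrite partial_sum0.
  by rewrite sup1.
- move=> l; have /andP[h1 h2] := ps0 l; rewrite (le_trans h1 (lb 0%N l)) /=.
  apply: le_trans (ub 0%N l) _; have : 2 / 2 ^+ s 1 <= 1 :> R.
    rewrite ler_pdivrMr // mul1r -[leLHS]expr1 ler_weXn2l ?ler1n //.
    exact: leq_ltn_trans (s_lt 0).
  lra.
Qed.

End Lacunary.

(** Hence each of m + 1 consecutive truncations is a combination of the first
    one and of distinct coordinate vectors. *)
Lemma axis_inj m M a b : (0 < a <= m)%N -> (0 < b <= m)%N ->
  axis m (M + a) = axis m (M + b) -> a = b.
Proof.
move=> am bm [] /eqP.
have -> : (M + a = M.+1 + a.-1)%N by lia.
have -> : (M + b = M.+1 + b.-1)%N by lia.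
by rewrite eqn_modDl !modn_small; lia.
Qed.

Lemma axis_surj m M l : (1 <= m)%N -> (0 < l <= m)%N ->
  exists2 a, (0 < a <= m)%N & axis m (M + a) = l.
Proof.
move=> m1 lm; have Mm : (M %% m < m)%N by rewrite ltn_mod.
have [a aE] : exists a, a = ((l.-1 + (m - M %% m)) %% m)%N by eexists.
have am : (a < m)%N by rewrite aE ltn_mod.
have e : ((M + a) %% m = l.-1)%N.
  rewrite aE modnDmr {1}(divn_eq M m).
  have -> : (M %/ m * m + M %% m + (l.-1 + (m - M %% m)) = (M %/ m).+1 * m + l.-1)%N by lia.
  by rewrite modnMDl modn_small //; lia.
have [a0|a0] := posnP a; last by exists a; rewrite /axis ?e; lia.
exists m; first by rewrite m1 leqnn.
by rewrite /axis modnDr; move: e; rewrite a0 addn0 => ->; lia.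
Qed.

(** * Direct sums of spans of consecutive truncations *)

Section Blocks.
Context {R : realType} (n m d : nat) (s : nat -> nat -> nat).
Hypotheses (hn : n = (m.+1 * d)%N) (m1 : (1 <= m)%N)
  (s_lt : forall i N, (s i N < s i N.+1)%N).

Notation toR := (map_mx (@intmul R 1)).

Definition block (c : 'I_n) : nat := (c %/ m.+1)%N.
Definition place (c : 'I_n) : nat := (c %% m.+1)%N.

Lemma block_lt c : (block c < d)%N.
Proof. by rewrite /block ltn_divLR // -[X in (_ < X)%N]mulnC -hn. Qed.

Lemma place_le c : (place c <= m)%N.
Proof. by rewrite -ltnS ltn_mod. Qed.

Lemma coord_exists i l : (i < d)%N -> (l <= m)%N -> exists c, block c = i /\ place c = l.
Proof.
move=> id lm; have cn : (i * m.+1 + l < n)%N by rewrite hn; nia.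
exists (Ordinal cn); rewrite /block /place /= divnMDl // divn_small // addn0.
by rewrite modnMDl modn_small.
Qed.

Lemma coord_inj a c : block a = block c -> place a = place c -> a = c.
Proof.
by move=> b p; apply: val_inj; rewrite /= (divn_eq a m.+1) (divn_eq c m.+1) -/(block a) b -/(place a) p.
Qed.

Definition truncation i N : 'rV[int]_n :=
  \row_c (if block c == i then (trunc_coord m (s i) N (place c))%:Z else 0).

(** Passing from one truncation to the next adds a single standard basis
    vector; this is why consecutive truncations span spaces of small height. *)
Lemma truncation_succ i M c : block c = i -> place c = axis m M.+1 ->
  truncation i M.+1 = (2 ^ (s i M.+1 - s i M))%:Z *: truncation i M + delta_mx 0 c.
Proof.
move=> ci cp; apply/rowP => j; rewrite !mxE eqxx /=.
case: eqP => [ji|ji]; last first.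
  by rewrite mulr0 add0r; case: eqP => // jc; case: ji; rewrite jc.
have [j0|j0] := posnP (place j).
  have -> : (j == c) = false.
    by apply/eqP => jc; move: cp; rewrite -jc j0.
  by rewrite addr0 j0 trunc_coordS0 // PoszM.
have -> : (j == c) = (axis m M.+1 == place j).
  rewrite -cp; apply/eqP/eqP => [->//|e]; apply: coord_inj => //; by rewrite ji.
by rewrite trunc_coordS // PoszD PoszM; case: (axis _ _ == _).
Qed.

Variables (v N : nat -> nat).

Definition heavy (c : 'I_n) : bool := (place c == 0%N) && (0 < v (block c) <= m)%N.

(** The rows whose index lies in [basis_index] form a basis of the direct sum of
    the spans of v i consecutive truncations in each block i, from N i on.
    Blocks with v i = 0 do not contribute, and v i = m + 1 gives the whole
    block; the remaining rows complete this basis by coordinate vectors, in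
    such a way that the matrix is triangular. *)
Definition adapted_mx : 'M[int]_n :=
  \matrix_c (if heavy c then truncation (block c) (N (block c)) else delta_mx 0 c).

Definition basis_index : {set 'I_n} := [set c | (0 < v (block c))%N &&
  ((place c == 0%N) || [exists a : 'I_m.+1, (0 < a < v (block c))%N &&
                                      (axis m (N (block c) + a) == place c)])].

Lemma adapted_mxE a c : adapted_mx a c =
  if heavy a then truncation (block a) (N (block a)) 0 c else (a == c)%:R.
Proof. by rewrite mxE; case: ifP => // _; rewrite mxE eqxx eq_sym. Qed.

Lemma truncationE i M c : truncation i M 0 c =
  if block c == i then (trunc_coord m (s i) M (place c))%:Z else 0.
Proof. by rewrite mxE. Qed.

Lemma mul_adapted_head (t : 'rV[R]_n) c : place c = 0%N ->
  (t *m toR adapted_mx) 0 c = t 0 c * (if heavy c then 2 ^+ s (block c) (N (block c)) else 1).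
Proof.
move=> c0; rewrite mxE (bigD1 c) //= big1 => [|a ac].
  rewrite addr0 mxE adapted_mxE; case: ifP => _; last by rewrite eqxx.
  by rewrite truncationE eqxx c0 trunc_coord0 /= -pmulrn natrX.
rewrite mxE adapted_mxE; case: ifP => [/andP[/eqP a0 _]|_]; last by rewrite (negPf ac) mulr0.
rewrite truncationE; case: eqP => [e|]; last by rewrite mulr0.
by case/eqP: ac; apply: coord_inj; rewrite // a0.
Qed.

Lemma mul_adapted_tail (t : 'rV[R]_n) h c : place c != 0%N -> place h = 0%N -> block h = block c ->
  (t *m toR adapted_mx) 0 c = t 0 c + (if heavy h then
    t 0 h * (trunc_coord m (s (block c)) (N (block c)) (place c))%:R else 0).
Proof.
move=> c0 h0 hc; have hneq : h != c by apply: contraNneq c0 => <-; rewrite h0.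
have nhc : heavy c = false by rewrite /heavy (negPf c0).
rewrite mxE (bigD1 c) //= mxE adapted_mxE nhc eqxx mulr1 (bigD1 h) //= big1 => [|a /andP[ac ah]].
  rewrite addr0 mxE adapted_mxE truncationE hc eqxx; case: ifP => // _.
  by rewrite (negPf hneq) mulr0.
rewrite mxE adapted_mxE; case: ifP => [/andP[/eqP a0 _]|_]; last by rewrite (negPf ac) mulr0.
rewrite truncationE; case: eqP => [e|]; last by rewrite mulr0.
by case/eqP: ah; apply: coord_inj; rewrite ?a0 ?h0 // hc e.
Qed.

Lemma sum_coord (F : nat -> nat -> nat) :
  (\sum_(c < n) F (block c) (place c) = \sum_(i < d) \sum_(l < m.+1) F i l)%N.
Proof.
rewrite /block /place hn; move: (d) => k.
rewrite -(big_mkord xpredT (fun c => F (c %/ m.+1) (c %% m.+1))%N).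
rewrite -[RHS](big_mkord xpredT (fun i => \sum_(l < m.+1) F i l)%N).
elim: k => [|k IH]; first by rewrite muln0 !big_geq.
rewrite mulnS addnC (big_cat_nat (n := (m.+1 * k)%N)) //= ?leq_addr // IH big_nat_recr //=.
congr (_ + _)%N; rewrite -[X in (\sum_(X <= _ < _) _)%N](add0n (m.+1 * k)%N) big_addn addKn big_mkord.
apply: eq_bigr => l _; rewrite mulnC addnC divnMDl // divn_small // addn0.
by rewrite modnMDl modn_small.
Qed.

Lemma prod_heavy :
  \prod_c (if heavy c then 2 ^+ s (block c) (N (block c)) else 1) =
  2 ^+ (\sum_(i < d | 0 < v i <= m) s i (N i))%N :> R.
Proof.
have -> : (\sum_(i < d | 0 < v i <= m) s i (N i) =
    \sum_(c < n) (if (place c == 0) && (0 < v (block c) <= m) then s (block c) (N (block c)) else 0))%N.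
  rewrite (sum_coord (fun i l => if (l == 0) && (0 < v i <= m) then s i (N i) else 0)%N).
  rewrite big_mkcond; apply: eq_bigr => i _; rewrite big_ord_recl /=.
  by rewrite big1 ?addn0.
by rewrite -prodrXr; apply: eq_bigr => c _; rewrite /heavy; case: ifP.
Qed.

Lemma det_adapted_mx : \det (toR adapted_mx) = 2 ^+ (\sum_(i < d | 0 < v i <= m) s i (N i))%N.
Proof.
rewrite -det_tr det_trig; last first.
  apply/is_trig_mxP => i j ij; rewrite mxE mxE adapted_mxE.
  case: ifP => [/andP[/eqP j0 _]|_]; last by rewrite -val_eqE gtn_eqF.
  rewrite truncationE; case: eqP => // e; move: ij.
  rewrite (divn_eq i m.+1) (divn_eq j m.+1) -/(block i) -/(block j) e -/(place j) j0 addn0.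
  by rewrite ltnNge leq_addr.
rewrite -prod_heavy; apply: eq_bigr => c _; rewrite mxE mxE adapted_mxE /heavy.
case: ifP => [/andP[/eqP c0 _]|_]; last by rewrite eqxx.
by rewrite truncationE eqxx c0 trunc_coord0 -pmulrn natrX.
Qed.

Lemma card_basis_index : (forall i, (i < d)%N -> (v i <= m.+1)%N) ->
  (#|basis_index| = \sum_(i < d) v i)%N.
Proof.
move=> vm; pose F i l := nat_of_bool ((0 < v i)%N &&
  ((l == 0%N) || [exists a : 'I_m.+1, (0 < a < v i)%N && (axis m (N i + a) == l)])).
have -> : (#|basis_index| = \sum_(c < n) F (block c) (place c))%N.
  by rewrite -sum1_card big_mkcond; apply: eq_bigr => c _; rewrite inE /F; case: (_ && _).
rewrite sum_coord; apply: eq_bigr => i _; rewrite /F.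
have [v0|v0] := posnP (v i); first by rewrite big1.
rewrite big_ord_recl /= -[RHS](prednK v0) -[RHS]add1n; congr (_ + _)%N.
pose f (a : 'I_(v i).-1) : 'I_m := Ordinal (ltn_pmod (N i + a.+1) m1).
have vi := vm i (ltn_ord i).
have finj : injective f.
  move=> a b [e]; apply: val_inj; apply: succn_inj.
  have ha := ltn_ord a; have hb := ltn_ord b.
  by apply: (@axis_inj m (N i) a.+1 b.+1); rewrite /axis ?e //; lia.
rewrite -[RHS]card_ord -cardsT -(card_imset _ finj) -sum1_card [RHS]big_mkcond /=.
apply: eq_bigr => l _.
suff -> : (l \in f @: [set: 'I_(v i).-1]) =
  [exists a : 'I_m.+1, (0 < a < v i)%N && (axis m (N i + a) == bump 0 l)] by case: ifP.
apply/imsetP/existsP => [[a _ ->]|[a /andP[/andP[a0 av] /eqP[e]]]].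
  have ha := ltn_ord a; have am : (a.+1 < m.+1)%N by lia.
  exists (Ordinal am); rewrite /axis /bump /= add1n eqxx andbT; lia.
have am : (a.-1 < (v i).-1)%N by lia.
exists (Ordinal am) => //; apply: val_inj; rewrite /= prednK //.
Qed.

(** The terms N + 1, ..., N + v - 1 of a block, whose coordinates are used by the
    basis, are followed by others up to N + m that belong to new coordinates. *)
Lemma next_axis_notin c w : (0 < v (block c) <= w)%N -> (w <= m)%N ->
  place c = axis m (N (block c) + w) -> c \notin basis_index.
Proof.
move=> /andP[v0 vw] wm pc; rewrite inE v0 pc /=; apply/existsP => -[a /andP[/andP[a0 av] /eqP e]].
have := @axis_inj m (N (block c)) a w; rewrite e => /(_ _ _ erefl).
lia.
Qed.

(** The only coefficients that might not be integers are those of the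
    truncations.  Such a coefficient becomes an integer when multiplied by the
    first coordinate of the truncation, which is a power of 2, and also when
    multiplied by an odd coordinate, namely the one that received the last term;
    these two numbers are coprime. *)
Lemma adapted_mx_primitive (x : 'rV[int]_n) (t : 'rV[R]_n) :
  (forall c, c \notin basis_index -> t 0 c = 0) -> toR x = t *m toR adapted_mx ->
  exists t' : 'rV[int]_n, t = toR t'.
Proof.
move=> tS xE.
suff /fin_all_exists[t' t'E] c : exists z : int, t 0 c = z%:~R.
  by exists (\row_c t' c); apply/rowP => c; rewrite !mxE.
have xc a : (x 0 a)%:~R = (t *m toR adapted_mx) 0 a by rewrite -xE mxE.
have heavy_int h : heavy h -> exists z : int, t 0 h = z%:~R.
  move=> hh; have /andP[/eqP h0 /andP[v0 vm]] := hh.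
  have al : (axis m (N (block h)) <= m)%N by exact: ltn_pmod.
  have [a [ah ap]] := coord_exists (block_lt h) al.
  have aS : a \notin basis_index.
    apply: (@next_axis_notin a m); rewrite ?ah ?v0 //.
    by rewrite ap /axis modnDr.
  have a0 : place a != 0%N by rewrite ap.
  have xa := xc a; rewrite (mul_adapted_tail _ a0 h0 (esym ah)) hh (tS _ aS) add0r in xa.
  have xh := xc h; rewrite (mul_adapted_head _ h0) hh in xh.
  rewrite ah ap in xa; set b := trunc_coord _ _ _ _ in xa.
  have : coprime (2 ^ s (block h) (N (block h))) b.
    rewrite coprimeXl // coprime2n; exact: trunc_coord_odd.
  move=> /coprimeP[]; first by rewrite expn_gt0.
  move=> [u w] /= uw; exists (x 0 h * u%:Z - x 0 a * w%:Z).
  rewrite rmorphB !rmorphM /= xa xh -!pmulrn -mulrA -natrX -natrM.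
  rewrite -(mulrA (t 0 h) b%:R) -natrM -mulrBr -natrB; last by lia.
  have -> : (2 ^ s (block h) (N (block h)) * u - b * w = 1)%N by rewrite mulnC (mulnC b).
  by rewrite mulr1.
have [c0|c0] := eqVneq (place c) 0%N.
  case hc: (heavy c); first exact: heavy_int.
  by exists (x 0 c); rewrite xc mul_adapted_head // hc mulr1.
have [h [hc h0]] := coord_exists (block_lt c) (leq0n m).
have xcE := xc c; rewrite (mul_adapted_tail _ c0 h0 hc) in xcE.
case hh: (heavy h) xcE; last by move=> e; exists (x 0 c); rewrite e addr0.
have [z zE] := heavy_int _ hh; move=> e.
exists (x 0 c - z * (trunc_coord m (s (block c)) (N (block c)) (place c))%:Z).
by rewrite rmorphB rmorphM /= e zE -!pmulrn addrK.
Qed.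

(** In the span of the truncations of one block, the coordinate reached by the
    next term is still proportional to the first one; this measures how far the
    span is from the limit vector. *)
Lemma adapted_mx_slope (t : 'rV[R]_n) h c : (forall c, c \notin basis_index -> t 0 c = 0) ->
  heavy h -> block c = block h -> place c = axis m (N (block h) + v (block h)) ->
  (t *m toR adapted_mx) 0 c =
  partial_sum R m (s (block h)) (N (block h)) (place c) * (t *m toR adapted_mx) 0 h.
Proof.
move=> tS hh ch pc; have /andP[/eqP h0 /andP[v0 vm]] := hh.
have cS : c \notin basis_index by apply: (@next_axis_notin c (v (block h))); rewrite ?ch ?v0 ?leqnn.
have c0 : place c != 0%N by rewrite pc.
rewrite (mul_adapted_tail _ c0 h0 (esym ch)) (mul_adapted_head _ h0) hh tS // add0r ch.
by rewrite /partial_sum; field; rewrite expf_neq0 // pnatr_eq0.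
Qed.

Lemma adapted_mx_unit : toR adapted_mx \in unitmx.
Proof. by rewrite unitmxE unitfE det_adapted_mx; apply: expf_neq0; rewrite pnatr_eq0. Qed.

Lemma row_adapted_mx c : row c adapted_mx =
  if heavy c then truncation (block c) (N (block c)) else delta_mx 0 c.
Proof. by apply/rowP => j; rewrite !mxE; case: ifP. Qed.

Lemma heavy_basis_index c : heavy c -> c \in basis_index.
Proof. by case/andP => c0 /andP[v0 _]; rewrite inE v0 c0. Qed.

Definition sum_basis : 'M[int]_(#|basis_index|, n) := rowsub enum_val adapted_mx.

Let spread (u : 'rV[R]_#|basis_index|) : 'rV[R]_n := u *m rowsub enum_val 1%:M.

Let spreadE u : u *m toR sum_basis = spread u *m toR adapted_mx.
Proof.
rewrite /spread -mulmxA; congr (_ *m _); apply/row_matrixP => a.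
have -> : row a (rowsub enum_val 1%:M *m toR adapted_mx) = row (enum_val a) (1%:M *m toR adapted_mx).
  by rewrite !row_mul; congr (_ *m _); apply/rowP => j; rewrite !mxE.
by rewrite mul1mx; apply/rowP => j; rewrite !mxE.
Qed.

Let spread_sel u a : spread u 0 (enum_val a) = u 0 a.
Proof.
rewrite mxE (bigD1 a) //= big1 => [|b ba]; rewrite !mxE ?eqxx ?mulr1 ?addr0 //.
by rewrite (inj_eq enum_val_inj) (negPf ba) mulr0.
Qed.

Let spread_out u c : c \notin basis_index -> spread u 0 c = 0.
Proof.
move=> cS; rewrite mxE big1 // => a _; rewrite !mxE; case: eqP => [e|]; rewrite ?mulr0 //.
by rewrite -e enum_valP in cS.
Qed.

Lemma sum_basis_row_free : row_free (toR sum_basis).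
Proof.
apply: inj_row_free => u; rewrite spreadE => u0; apply/rowP => a.
have Wf : row_free (toR adapted_mx) by rewrite row_free_unit adapted_mx_unit.
have : spread u = 0 by apply: (row_free_inj Wf); rewrite u0 mul0mx.
by move=> /rowP/(_ (enum_val a)); rewrite spread_sel !mxE.
Qed.

Lemma sum_basis_primitive (x : 'rV[int]_n) (u : 'rV[R]_#|basis_index|) :
  toR x = u *m toR sum_basis -> exists u' : 'rV[int]_#|basis_index|, u = toR u'.
Proof.
rewrite spreadE => /(adapted_mx_primitive (@spread_out u))[t tE].
exists (\row_a t 0 (enum_val a)); apply/rowP => a.
by rewrite -spread_sel tE !mxE.
Qed.

Lemma row_adapted_sel c : c \in basis_index -> (row c (toR adapted_mx) <= toR sum_basis)%MS.
Proof.
move=> cS; have -> : row c (toR adapted_mx) = row (enum_rank_in cS c) (toR sum_basis).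
  by apply/rowP => j; rewrite !mxE enum_rankK_in.
exact: row_sub.
Qed.

Lemma delta_sel c : c \in basis_index -> ~~ heavy c -> ((delta_mx 0 c : 'rV[R]_n) <= toR sum_basis)%MS.
Proof.
move=> cS hc; have := row_adapted_sel cS; rewrite -map_row row_adapted_mx (negPf hc).
have -> // : toR (delta_mx 0 c : 'rV[int]_n) = delta_mx 0 c.
by apply/rowP => j; rewrite !mxE; case: (_ && _).
Qed.

(** Among the truncations only X_(N i) is a row of the basis; the following ones
    are obtained from it by adding coordinate vectors of the basis. *)
Lemma truncation_sel i a : (i < d)%N -> (a < v i <= m)%N ->
  (toR (truncation i (N i + a)) <= toR sum_basis)%MS.
Proof.
move=> id; elim: a => [|a IH] /andP[av vm].
  have [c [ci c0]] := coord_exists id (leq0n m).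
  have hc : heavy c by rewrite /heavy c0 ci vm av.
  have := row_adapted_sel (heavy_basis_index hc).
  by rewrite -map_row row_adapted_mx hc ci addn0.
have [c [ci cp]] := coord_exists id (ltn_pmod (N i + a.+1) m1 : (axis m (N i + a.+1) <= m)%N).
have := cp; rewrite addnS => cp'; rewrite (truncation_succ ci cp') map_mxD map_mxZ.
apply: addmx_sub; first by rewrite scalemx_sub // IH // vm andbT ltnW.
have -> : toR (delta_mx 0 c : 'rV[int]_n) = delta_mx 0 c.
  by apply/rowP => j; rewrite !mxE; case: (_ && _).
apply: delta_sel; last by rewrite /heavy cp.
rewrite inE ci (leq_trans _ av) //=; apply/orP; right; apply/existsP.
have am : (a.+1 < m.+1)%N by rewrite (leq_trans av) // ltnW.
by exists (Ordinal am); rewrite /= av cp addnS eqxx.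
Qed.

Lemma full_block_sel i (y : 'rV[R]_n) : (i < d)%N -> v i = m.+1 ->
  (forall c, block c <> i -> y 0 c = 0) -> (y <= toR sum_basis)%MS.
Proof.
move=> id vi y0; rewrite [y]row_sum_delta; apply: summx_sub => c _.
have [ci|ci] := eqVneq (block c) i; last by rewrite y0 ?scale0r ?sub0mx //; apply/eqP.
apply: scalemx_sub; apply: delta_sel; last by rewrite /heavy ci vi ltnn !andbF.
rewrite inE ci vi /=; have [//|p0] := posnP (place c).
have [|a am ae] := @axis_surj m (N i) (place c) m1; first by rewrite p0 place_le.
apply/existsP; have am' : (a < m.+1)%N by case/andP: am.
by exists (Ordinal am'); rewrite /= ae eqxx andbT ltnS.
Qed.

End Blocks.

(** * The lower bound for the distance to a rational space *)

Section PowersOfTwo.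
Context {R : realType}.
Implicit Types x y : R.

Lemma pow2D x y : 2 `^ (x + y) = 2 `^ x * 2 `^ y :> R.
Proof. by rewrite powRD // pnatr_eq0 implybT. Qed.

Lemma pow2_gt0 x : 0 < 2 `^ x :> R. Proof. exact: powR_gt0. Qed.

Lemma pow2_le x y : (2 `^ x <= 2 `^ y :> R) = (x <= y).
Proof.
have mono a b : a <= b -> 2 `^ a <= 2 `^ b :> R by apply: ler_powR; rewrite ler1n.
apply/idP/idP => [h|/mono //]; rewrite leNgt; apply/negP => yx.
move: h; rewrite leNgt => /negP; apply.
rewrite -(subrK y x) pow2D ltr_pMl ?pow2_gt0 //.
by rewrite /powR pnatr_eq0 /= expR_gt1 mulr_gt0 ?ln_gt0 ?ltr1n // subr_gt0.
Qed.

Lemma pow2_lt x y : (2 `^ x < 2 `^ y :> R) = (x < y).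
Proof. by rewrite !ltNge pow2_le. Qed.

Lemma pow2_nat k : 2 `^ k%:R = 2 ^+ k :> R.
Proof. by rewrite powR_mulrn. Qed.

Lemma pow2N x : 2 `^ (- x) = (2 `^ x)^-1 :> R.
Proof. by rewrite powRN. Qed.

Lemma pow2_log x : 0 < x -> exists y, x = 2 `^ y.
Proof.
move=> x0; exists (ln x / ln 2); rewrite /powR pnatr_eq0 /= divfK ?lnK //.
by rewrite gt_eqF // ln_gt0 // ltr1n.
Qed.

End PowersOfTwo.

(** An exponent of 2 that absorbs the factors lost when minors are expanded
    and coordinate vectors are added. *)
Definition minor_loss (n : nat) : nat := (8 * (1 + n) ^ (n + n).+1)%N.

Lemma minor_loss_bound n : (8 * (1 + n) ^ (n + n).+1 <= 2 ^ minor_loss n)%N.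
Proof. by apply: ltnW; exact: ltn_expl. Qed.

Section LowerBound.
Context {R : realType} (n m d : nat) (alpha : nat -> nat -> R) (K : nat -> nat -> R) (CK : R).
Hypotheses (hn : n = (m.+1 * d)%N) (m1 : (1 <= m)%N)
  (alpha0 : forall i, alpha i 0 = 1)
  (alpha2 : forall i N, 2 * alpha i N <= alpha i N.+1)
  (alphaK : forall i N w, (w <= m)%N -> alpha i (N + w)%N <= K i w * alpha i N)
  (K1 : forall i w, (w <= m)%N -> 1 <= K i w)
  (KC : forall i w, (w <= m)%N -> K i w <= CK).

Notation toR := (map_mx (@intmul R 1)).

Definition height_exponent i N : nat := Num.truncn (alpha i N).
Let s := height_exponent.

Lemma alpha_ge1 i N : 1 <= alpha i N.
Proof. by elim: N => [|N IH]; [rewrite alpha0|have := alpha2 i N; lra]. Qed.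

Lemma alpha_mono i M N : (M <= N)%N -> alpha i M <= alpha i N.
Proof.
move=> /subnK <-; elim: (N - M)%N => // k IH.
by have := alpha2 i (k + M); have := alpha_ge1 i (k + M); rewrite addSn; lra.
Qed.

Lemma exponent_bounds i N : (s i N)%:R <= alpha i N < (s i N)%:R + 1.
Proof.
have /andP[h1 h2] := truncn_itv (le_trans ler01 (alpha_ge1 i N)).
by rewrite h1 /= natr1.
Qed.

Lemma exponent_lt i N : (s i N < s i N.+1)%N.
Proof.
have /andP[_ h1] := exponent_bounds i N.+1; have /andP[h2 _] := exponent_bounds i N.
have := alpha_ge1 i N; have := alpha2 i N => h3 h4.
by rewrite -(ltr_nat R); lra.
Qed.

Lemma alpha_crossing i (tau : R) : 1 <= tau ->
  exists M, alpha i M <= tau < alpha i M.+1.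
Proof.
move=> t1.
have alphaN N : N%:R <= alpha i N.
  by elim: N => [|N IH]; [rewrite alpha0|have := alpha2 i N; have := alpha_ge1 i N;
    rewrite -natr1; lra].
have ex : exists N, tau < alpha i N.
  exists (Num.truncn tau).+1; apply: lt_le_trans (alphaN _).
  by have /andP[] := truncn_itv (le_trans ler01 t1).
have := ex_minnP ex => -[[|M] tM min]; first by move: tM; rewrite alpha0 ltNge t1.
exists M; rewrite tM andbT leNgt; apply/negP => /min; by rewrite ltnn.
Qed.

Variable (sigma : nat -> nat -> R).
Hypotheses (sigma0 : forall i, sigma i 0%N = 1)
  (sigma_bd : forall i l, 0 <= sigma i l <= 2)
  (sigma_lb : forall i N l, partial_sum R m (s i) N l <= sigma i l)
  (sigma_ub : forall i N l, sigma i l <= partial_sum R m (s i) N l + 2 / 2 ^+ s i N.+1).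

Definition limit_vector i : 'rV[R]_n :=
  \row_c (if block m c == i then sigma i (place m c) else 0).

Lemma truncation_near i N c :
  `|(truncation n m s i N 0 c)%:~R - 2 ^+ s i N * limit_vector i 0 c| <= 2 * 2 ^+ s i N / 2 ^+ s i N.+1.
Proof.
have p0 k : 0 < 2 ^+ k :> R by exact: exprn_gt0.
have e0 : 0 <= 2 * 2 ^+ s i N / 2 ^+ s i N.+1 :> R by rewrite divr_ge0 ?mulr_ge0 ?ltW.
rewrite !mxE; case: eqP => _; last by rewrite mulr0 subr0 normr0.
have -> : (trunc_coord m (s i) N (place m c))%:~R = 2 ^+ s i N * partial_sum R m (s i) N (place m c) :> R.
  by rewrite /partial_sum mulrC divfK ?gt_eqF // -pmulrn.
rewrite -mulrBr normrM gtr0_norm // [leRHS]mulrAC [leRHS]mulrC ler_pM2l // distrC.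
have h1 := sigma_lb i N (place m c); have h2 := sigma_ub i N (place m c).
by rewrite ger0_norm; lra.
Qed.

(** The truncation is at distance at most 2 ^ (1 + s_N - s_(N+1)) from a multiple
    of the limit vector, which in turn is close to the row space of Z. *)
Lemma truncation_mem (g : nat) r (Z : 'M[int]_(r, n)) (h p : R) i N (y : 'rV[R]_n) :
  (8 * (1 + n) ^ n.+1 <= 2 ^ g)%N ->
  row_free (toR Z) -> minors_le (toR Z) ((1 + n)%:R ^+ n * 2 `^ h) ->
  (y <= toR Z)%MS -> (forall c, `|limit_vector i 0 c - y 0 c| <= 2 `^ (- p)) ->
  (s i N)%:R <= p - h - g%:R -> (s i N)%:R + h + g%:R + 1 <= (s i N.+1)%:R ->
  (toR (truncation n m s i N) <= toR Z)%MS.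
Proof.
move=> gn Zf Zm yZ Yy sp ss.
set H := (1 + n)%:R ^+ n * 2 `^ h in Zm.
pose eta := 2 `^ (1 + (s i N)%:R - (s i N.+1)%:R) + 2 `^ ((s i N)%:R - p) : R.
have eta0 : 0 <= eta by rewrite addr_ge0 // ltW // pow2_gt0.
apply: (@int_point_near _ _ _ _ _ (2 ^+ s i N *: y) H eta) => //.
- by rewrite scalemx_sub.
- move=> c; rewrite [(_ *: y) 0 c]mxE.
  have -> : (truncation n m s i N 0 c)%:~R - 2 ^+ s i N * y 0 c =
    ((truncation n m s i N 0 c)%:~R - 2 ^+ s i N * limit_vector i 0 c) +
     2 ^+ s i N * (limit_vector i 0 c - y 0 c) by ring.
  apply: le_trans (ler_normD _ _) _; apply: lerD.
    apply: le_trans (truncation_near _ _ _) _.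
    by rewrite pow2D pow2N pow2D !pow2_nat powRr1 //.
  rewrite normrM gtr0_norm ?exprn_gt0 // pow2D pow2_nat.
  by rewrite ler_wpM2l ?exprn_ge0.
have rn : (r <= n)%N by rewrite -(eqP Zf) rank_leq_col.
have h1 : 2 `^ h * eta <= 2 * 2 `^ (- g%:R) :> R.
  rewrite /eta mulrDr -!pow2D mulr_natl mulr2n; apply: lerD; rewrite pow2_le; lra.
have pg : 0 < 2 `^ (g%:R) :> R by exact: pow2_gt0.
have gn' : 8 * (1 + n)%:R ^+ n.+1 <= 2 `^ g%:R :> R.
  by rewrite pow2_nat -!natrX -natrM ler_nat.
have n0 : 0 <= (1 + n)%:R ^+ n.+1 :> R by rewrite exprn_ge0.
apply: (@le_lt_trans _ _ ((1 + n)%:R ^+ n.+1 * (2 * 2 `^ (- g%:R)))).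
  have -> : (1 + r)%:R * (eta * H) = ((1 + r)%:R * (1 + n)%:R ^+ n) * (2 `^ h * eta) by rewrite /H; ring.
  apply: (ler_pM _ _ _ h1); first by rewrite mulr_ge0 ?exprn_ge0.
    by rewrite mulr_ge0 // ltW // pow2_gt0.
  by rewrite exprS ler_wpM2r ?exprn_ge0 // ler_nat leq_add2l.
rewrite pow2N mulrA ltr_pdivrMr //; lra.
Qed.

Definition inverse_max_sum (T : pred nat) (v : nat -> nat) : R :=
  \sum_(i < d | T i && (v i <= m)%N) (K i (v i))^-1.

(** Let the blocks in T have limit vectors within 2 ^ - p of the row space of Z,
    up to coordinates of the other blocks.  Assuming p * S > h + C, the third
    hypothesis says that p is large enough for the last v i truncations of each
    block i of T before the level p - h to be captured.  The dimensions then
    force the space to be the direct sum described by [adapted_mx]; comparing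
    h with its covolume, and p with its distance to the limit vectors, yields
    the opposite inequality. *)
Lemma inverse_max_sum_le : exists C : R, forall (T : pred nat) (v : nat -> nat) e
    (Z : 'M[int]_(e, n)) (h p : R),
  (forall i, (i < d)%N -> T i -> (0 < v i <= m.+1)%N) ->
  e = (\sum_(i < d | T i) v i)%N ->
  row_free (toR Z) -> minors_le (toR Z) (2 `^ h) ->
  (forall i, (i < d)%N -> T i -> 3 * K i (v i).-1 * inverse_max_sum T v <= 1) ->
  (forall i, (i < d)%N -> T i -> exists2 y : 'rV[R]_n, (y <= toR Z)%MS &
     forall c, T (block m c) -> `|limit_vector i 0 c - y 0 c| <= 2 `^ (- p)) ->
  p * inverse_max_sum T v <= h + C.
Proof.
set g := minor_loss n.
have CK1 : 1 <= CK by apply: le_trans (K1 0%N (leq0n m)) (KC 0%N (leq0n m)).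
(* The constant absorbs K_(i,w) when the first truncations are concerned, the
   loss g on minors, and the rounding of the exponents, 3 for each block. *)
exists (CK + g%:R + 3 * d%:R + 3) => T v e Z h p vT eE Zf Zh gap near.
have v1m i : (i < d)%N -> T i -> ((v i).-1 <= m)%N.
  by move=> id Ti; have := vT i id Ti; lia.
set C := CK + _ + _ + _; set Sg := inverse_max_sum T v.
have d0 : 0 <= d%:R :> R by [].
have g0 : 0 <= g%:R :> R by [].
have CC : CK + g%:R + 3 <= C by rewrite /C; lra.
have h0 : 0 <= h.
  by rewrite -pow2_le powRr0; apply: (minors_ge1 Zf Zh).
rewrite leNgt; apply/negP => pS.
have Sg0 : 0 <= Sg.
  apply: sumr_ge0 => i /andP[_ vm]; rewrite invr_ge0; have := K1 i vm; lra.
have p0 : 0 < p.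
  by rewrite ltNge; apply/negP => p0; have := mulr_le0_ge0 p0 Sg0; lra.
have pK i : (i < d)%N -> T i -> 3 * K i (v i).-1 * (h + C) <= p.
  move=> id Ti; have := gap i id Ti; rewrite -/Sg => gp.
  have k1 := K1 i (v1m i id Ti).
  apply: (@le_trans _ _ (3 * K i (v i).-1 * (p * Sg))).
    by rewrite ler_wpM2l ?ltW //; lra.
  by rewrite mulrCA ler_piMr // ltW.
pose tau := p - h - g%:R.
have tauK i : (i < d)%N -> T i -> 2 * K i (v i).-1 * (h + C) <= tau.
  move=> id Ti; have := pK i id Ti.
  have k1 := K1 i (v1m i id Ti).
  have : h + C <= K i (v i).-1 * (h + C) by rewrite ler_peMl //; lra.
  by rewrite /tau -!mulrA; lra.
have tau2 i : (i < d)%N -> T i -> 2 * (h + C) <= tau.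
  move=> id Ti; apply: le_trans (tauK i id Ti).
  have k1 := K1 i (v1m i id Ti).
  by rewrite -mulrA ler_wpM2l // ler_peMl //; lra.
(* The coordinates of the blocks outside T are added to the space, so that the
   limit vectors themselves become close to it. *)
pose cs := enum [set c : 'I_n | ~~ T (block m c)].
have csT c : c \in cs -> ~~ T (block m c) by rewrite mem_enum inE.
have [r [Z' [Z'f rle [ZZ' csZ'] Z'm _]]] := extend_coord (P := fun=> True) (cs := cs) Zf Zh
  (fun _ => I) (fun _ _ => I).
have cs_n : (size cs <= n)%N by rewrite -cardE -[X in (_ <= X)%N]card_ord max_card.
have Z'm' : minors_le (toR Z') ((1 + n)%:R ^+ n * 2 `^ h).
  move=> f; apply: (le_trans (Z'm f)); apply: ler_wpM2r; first exact/ltW/pow2_gt0.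
  by rewrite ler_weXn2l // ler1n.
have near' i : (i < d)%N -> T i -> exists2 y : 'rV[R]_n, (y <= toR Z')%MS &
     forall c, `|limit_vector i 0 c - y 0 c| <= 2 `^ (- p).
  move=> id Ti; have [y yZ Yy] := near i id Ti.
  exists (y + \sum_c (if T (block m c) then 0 else limit_vector i 0 c - y 0 c) *: delta_mx 0 c).
    apply: addmx_sub; first exact: submx_trans ZZ'.
    apply: summx_sub => c _; case: ifP => Tc; first by rewrite scale0r sub0mx.
    by rewrite scalemx_sub // csZ' // mem_enum inE Tc.
  have dE (x : R) (a b : 'I_n) : (x *: delta_mx 0 a : 'rV[R]_n) 0 b = x * (a == b)%:R.
    by rewrite !mxE eqxx eq_sym.
  move=> c; rewrite [(y + _) 0 c]mxE summxE (bigD1 c) //= big1 => [|a ac]; last first.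
    by rewrite dE (negPf ac) mulr0.
  rewrite dE eqxx mulr1 addr0; case: ifP => Tc.
    by rewrite addr0; exact: Yy.
  by rewrite [y 0 c + _]addrC subrK subrr normr0 ltW // pow2_gt0.
have member i N : (i < d)%N -> T i -> (s i N)%:R <= tau ->
    (s i N)%:R + h + g%:R + 1 <= (s i N.+1)%:R -> (toR (truncation n m s i N) <= toR Z')%MS.
  move=> id Ti sN sN1; have [y yZ Yy] := near' i id Ti.
  apply: (truncation_mem (g := g) _ Z'f Z'm' yZ Yy sN sN1).
  apply: leq_trans (minor_loss_bound n); rewrite leq_pmul2l //; apply: leq_pexp2l => //.
  by rewrite ltnS leq_addr.
(* Up to the level tau, truncations stay close to the space after being scaled
   to integer vectors; M i is the last such index in the block i. *)
have /choice[M MP] : forall i, exists M, (i < d)%N -> T i -> alpha i M <= tau < alpha i M.+1.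
  move=> i; have [id|] := ltnP i d; last by exists 0%N.
  case Ti: (T i); last by exists 0%N.
  have [|M HM] := @alpha_crossing i tau; last by exists M.
  by have := tau2 i id Ti; lra.
have vM i : (i < d)%N -> T i -> (v i <= (M i).+1)%N.
  move=> id Ti; rewrite leqNgt; apply/negP => Mv; have := vT i id Ti => vi.
  have Mm : ((M i).+1 <= m)%N by move: Mv vi; clear; lia.
  have := alphaK i 0 Mm; rewrite add0n alpha0 mulr1.
  by have := KC i Mm; have /andP[_] := MP i id Ti; have := tau2 i id Ti; lra.
pose N i := ((M i).+1 - v i)%N.
have XZ i j : (i < d)%N -> T i -> (N i <= j <= M i)%N -> (toR (truncation n m s i j) <= toR Z')%MS.
  move=> id Ti /andP[Nj jM]; have /andP[Mt tM] := MP i id Ti; have vi := vT i id Ti.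
  have /andP[s1 _] := exponent_bounds i j; have /andP[_ s2] := exponent_bounds i j.+1.
  have aj := alpha_mono i jM.
  have aN : alpha i (N i).+1 <= alpha i j.+1 by exact: alpha_mono.
  have := alphaK i (N i).+1 (v1m i id Ti).
  have -> : ((N i).+1 + (v i).-1 = (M i).+1)%N by move: (vM i id Ti) vi; rewrite /N; clear; lia.
  move=> aM; have k1 := K1 i (v1m i id Ti).
  have aj2 : 2 * (h + C) <= alpha i j.+1.
    rewrite -(@ler_pM2l _ (K i (v i).-1)); last lra.
    rewrite mulrCA mulrA; apply: le_trans (tauK i id Ti) _.
    apply: le_trans (ltW tM) _; apply: le_trans aM _.
    by rewrite ler_wpM2l //; lra.
  have := alpha2 i j => a2.
  apply: member => //; rewrite -/s in s1 s2; lra.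
(* The blocks outside T are now contained in the space, hence the value
   m + 1. *)
have dR (c : 'I_n) : toR (delta_mx 0 c : 'rV[int]_n) = delta_mx 0 c.
  by apply/rowP => j; rewrite !mxE; case: (_ && _).
pose v' i := if T i then v i else m.+1.
have axisZ i a c : (i < d)%N -> T i -> (0 < a < v i)%N -> block m c = i ->
    place m c = axis m (N i + a) -> ((delta_mx 0 c : 'rV[R]_n) <= toR Z')%MS.
  move=> id Ti av ci cp; have vMi := vM i id Ti.
  case: a av cp => [//|a] /andP[_ av]; rewrite addnS => cp.
  have E := truncation_succ m1 exponent_lt ci cp.
  have -> : (delta_mx 0 c : 'rV[R]_n) =
     toR (truncation n m s i (N i + a).+1) - (2 ^ (s i (N i + a).+1 - s i (N i + a)))%:R *: toR (truncation n m s i (N i + a)).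
    by rewrite E map_mxD map_mxZ dR /= -pmulrn addrC addKr.
  by apply: addmx_sub; rewrite ?eqmx_opp ?scalemx_sub // XZ //; move: vMi av; rewrite /N; clear; lia.
have v'd i : (i < d)%N -> (v' i <= m.+1)%N.
  by move=> id; rewrite /v'; case: ifP => // Ti; have /andP[] := vT i id Ti.
have WZ c : c \in basis_index n m v' N -> (row c (toR (adapted_mx n m s v' N)) <= toR Z')%MS.
  rewrite inE => /andP[_ cS]; have cd := block_lt hn c.
  rewrite -map_row row_adapted_mx.
  case: ifP => [/andP[/eqP c0 /andP[v0 vm]]|hc].
    case Tc: (T (block m c)) (v0) (vm); rewrite /v' Tc ?ltnn // => _ _.
    by apply: XZ => //; move: (vM _ cd Tc) (vT _ cd Tc); rewrite leqnn /N; clear; lia.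
  rewrite dR; case Tc: (T (block m c)); last by rewrite csZ' // mem_enum inE Tc.
  case/orP: cS => [/eqP c0|/existsP[a /andP[av /eqP ac]]]; last first.
    by apply: (axisZ (block m c) a) => //; move: av; rewrite /v' Tc.
  have vc : v (block m c) = m.+1.
    by move: hc (vT _ cd Tc); rewrite /heavy c0 /v' Tc /=; clear; lia.
  set i := block m c in cd Tc vc *.
  have -> : (delta_mx 0 c : 'rV[R]_n) = (2 ^+ s i (N i))^-1 *: (toR (truncation n m s i (N i)) -
      \sum_(a | a != c) toR (truncation n m s i (N i)) 0 a *: delta_mx 0 a).
    rewrite [X in X - _]row_sum_delta (bigD1 c) //= addrK mxE truncationE -/i eqxx c0.
    by rewrite trunc_coord0 -pmulrn natrX scalerA mulVf ?scale1r // expf_neq0 ?pnatr_eq0.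
  rewrite scalemx_sub // addmx_sub //.
    by apply: XZ => //; move: (vM i cd Tc); rewrite leqnn /N vc; clear; lia.
  rewrite eqmx_opp summx_sub // => a ac; rewrite mxE truncationE.
  case: eqP => [ai|]; last by rewrite scale0r sub0mx.
  rewrite scalemx_sub //.
  have ap : (0 < place m a <= m)%N.
    rewrite place_le andbT lt0n; apply: contra ac => /eqP a0; apply/eqP.
    by apply: coord_inj; [exact: ai|rewrite a0 c0].
  have [b bm be] := axis_surj (N i) m1 ap.
  by apply: (axisZ i b) => //; rewrite vc; move: bm; clear; lia.
have sumv' : (\sum_(i < d) v' i = e + size cs)%N.
  rewrite (bigID (fun i : 'I_d => T i)) /= eE; congr (_ + _)%N.
    by apply: eq_bigr => i Ti; rewrite /v' Ti.
  have -> : size cs = (\sum_(c < n) (~~ T (block m c)))%N.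
    rewrite -cardE -sum1_card big_mkcond; apply: eq_bigr => c _.
    by rewrite inE; case: (T _).
  rewrite (sum_coord hn (fun i _ => ~~ T i : nat)) big_mkcond; apply: eq_bigr => i _.
  by rewrite /v' sum_nat_const card_ord; case: (T i); rewrite ?muln0 ?muln1.
have rS : (r <= #|basis_index n m v' N|)%N by rewrite (card_basis_index hn m1 N v'd) sumv'.
have Wu := adapted_mx_unit (R := R) s hn v' N.
have heightW : (\sum_(i < d | T i && (v i <= m)%N) (s i (N i))%:R) <= h + g%:R :> R.
  have notS c : c \notin basis_index n m v' N -> row c (adapted_mx n m s v' N) = delta_mx 0 c.
    by rewrite row_adapted_mx; case: ifP => // /(heavy_basis_index N) ->.
  have prim := @adapted_mx_primitive R n m d s hn m1 exponent_lt v' N.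
  have WZ2 c : c \in basis_index n m v' N -> (toR (row c (adapted_mx n m s v' N)) <= toR Z')%MS.
    by move=> cS; rewrite map_row WZ.
  have := det_le_minors Wu notS prim WZ2 Z'f rS Z'm'.
  rewrite (det_adapted_mx s hn) ger0_norm ?exprn_ge0 // => H.
  have {}H : 2 ^+ (\sum_(i < d | 0 < v' i <= m) s i (N i))%N <= 2 `^ (g%:R + h) :> R.
    apply: (le_trans H).
    rewrite mulrA pow2D; apply: ler_wpM2r; first exact/ltW/pow2_gt0.
    rewrite -exprD pow2_nat -!natrX ler_nat; apply: leq_trans (minor_loss_bound n).
    by apply: (@leq_trans ((1 + n) ^ (n + n).+1)); [exact: leq_pexp2l|exact: leq_pmull].
  move: H; rewrite -pow2_nat pow2_le addrC natr_sum.
  congr (_ <= _); apply: eq_bigl => i; rewrite /v'.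
  by case Ti: (T i); rewrite /= ?ltnn ?andbF //; have /andP[-> _] := vT i (ltn_ord i) Ti.
(* The first coordinate of the limit vector is 1, and the next term of the
   series separates the limit vector from the span of the truncations. *)
have dist i : (i < d)%N -> T i -> (v i <= m)%N -> p <= (s i (N i + v i))%:R + 2.
  move=> id Ti vm; have [y yZ Yy] := near' i id Ti.
  have WZ' c : c \in basis_index n m v' N -> (row c (toR (adapted_mx n m s v' N)) <= toR Z')%MS by exact: WZ.
  have [t [tS tE]] := span_selected_rows Wu WZ' Z'f rS yZ.
  have vi := vT i id Ti; have v'i : v' i = v i by rewrite /v' Ti.
  have [hh [hb h0']] := coord_exists hn m1 id (leq0n m).
  have [c [cb cp]] := coord_exists hn m1 id (ltn_pmod (N i + v i) m1 : (axis m (N i + v i) <= m)%N).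
  have hvy : heavy m v' hh by rewrite /heavy h0' hb v'i vm; case/andP: vi => ->.
  have := adapted_mx_slope s hn m1 tS hvy; rewrite hb v'i => /(_ c cb cp); rewrite -tE => slope.
  have := Yy c; have := Yy hh; rewrite !mxE hb cb !eqxx h0' sigma0 slope cp.
  set l := axis _ _; set ps := partial_sum _ _ _ _ _.
  have jump : ps + (2 ^+ s i (N i + v i))^-1 <= sigma i l.
    apply: le_trans (sigma_lb i (N i + v i) l).
    by apply: partial_sum_jump => //; [exact: exponent_lt|move: vi; clear; lia].
  have /andP[_ sl] := sigma_bd i l.
  have ps0 : 0 <= ps by rewrite divr_ge0 ?exprn_ge0.
  have is0 : 0 <= (2 ^+ s i (N i + v i))^-1 :> R by rewrite invr_ge0 exprn_ge0.
  set dl := 2 `^ (- p); move=> /ler_normlP[y1 y2] /ler_normlP[y3 y4].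
  have : (2 ^+ s i (N i + v i))^-1 <= 2 `^ (2 - p) :> R.
    rewrite pow2D pow2_nat -/dl.
    have : ps * (y 0 hh - 1) <= 2 * dl.
      apply: (@le_trans _ _ (ps * dl)); first by rewrite ler_wpM2l //; move: y1; lra.
      apply: ler_wpM2r; first exact: powR_ge0.
      by move: jump sl is0; lra.
    by rewrite mulrBr mulr1; move: y4 jump; lra.
  by rewrite -pow2_nat -pow2N pow2_le; lra.
suff : p * Sg <= h + g%:R + 3 * d%:R by move: pS CK1; rewrite /C; lra.
rewrite mulr_sumr.
apply: (@le_trans _ _ (\sum_(i < d | T i && (v i <= m)%N) ((s i (N i))%:R + 3))).
  apply: ler_sum => i /andP[Ti vm]; have id := ltn_ord i.
  have ps := dist i id Ti vm.
  have /andP[s1 _] := exponent_bounds i (N i + v i).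
  have /andP[_ s2] := exponent_bounds i (N i).
  have aK := alphaK i (N i) vm; have k1 := K1 i vm.
  rewrite ler_pdivrMr; last lra.
  apply: (le_trans ps); rewrite -/s in s1 s2.
  apply: (@le_trans _ _ (K i (v i) * ((s i (N i))%:R + 1) + 2 * K i (v i))); last lra.
  apply: lerD; last lra.
  apply: (le_trans s1); apply: (le_trans aK); rewrite ler_wpM2l ?ltW //; lra.
rewrite big_split /=; apply: lerD; first exact: heightW.
rewrite sumr_const -[leLHS]mulr_natr ler_wpM2l // ler_nat.
by rewrite -[X in (_ <= X)%N]card_ord max_card.
Qed.

End LowerBound.

(** * Reduction to some of the blocks *)

Section Cramer.
Context {R : realType}.

(** Cramer's rule: with the columns of a maximal minor as basis, the
    coordinates of the other columns are quotients of minors by it. *)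
Lemma max_minor k d (C : 'M[R]_(k, d)) : row_free C ->
  exists f : 'I_k -> 'I_d, [/\ injective f, colsub f C \in unitmx &
    forall r j, `|(invmx (colsub f C) *m C) r j| <= 1].
Proof.
move=> Cf; have [f0 f0n] := row_free_minor Cf.
pose g0 : {ffun 'I_k -> 'I_d} := [ffun i => f0 i].
pose D (g : {ffun 'I_k -> 'I_d}) := `|\det (colsub g C)|.
have [f _ fmax] := @arg_maxP _ R _ g0 xpredT D isT.
have fE (h : 'I_k -> 'I_d) : colsub [ffun i => h i] C = colsub h C.
  by apply/matrixP => i j; rewrite !mxE ffunE.
have Df : 0 < `|\det (colsub f C)|.
  apply: lt_le_trans (fmax g0 isT); rewrite /D fE normr_gt0.
  exact: f0n.
have Cu : colsub f C \in unitmx by rewrite unitmxE unitfE -normr_gt0.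
exists f; split => //.
  apply: contrapT => fi; move: Df; rewrite det_colsub_not_inj ?normr0 ?ltxx //.
move=> r j; rewrite /invmx Cu -scalemxAl mxE normrM normrV ?unitfE -?normr_gt0 //.
rewrite mulrC ler_pdivrMr // mul1r.
pose f' := [ffun a => if a == r then j else f a].
have -> : (\adj (colsub f C) *m C) r j = \det (colsub f' C).
  rewrite mxE (expand_det_col _ r); apply: eq_bigr => q _.
  rewrite !mxE ffunE eqxx mulrC; congr (_ * _); rewrite /cofactor; congr (_ * \det _).
  apply/matrixP => a b; rewrite !mxE ffunE eq_sym (negPf (neq_lift _ _)).
  by [].
exact: fmax.
Qed.

Lemma mulmx_entry_bound p q r (M : 'M[R]_(p, q)) (N : 'M[R]_(q, r)) a b :
  0 <= a -> (forall i j, `|M i j| <= a) -> (forall i j, `|N i j| <= b) ->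
  forall i j, `|(M *m N) i j| <= q%:R * (a * b).
Proof.
move=> a0 Ma Nb i j; rewrite mxE; apply: le_trans (ler_norm_sum _ _ _) _.
rewrite mulr_natl -[X in _ *+ X]card_ord -sumr_const; apply: ler_sum => l _.
by rewrite normrM ler_pM.
Qed.

End Cramer.

Section FrameProjection.
Context {R : realType} (n m d : nat) (Y : nat -> 'rV[R]_n).
Hypotheses (limit_vector_out : forall i c, block m c <> i -> Y i 0 c = 0)
  (limit_vector_bound : forall i c, `|Y i 0 c| <= 2).

(** With f given by a maximal minor of the matrix C of coefficients of x, the
    inverse of this minor is bounded, since C has a bounded right inverse (the
    scalar products of x with Y); it brings the x to vectors of the form Y (f r)
    plus coordinates of the blocks outside the image of f. *)
Lemma frame_projection k (x y : 'I_k -> 'rV[R]_n) (psi : R) :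
  0 <= psi ->
  (forall q, exists u : 'rV[R]_d, x q = \sum_i u 0 i *: Y i) ->
  (forall q r, dotp (x q) (x r) = (q == r)%:R) ->
  (forall q, dotp (x q - y q) (x q - y q) <= psi ^+ 2) ->
  exists f : 'I_k -> 'I_d, injective f /\ forall r, exists w : 'rV[R]_k,
    forall c, block m c \in [seq val (f a) | a : 'I_k] ->
    `|Y (f r) 0 c - (\sum_q w 0 q *: y q) 0 c| <= k%:R * (d%:R * (2 * n%:R) * psi).
Proof.
move=> psi0 /fin_all_exists[u xE] xx xy.
pose C : 'M[R]_(k, d) := \matrix_(q, i) u q 0 i.
have xC q c (i : 'I_d) : block m c = i -> x q 0 c = C q i * Y i 0 c.
  move=> ci; rewrite xE summxE (bigD1 i) //= big1 => [|j ji].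
    by rewrite !mxE addr0.
  rewrite mxE limit_vector_out ?mulr0 // ci => e; case/eqP: ji; exact: val_inj.
have x_le1 q c : `|x q 0 c| <= 1.
  rewrite -(@ler_pXn2r _ 2%N) ?nnegrE // expr1n real_normK ?num_real //.
  by apply: le_trans (sqr_coord_le_dotp _ _) _; rewrite xx eqxx.
pose E : 'M[R]_(d, k) := \matrix_(i, r) dotp (Y i) (x r).
have CE : C *m E = 1%:M.
  apply/matrixP => q r; rewrite !mxE -xx xE dotp_suml; apply: eq_bigr => i _.
  by rewrite !mxE dotpZl.
have [|f [finj Cu F1]] := @max_minor R k d C; first by apply/row_freeP; exists E.
exists f; split => // r.
set Cf := colsub f C in Cu F1.
have invE : invmx Cf = (invmx Cf *m C) *m E by rewrite -mulmxA CE mulmx1.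
have Ebd i j : `|E i j| <= 2 * n%:R.
  rewrite mxE; apply: le_trans (ler_norm_sum _ _ _) _.
  rewrite mulr_natr -[X in _ *+ X]card_ord -sumr_const; apply: ler_sum => c _.
  by rewrite normrM -[leRHS]mulr1 ler_pM.
have invbd i j : `|invmx Cf i j| <= d%:R * (2 * n%:R).
  rewrite invE; have := mulmx_entry_bound ler01 F1 Ebd i j.
  by rewrite mul1r.
exists (row r (invmx Cf)) => c /mapP[r' _ cr'].
have -> : Y (f r) 0 c - (\sum_q row r (invmx Cf) 0 q *: y q) 0 c =
    \sum_q invmx Cf r q * (x q - y q) 0 c.
  have -> : Y (f r) 0 c = \sum_q invmx Cf r q * x q 0 c.
    under eq_bigr => q _ do rewrite (xC q c (f r')) // mulrA.
    rewrite -mulr_suml; have -> : \sum_q invmx Cf r q * C q (f r') = (r == r')%:R.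
      have /matrixP/(_ r r') := mulVmx Cu; rewrite !mxE => <-.
      by apply: eq_bigr => q _; rewrite !mxE.
    have [->|rr'] := eqVneq r r'; first by rewrite mul1r.
    rewrite mul0r limit_vector_out // cr' => e; case/eqP: rr'; apply: finj; exact/esym/val_inj.
  rewrite summxE -sumrB; apply: eq_bigr => q _.
  by rewrite !mxE mulrBr.
apply: le_trans (ler_norm_sum _ _ _) _.
rewrite mulr_natl -[X in _ *+ X]card_ord -sumr_const; apply: ler_sum => q _.
rewrite normrM ler_pM //.
rewrite -(@ler_pXn2r _ 2%N) ?nnegrE // real_normK ?num_real //.
exact: le_trans (sqr_coord_le_dotp _ _) (xy q).
Qed.

End FrameProjection.

(** * The balanced partition of the dimension *)

Section Balanced.
Variables (e k m : nat).
Hypotheses (k0 : (0 < k <= e)%N) (ekm : (e < k * m.+1)%N).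

Let divle : (e %/ k <= m)%N.
Proof.
have [k1 _] := andP k0.
by rewrite -ltnS ltn_divLR // mulnC.
Qed.

Lemma vpart_bounds q : (0 < vpart e k q <= m.+1)%N.
Proof.
have w0 : (0 < e %/ k)%N by rewrite divn_gt0; case/andP: k0.
by rewrite /vpart; case: ifP => _; move: divle w0; lia.
Qed.

Lemma vpart_sum : (\sum_(q < k) vpart e k q.+1 = e)%N.
Proof.
have mk : (e %% k <= k)%N by rewrite ltnW // ltn_mod; case/andP: k0.
have E (q : nat) : vpart e k q.+1 = (e %/ k + (q < e %% k))%N.
  by rewrite /vpart; case: ifP => _; rewrite ?addn1 ?addn0.
under eq_bigr do rewrite E.
rewrite big_split /= sum_nat_const card_ord [RHS](divn_eq e k) mulnC; congr (_ + _)%N.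
have -> u j : (\sum_(q < j) (q < u) = minn u j)%N.
  elim: j => [|j IH]; first by rewrite big_ord0 minn0.
  rewrite big_ord_recr /= IH; clear; lia.
by apply/minn_idPl.
Qed.

(** A part can only exceed m when e > m k; the first e - m k parts are then
    equal to m + 1. *)
Lemma vpart_le_cond q : (0 < q)%N -> (vpart e k q <= m)%N = (e - m * k < q)%N.
Proof.
move=> q0; have E := divn_eq e k; have mk : (e %% k < k)%N by rewrite ltn_mod; case/andP: k0.
rewrite /vpart; move: divle E mk.
set w := (e %/ k)%N; set u := (e %% k)%N => wm E uk.
have [wE|wlt] : (w = m \/ (w < m)%N) by move: wm; clear; lia.
  by rewrite E wE addKn; case: (leqP q u) => qu; rewrite ?ltnn ?leqnn.
have -> : (e - m * k = 0)%N by rewrite E; nia.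
by rewrite q0; case: (leqP q u) => qu; move: wlt; clear; lia.
Qed.

End Balanced.

Lemma increasing_le_shift k d (g : {ffun 'I_k -> 'I_d}) (q : 'I_k) :
  increasing g -> (g q <= q + (d - k))%N.
Proof.
move=> gi.
have step j (q' : 'I_k) : (q' = q + j :> nat)%N -> (g q + j <= g q')%N.
  elim: j q' => [|j IH] q' qE; first by rewrite addn0 (_ : q' = q) //; apply: val_inj; rewrite /= qE addn0.
  have jk : (q + j < k)%N by have := ltn_ord q'; rewrite qE; lia.
  have := IH (Ordinal jk) erefl.
  have : (g (Ordinal jk) < g q')%N.
    by move/forallP: gi => /(_ (Ordinal jk))/forallP/(_ q')/implyP; apply; rewrite qE /= addnS.
  lia.
have kq : (k.-1 < k)%N by have := ltn_ord q; lia.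
have := step (k.-1 - q)%N (Ordinal kq); rewrite /= => /(_ _).
have := ltn_ord q; have := ltn_ord (g (Ordinal kq)); lia.
Qed.

Section Gaps.
Context (R : realType) (d m : nat) (c1 c2 : R) (beta : nat -> nat -> R).
Hypotheses (hd : (1 <= d)%N) (hm : (1 <= m)%N)
  (hc1 : c1 = (1 + 1 / m%:R) `^ (1 / d%:R))
  (hc2 : 1 < c2 < c1)
  (hbeta1 : min_upto m (beta 1%N) > (3 * d%:R) `^ (c2 / (c2 - 1)))
  (hbeta1' : min_upto m (beta 1%N) `^ c1 > max_upto m (beta 1%N) `^ c2)
  (hbeta : forall i : nat, (1 <= i <= d - 1)%N ->
     min_upto m (beta i) `^ c1 > max_upto m (beta i.+1) /\
     min_upto m (beta i.+1) > max_upto m (beta i) `^ c2).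

Local Notation K i w := (window_max m (beta i.+1) w).

Lemma window_max_ge1 i w : (i < d)%N -> (w <= m)%N -> 1 <= K i w.
Proof.
move=> id wm; have b9 : 9 <= min_upto m (beta i.+1) by apply: (min_upto_ge9 hd hm hc1 hc2 hbeta1 hbeta1' hbeta).
have /andP[h _] : min_upto m (beta i.+1) ^+ w <= K i w <= max_upto m (beta i.+1) ^+ w.
  by apply: window_max_bounds => //; lra.
by apply: le_trans h; rewrite exprn_ege1 //; lra.
Qed.

(** The parts of e differ by at most 1 and the larger ones come first.  So
    vpart q - 1 is less than vpart q', or they are equal and q comes before q',
    in which case the row g q' is later than g q. *)
Lemma balanced_gap e k (g : {ffun 'I_k -> 'I_d}) (q q' : 'I_k) :
  (0 < k <= e)%N -> (e < k * m.+1)%N -> increasing g ->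
  (vpart e k q'.+1 <= m)%N ->
  3 * d%:R * K (g q) (vpart e k q.+1).-1 <= K (g q') (vpart e k q'.+1).
Proof.
move=> k0 ekm gi vm.
have /andP[v1 v2] := vpart_bounds k0 ekm q.+1.
have /andP[v1' v2'] := vpart_bounds k0 ekm q'.+1.
have gd := ltn_ord (g q); have gd' := ltn_ord (g q').
have gap := window_max_gap hd hm hc1 hc2 hbeta1 hbeta1' hbeta.
have gap_row := window_max_gap_row hd hm hc1 hc2 hbeta1 hbeta1' hbeta.
have [lt|ge] := ltnP (vpart e k q.+1).-1 (vpart e k q'.+1).
  have cases : ((vpart e k q'.+1).-1 = (vpart e k q.+1).-1 \/
     ((vpart e k q'.+1).-1 = vpart e k q.+1))%N.
    move: lt v1 v1'; rewrite /vpart; do 2 case: ifP => _; clear; lia.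
  case: cases => E.
    rewrite -E -{2}(prednK v1'); apply: gap; move: gd gd' vm v1'; clear; lia.
  rewrite -(prednK v1') E; apply: (@le_trans _ _ (K (g q') (vpart e k q.+1))).
    rewrite -{2}(prednK v1); apply: gap; move: gd gd' vm v1' v1 E; clear; lia.
  have b9 : 9 <= min_upto m (beta (g q').+1).
    by apply: (min_upto_ge9 hd hm hc1 hc2 hbeta1 hbeta1' hbeta).
  have vm' : (vpart e k q.+1 < m)%N by move: vm v1' E; clear; lia.
  apply: le_trans (window_max_step _ vm'); last by lra.
  rewrite ler_peMl //; last lra.
  by have := window_max_ge1 gd' (ltnW vm'); lra.
have E : (vpart e k q.+1).-1 = vpart e k q'.+1.
  move: ge v1 v1'; rewrite /vpart; do 2 case: ifP => _; clear; lia.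
have qq' : (q < q')%N.
  move: E v1 v1'; rewrite /vpart; case: ifP => h1; case: ifP => h2; move: h1 h2; clear; lia.
rewrite E; apply: gap_row; rewrite ?ltnS //; last by rewrite v1'.
by move/forallP: gi => /(_ q)/forallP/(_ q')/implyP; apply.
Qed.

End Gaps.

(** * The subspace and its angles with rational subspaces *)

Lemma big_image_inj (M : Type) (idx : M) (op : Monoid.com_law idx) k d
    (g : 'I_k -> 'I_d) (P : pred nat) (F : nat -> M) : injective g ->
  \big[op/idx]_(i < d | (val i \in [seq val (g a) | a : 'I_k]) && P i) F i =
  \big[op/idx]_(q < k | P (g q)) F (g q).
Proof.
move=> ginj; rewrite big_mkcondr [RHS]big_mkcond.
rewrite (eq_bigl (fun i : 'I_d => i \in g @: [set: 'I_k])); last first.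
  move=> i; apply/mapP/imsetP => [[a _ /val_inj ->]|[a _ ->]]; exists a => //.
  by rewrite mem_enum.
rewrite big_imset /=; last by move=> a b _ _; exact: ginj.
by apply: eq_bigl => q; rewrite inE.
Qed.

Section Main.
Context {R : realType} (d m n : nat) (c1 c2 : R) (beta : nat -> nat -> R).
Hypotheses (hd : (1 <= d)%N) (hm : (1 <= m)%N) (hn : n = (m.+1 * d)%N)
  (hc1 : c1 = (1 + 1 / m%:R) `^ (1 / d%:R))
  (hc2 : 1 < c2 < c1)
  (hbeta1 : min_upto m (beta 1%N) > (3 * d%:R) `^ (c2 / (c2 - 1)))
  (hbeta1' : min_upto m (beta 1%N) `^ c1 > max_upto m (beta 1%N) `^ c2)
  (hbeta : forall i : nat, (1 <= i <= d - 1)%N ->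
     min_upto m (beta i) `^ c1 > max_upto m (beta i.+1) /\
     min_upto m (beta i.+1) > max_upto m (beta i) `^ c2).

(** Blocks are numbered from 0, and the index is truncated so that the
    bounds below hold for all natural numbers. *)
Definition block_max (i w : nat) : R := window_max m (beta (minn i d.-1).+1) w.
Local Notation K := block_max.

Variables (alpha : nat -> nat -> R) (sigma : nat -> nat -> R).
Let s := height_exponent alpha.
Hypotheses (alpha0 : forall i, alpha i 0 = 1)
  (alpha2 : forall i N, 2 * alpha i N <= alpha i N.+1)
  (alphaK : forall i N w, (w <= m)%N -> alpha i (N + w)%N <= K i w * alpha i N)
  (sigma0 : forall i, sigma i 0%N = 1)
  (sigma_bd : forall i l, 0 <= sigma i l <= 2)
  (sigma_lb : forall i N l, partial_sum R m (s i) N l <= sigma i l)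
  (sigma_ub : forall i N l, sigma i l <= partial_sum R m (s i) N l + 2 / 2 ^+ s i N.+1).

Lemma block_max_ge1 i w : (w <= m)%N -> 1 <= K i w.
Proof.
by move=> wm; apply: (window_max_ge1 hd hm hc1 hc2 hbeta1 hbeta1' hbeta) => //; move: hd; clear; lia.
Qed.

Lemma block_maxE i w : (i < d)%N -> K i w = window_max m (beta i.+1) w.
Proof. by move=> id; rewrite /block_max (minn_idPl _) //; move: id; clear; lia. Qed.

Lemma block_max_bounded : exists CK, forall i w, (w <= m)%N -> K i w <= CK.
Proof.
exists (\sum_(i < d) \sum_(w < m.+1) K i w) => i w wm.
have K0 j u : (u <= m)%N -> 0 <= K j u by move=> /(block_max_ge1 j); lra.
have id : (minn i d.-1 < d)%N by move: hd; clear; lia.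
rewrite (bigD1 (Ordinal id)) //= (bigD1 (Ordinal (wm : (w < m.+1)%N))) //=.
have -> : K (minn i d.-1) w = K i w by rewrite /block_max -minnA minnn.
rewrite -addrA lerDl addr_ge0 // sumr_ge0 // => [u _|j _].
  by apply: K0; have := ltn_ord u.
by rewrite sumr_ge0 // => u _; apply: K0; have := ltn_ord u.
Qed.

Local Notation Y := (limit_vector n m sigma).

Definition Aspace : {vspace 'rV[R]_n} := <<[tuple Y i | i < d]>>%VS.

Lemma limit_vector_out i c : block m c <> i -> Y i 0 c = 0.
Proof. by rewrite mxE => /eqP/negPf ->. Qed.

Lemma limit_vector_bound i c : `|Y i 0 c| <= 2.
Proof.
rewrite mxE; case: ifP => _; last by rewrite normr0.
by have /andP[h1 h2] := sigma_bd i (place m c); rewrite ger0_norm.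
Qed.

Lemma limit_vector_sum_head (u : 'I_d -> R) (c : 'I_n) (i : 'I_d) : block m c = i -> place m c = 0%N ->
  (\sum_j u j *: Y j) 0 c = u i.
Proof.
move=> ci c0; rewrite summxE (bigD1 i) //= big1 => [|j ji].
  by rewrite addr0 !mxE ci eqxx c0 sigma0 mulr1.
rewrite mxE limit_vector_out ?mulr0 // ci => e; case/eqP: ji; exact: val_inj.
Qed.

Lemma Aspace_basis : basis_of Aspace [tuple Y i | i < d].
Proof.
apply/andP; split; first by rewrite eqxx.
apply/freeP => u u0 i; have [c [ci c0]] := coord_exists hn hm (ltn_ord i) (leq0n m).
have e : \sum_j u j *: Y j = 0.
  by rewrite -[RHS]u0; apply: eq_bigr => j _; rewrite -tnth_nth tnth_mktuple.
by rewrite -(limit_vector_sum_head u ci c0) e mxE.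
Qed.

Lemma dim_Aspace : \dim Aspace = d.
Proof. by rewrite -(size_basis Aspace_basis). Qed.

Lemma mem_Aspace X : X \in Aspace -> exists u : 'rV[R]_d, X = \sum_i u 0 i *: Y i.
Proof.
move=> XA; exists (\row_i coord [tuple Y i | i < d] i X).
rewrite {1}(coord_basis Aspace_basis XA); apply: eq_bigr => i _.
by rewrite mxE -tnth_nth tnth_mktuple.
Qed.

(** The denominator of the exponent, for the last k blocks; the parts equal to
    m + 1 correspond to full blocks and do not contribute. *)
Definition top_sum e k : R :=
  \sum_(q < k | (vpart e k q.+1 <= m)%N) (K (q + (d - k))%N (vpart e k q.+1))^-1.

(** The k blocks selected by [frame_projection], taken in increasing order,
    receive the parts of e.  The q-th selected block has number at most q + (d - k), and
    the maxima grow with the block, so the last k blocks give the smallest sum. *)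
Lemma omegaj_lower_bound e k : (0 < k <= minn d e)%N -> (e < k * m.+1)%N ->
  exists C, forall B, rational_spaces e B -> forall h p,
    height B <= 2 `^ h -> omegaj k Aspace B <= 2 `^ (- p) ->
    p * top_sum e k <= h + C.
Proof.
move=> kde ekm.
have k0 : (0 < k)%N by case/andP: kde.
have ke : (0 < k <= e)%N by move: kde; clear; lia.
have kd : (k <= d)%N by move: kde; clear; lia.
have [CK KC] := block_max_bounded.
have [C0 core] := inverse_max_sum_le hn hm alpha0 alpha2 alphaK block_max_ge1 KC sigma0 sigma_bd sigma_lb sigma_ub.
pose c := (k * (d * (2 * n)))%N.
have cP : k%:R * (d%:R * (2 * n%:R)) <= 2 `^ c%:R :> R.
  by rewrite pow2_nat -!natrM -natrX ler_nat ltnW // ltn_expl.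
exists (`|C0| + c%:R) => B [rB eB] h p Bh om.
have [X [Xf BX hB]] := height_rational rB.
move: X Xf BX hB; rewrite eB => X Xf BX hB.
have Xm : minors_le (map_mx intr X) (2 `^ h).
  by move=> f; apply: le_trans Bh; rewrite hB; exact: wedge_norm_ge.
have [|x [y [xA yB xx xy]]] := @omegaj_frame _ _ Aspace B k.
  by rewrite dim_Aspace eB; case/andP: kde.
have xu q : exists u : 'rV[R]_d, x q = \sum_i u 0 i *: Y i by apply: mem_Aspace.
have xy' q : dotp (x q - y q) (x q - y q) <= (2 `^ (- p)) ^+ 2.
  apply: le_trans (xy q) _.
  by rewrite ler_pXn2r ?nnegrE ?omegaj_ge0 // ltW // pow2_gt0.
have [f [finj fP]] := frame_projection limit_vector_out limit_vector_bound (ltW (pow2_gt0 (- p))) xu xx xy'.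
have [g [sg [gi fg]]] := inj_sort finj.
have ginj := increasing_inj gi.
have codomE i : (i \in [seq val (f a) | a : 'I_k]) = (i \in [seq val (g a) | a : 'I_k]).
  apply/mapP/mapP => -[a _ ->]; first by exists (sg a); rewrite ?mem_enum // fg.
  by exists (sg^-1%g a); rewrite ?mem_enum // fg /= permKV.
pose T (i : nat) := i \in [seq val (g a) | a : 'I_k].
pose v i := if [pick q : 'I_k | val (g q) == i] is Some q then vpart e k q.+1 else 0%N.
have vE (q : 'I_k) : v (g q) = vpart e k q.+1.
  rewrite /v; case: pickP => [q' /eqP/val_inj/ginj -> //|/(_ q)]; by rewrite eqxx.
have TP i : T i -> exists q, i = val (g q) by case/mapP => q _ ->; exists q.
pose S := inverse_max_sum m d K T v.
have SE : S = \sum_(q < k | (vpart e k q.+1 <= m)%N) (K (g q) (vpart e k q.+1))^-1.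
  rewrite /S /inverse_max_sum (big_image_inj _ (fun i => (v i <= m)%N) (fun i => (K i (v i))^-1) ginj).
  by apply: eq_big => [q|q _]; rewrite vE.
have Kgap (q q' : 'I_k) : (vpart e k q'.+1 <= m)%N ->
    3 * d%:R * K (g q) (vpart e k q.+1).-1 <= K (g q') (vpart e k q'.+1).
  move=> vm; rewrite !block_maxE //.
  exact: (balanced_gap hd hm hc1 hc2 hbeta1 hbeta1' hbeta).
have d1 : 1 <= d%:R :> R by rewrite ler1n.
have Sgap i : (i < d)%N -> T i -> 3 * K i (v i).-1 * S <= 1.
  move=> id /TP[q ->]; rewrite vE SE mulr_sumr.
  apply: (@le_trans _ _ (\sum_(q' < k | (vpart e k q'.+1 <= m)%N) d%:R^-1)).
    apply: ler_sum => q' vm; have K1 := block_max_ge1 (g q') vm.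
    rewrite ler_pdivrMr; last lra.
    rewrite [leRHS]mulrC ler_pdivlMr; last lra.
    by rewrite mulrC mulrA [d%:R * 3]mulrC; exact: Kgap.
  rewrite sumr_const -[leLHS]mulr_natr [leLHS]mulrC ler_pdivrMr; last lra.
  rewrite mul1r ler_nat; apply: leq_trans kd.
  by rewrite -[X in (_ <= X)%N]card_ord max_card.
have S_top : top_sum e k <= S.
  rewrite SE; apply: ler_sum => q vm.
  have q1 := block_max_ge1 (g q) vm; have q2 := block_max_ge1 (q + (d - k)) vm.
  rewrite lef_pV2 ?posrE; try lra.
  have := increasing_le_shift q gi => gq; have qk := ltn_ord q.
  have qd : (q + (d - k) < d)%N by move: qk kd; clear; lia.
  rewrite !block_maxE //; apply: (window_max_mono hd hm hc1 hc2 hbeta1 hbeta1' hbeta) => //.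
  by have /andP[-> _] := vpart_bounds ke ekm q.+1.
have S0 : 0 <= top_sum e k.
  by apply: sumr_ge0 => q vm; rewrite invr_ge0; have := block_max_ge1 (q + (d - k)) vm; lra.
have h0 : 0 <= h.
  by rewrite -pow2_le powRr0; apply: le_trans Bh; exact: height_ge1.
have S1 : S <= 1.
  have := Sgap _ (ltn_ord (g (Ordinal k0))) _; rewrite vE => Sg.
  have /andP[v1 v2] := vpart_bounds ke ekm 1.
  have K1 : 1 <= K (g (Ordinal k0)) (vpart e k 1).-1.
    by apply: block_max_ge1; move: v2; clear; lia.
  have /Sg : T (g (Ordinal k0)) by apply/mapP; exists (Ordinal k0); rewrite ?mem_enum.
  by have := le_trans S0 S_top; nra.
have := core T v e X h (p - c%:R) _ _ Xf Xm Sgap _.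
have [pneg _|ppos] := leP p 0.
  have : p * top_sum e k <= 0 by rewrite mulr_le0_ge0.
  by have := normr_ge0 C0; have : 0 <= c%:R :> R by []; lra.
move=> /(_ _ _ _) Hc.
have {}Hc : (p - c%:R) * S <= h + C0.
  apply: Hc.
  - by move=> i _ /TP[q ->]; rewrite vE; exact: vpart_bounds.
  - rewrite -[LHS](vpart_sum ke).
    transitivity (\sum_(i < d | (val i \in [seq val (g a) | a : 'I_k]) && xpredT (val i)) v i)%N.
      by rewrite (big_image_inj _ xpredT v ginj); apply: eq_bigr => q _; rewrite vE.
    by apply: eq_bigl => i; rewrite andbT.
  - move=> i id /TP[q qE].
    have [w wP] := fP (sg^-1%g q).
    exists (\sum_q w 0 q *: y q).
      by rewrite summx_sub // => a _; rewrite scalemx_sub // -BX.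
    move=> a Ta; have := wP a; rewrite codomE => /(_ Ta).
    rewrite fg /= permKV -qE => /le_trans; apply.
    rewrite opprB pow2D mulrA; apply: ler_wpM2r; first exact/ltW/pow2_gt0.
    exact: cP.
have pS : p * top_sum e k <= p * S by rewrite ler_wpM2l // ltW.
have cS : c%:R * S <= c%:R by rewrite ler_piMr.
have := ler_norm C0; lra.
Qed.

(** The height is at most a constant times the product of the sizes of the rows
    of a Z-basis, and only the first truncation of each block is large. *)
Lemma approximating_space e (v N : nat -> nat) :
  (forall i, (i < d)%N -> (v i <= m.+1)%N) -> (\sum_(i < d) v i = e)%N ->
  exists B, [/\ rational_spaces e B,
    height B <= #|{ffun 'I_e -> 'I_n}|%:R * (e`!%:R * (2 ^+ n *
      2 ^+ (\sum_(i < d | 0 < v i <= m) s i (N i))%N)) &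
    forall i, (i < d)%N -> (0 < v i)%N -> exists2 y, y \in B &
      forall c, `|Y i 0 c - y 0 c| <= 2 / 2 ^+ s i (N i + v i)%N * (v i <= m)%:R].
Proof.
move=> vm eE.
have s_lt := exponent_lt alpha0 alpha2.
have cS : #|basis_index n m v N| = e by rewrite (card_basis_index hn hm N vm).
clear eE; subst e.
have Xf := sum_basis_row_free (R := R) s hn v N.
have Xp := @sum_basis_primitive R n m d s hn hm s_lt v N.
have Xsel i a : (i < d)%N -> (a < v i <= m)%N ->
    (map_mx intr (truncation n m s i (N i + a)) <= map_mx (@intmul R 1) (sum_basis n m s v N))%MS.
  by move=> id; apply: (truncation_sel hn hm s_lt).
have Ysel i : (i < d)%N -> v i = m.+1 -> (Y i <= map_mx (@intmul R 1) (sum_basis n m s v N))%MS.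
  by move=> id vi; apply: (full_block_sel s hm N id vi) => c; exact: limit_vector_out.
have [B [rB BX]] := rational_of_int Xf.
have hB := height_primitive (proj2 rB) Xf Xp BX.
have Xb : minors_le (map_mx (@intmul R 1) (sum_basis n m s v N)) ((#|basis_index n m v N|)`!%:R * (2 ^+ n *
      2 ^+ (\sum_(i < d | 0 < v i <= m) s i (N i))%N)).
  move=> f; pose b (c : 'I_n) : R := 2 * (if heavy m v c then 2 ^+ s (block m c) (N (block m c)) else 1).
  have b1 c : 1 <= b c.
    rewrite /b; case: ifP => _; last lra.
    have : 1 <= 2 ^+ s (block m c) (N (block m c)) :> R by rewrite exprn_ege1 // ler1n.
    lra.
  apply: le_trans (det_le_rows (b := fun a => b (enum_val a)) _) _.
    move=> a j; rewrite !mxE /b; case: ifP => [_|_]; last first.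
      by rewrite mxE; case: (_ && _); rewrite ?normr1 ?normr0; lra.
    rewrite truncationE; case: eqP => _; last by rewrite normr0 mulr_ge0 ?exprn_ge0.
    rewrite -pmulrn normr_nat.
    set i := block m _; have p0 : 0 < 2 ^+ s i (N i) :> R by rewrite exprn_gt0.
    rewrite -ler_pdivrMr //; apply: le_trans (sigma_lb i (N i) (place m (f j))) _.
    by have /andP[] := sigma_bd i (place m (f j)).
  apply: ler_wpM2l => //.
  have -> : \prod_(a < #|basis_index n m v N|) b (enum_val a) = \prod_(c in basis_index n m v N) b c.
    by rewrite [RHS]big_enum_val.
  rewrite -(prod_heavy s hn) -[X in 2 ^+ X]card_ord -prodr_const -big_split /=.
  rewrite [leRHS](bigID (fun c => c \in basis_index n m v N)) /= ler_peMr //.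
    by apply: prodr_ge0 => c _; exact: le_trans (b1 c).
  by apply: (big_ind (fun x => 1 <= x)) => // [x y|c _]; [exact: mulr_ege1|exact: b1].
exists B; split.
- by [].
- by rewrite hB; exact: wedge_norm_le.
move=> i id v0; have [vi|vi] := leqP (v i) m; last first.
  have vi' : v i = m.+1 by apply/eqP; rewrite eqn_leq vm.
  exists (Y i); first by rewrite BX Ysel.
  by move=> c; rewrite subrr normr0 mulr0.
exists ((2 ^+ s i (N i + (v i).-1)%N)^-1 *: map_mx intr (truncation n m s i (N i + (v i).-1))).
  rewrite memvZ // BX; apply: Xsel => //; rewrite vi andbT; move: v0; clear; lia.
move=> c; set M := (N i + (v i).-1)%N.
have p0 : 0 < 2 ^+ s i M :> R by rewrite exprn_gt0.
have := truncation_near sigma_lb sigma_ub i M c.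
have -> : (N i + v i = M.+1)%N by rewrite /M -addnS prednK.
set X := truncation n m s i M => near.
have -> : ((2 ^+ s i M)^-1 *: map_mx intr X) 0 c = (2 ^+ s i M)^-1 * (X 0 c)%:~R :> R by rewrite !mxE.
rewrite mulr1 -(@ler_pM2l _ (2 ^+ s i M)) // -[X in X * `|_|](gtr0_norm p0) -normrM.
rewrite mulrBr mulVKf ?gt_eqF // distrC; apply: le_trans near _.
by rewrite mulrAC mulrC.
Qed.

(** The direct sum over the last k blocks, at a time tau common to all of them.
    A combination of the limit vectors has these coefficients as coordinates, so
    it is approximated as well as the vectors themselves. *)
Lemma omegaj_upper_bound e k : (0 < k <= minn d e)%N -> (e < k * m.+1)%N ->
  exists C, forall tau (N : nat -> nat), C < tau ->
    (forall q : 'I_k, (vpart e k q.+1 <= m)%N ->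
      alpha (q + (d - k))%N (N (q + (d - k))%N + vpart e k q.+1)%N = tau /\
      alpha (q + (d - k))%N (N (q + (d - k))%N) = tau / K (q + (d - k))%N (vpart e k q.+1)) ->
    exists B, [/\ rational_spaces e B, height B <= 2 `^ (tau * top_sum e k + C) &
      omegaj k Aspace B <= 2 `^ (C - tau)].
Proof.
move=> kde ekm.
have k0 : (0 < k)%N by case/andP: kde.
have ke : (0 < k <= e)%N by move: kde; clear; lia.
have kd : (k <= d)%N by move: kde; clear; lia.
pose c1' := (#|{ffun 'I_e -> 'I_n}| * (e`! * 2 ^ n))%N.
pose c2' := (4 * (n * k))%N.
exists (c1' + c2')%:R => tau N tauC sync.
pose v i := if (i < d - k)%N then 0%N else vpart e k (i - (d - k)).+1.
have vE (q : nat) : v (q + (d - k))%N = vpart e k q.+1.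
  by rewrite /v ltnNge leq_addl /= addnK.
have vm i : (i < d)%N -> (v i <= m.+1)%N.
  by rewrite /v; case: ifP => // _ _; have /andP[] := vpart_bounds ke ekm (i - (d - k)).+1.
have split_sum (M : nmodType) (F : nat -> M) :
    \sum_(i < d) F i = \sum_(i < d - k) F i + \sum_(q < k) F (q + (d - k))%N.
  rewrite -(big_mkord xpredT F) (big_cat_nat (n := (d - k)%N)) ?leq_subr //=.
  rewrite big_mkord; congr (_ + _).
  rewrite -[X in \sum_(X <= _ < _) _](add0n (d - k)%N) big_addn subKn // big_mkord.
  by [].
have eE : (\sum_(i < d) v i = e)%N.
  rewrite (split_sum _ v) /= big1 ?add0r; last by move=> i _; rewrite /v ltn_ord.
  by rewrite -[RHS](vpart_sum ke); apply: eq_bigr => q _; rewrite vE.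
have [B [rB hB near]] := approximating_space N vm eE.
have pc j : j%:R <= 2 `^ j%:R :> R by rewrite pow2_nat -natrX ler_nat ltnW // ltn_expl.
exists B; split => //.
  apply: (le_trans hB).
  have -> : #|{ffun 'I_e -> 'I_n}|%:R * (e`!%:R * (2 ^+ n *
      2 ^+ (\sum_(i < d | 0 < v i <= m) s i (N i))%N)) =
      c1'%:R * 2 ^+ (\sum_(i < d | 0 < v i <= m) s i (N i))%N :> R.
    by rewrite /c1' !natrM natrX; ring.
  rewrite addrC natrD -addrA pow2D; apply: ler_pM => //.
  rewrite -pow2_nat pow2_le; apply: (@le_trans _ _ (tau * top_sum e k)); last by rewrite lerDr.
  rewrite natr_sum big_mkcond (split_sum _ (fun i => if (0 < v i <= m)%N then (s i (N i))%:R else 0)) /=.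
  rewrite big1 ?add0r; last by move=> i _; rewrite /v ltn_ord.
  rewrite -big_mkcond /top_sum mulr_sumr /=.
  rewrite (eq_bigl (fun q : 'I_k => (vpart e k q.+1 <= m)%N)); last first.
    by move=> q; rewrite vE; have /andP[-> _] := vpart_bounds ke ekm q.+1.
  apply: ler_sum => q vq; have [_ <-] := sync q vq.
  by have /andP[] := exponent_bounds alpha0 alpha2 (q + (d - k)) (N (q + (d - k))%N).
pose eta : R := 4 * 2 `^ (- tau).
have eta0 : 0 <= eta by rewrite mulr_ge0 // ltW // pow2_gt0.
have /fin_all_exists2[y yB yY] : forall q : 'I_k, exists2 y, y \in B &
    forall a, `|Y (q + (d - k))%N 0 a - y 0 a| <= eta.
  move=> q; have qd : (q + (d - k) < d)%N by have := ltn_ord q; move: kd; clear; lia.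
  have /andP[v0 _] := vpart_bounds ke ekm q.+1; rewrite -vE in v0.
  have [y yB yY] := near _ qd v0; exists y => // a; apply: le_trans (yY a) _.
  rewrite vE; have [vq|_] := leqP (vpart e k q.+1) m; last by rewrite mulr0.
  have [tE _] := sync q vq.
  have /andP[_] := exponent_bounds alpha0 alpha2 (q + (d - k)) (N (q + (d - k)) + vpart e k q.+1)%N.
  rewrite tE mulr1 -pow2_nat -pow2N /eta => ts.
  have -> : (4 : R) * 2 `^ (- tau) = 2 * 2 `^ (1 - tau) by rewrite pow2D powRr1 //; ring.
  by rewrite ler_wpM2l // pow2_le; lra.
pose F : 'M[R]_(k, n) := \matrix_q Y (q + (d - k))%N.
have FE (u : 'rV[R]_k) : u *m F = \sum_q u 0 q *: Y (q + (d - k))%N.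
  by rewrite mulmx_sum_row; apply: eq_bigr => q _; rewrite rowK.
have Fhead (u : 'rV[R]_k) (q : 'I_k) : exists a, (u *m F) 0 a = u 0 q.
  have qd : (q + (d - k) < d)%N by have := ltn_ord q; move: kd; clear; lia.
  have [a [ab ap]] := coord_exists hn hm qd (leq0n m).
  exists a; rewrite FE summxE (bigD1 q) //= big1 => [|r rq].
    by rewrite !mxE ab eqxx ap sigma0 mulr1 addr0.
  rewrite mxE limit_vector_out ?mulr0 // ab => /eqP; rewrite eqn_add2r => /eqP e'.
  by case/eqP: rq; apply: val_inj.
have Ff : row_free F.
  apply: inj_row_free => u u0; apply/rowP => q; have [a aE] := Fhead u q.
  by rewrite -aE u0 !mxE.
have FA (u : 'rV[R]_k) : u *m F \in Aspace.
  rewrite FE memv_suml // => q _; rewrite memvZ //.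
  have qd : (q + (d - k) < d)%N by have := ltn_ord q; move: kd; clear; lia.
  apply: memv_span; apply/mapP; exists (Ordinal qd) => //.
  by rewrite mem_enum.
have dom : 2 `^ ((c1' + c2')%:R - tau) < 1 :> R.
  by rewrite -[ltRHS](powRr0 2) pow2_lt subr_lt0.
apply: (@omegaj_le _ _ _ _ k F) => //.
- by rewrite k0 dim_Aspace (proj2 rB); case/andP: kde.
- by rewrite dom ltW // pow2_gt0.
move=> u; exists (\sum_q u 0 q *: y q); first by rewrite memv_suml // => q _; rewrite memvZ.
set D := _ - _; set U := enorm (u *m F).
have U0 : 0 <= U by exact: sqrtr_ge0.
have uU q : `|u 0 q| <= U.
  rewrite -(@ler_pXn2r _ 2%N) ?nnegrE // real_normK ?num_real // enorm_sqr.
  by have [a <-] := Fhead u q; exact: sqr_coord_le_dotp.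
have Da a : `|D 0 a| <= k%:R * (U * eta).
  have -> : D 0 a = \sum_q u 0 q * (Y (q + (d - k))%N 0 a - y q 0 a).
    rewrite /D FE [LHS]mxE [X in _ + X]mxE !summxE -sumrB; apply: eq_bigr => q _.
    by rewrite mulrBr; congr (_ - _); rewrite [LHS]mxE.
  apply: le_trans (ler_norm_sum _ _ _) _.
  rewrite mulr_natl -[X in _ *+ X]card_ord -sumr_const; apply: ler_sum => q _.
  by rewrite normrM ler_pM.
apply: (@le_trans _ _ (\sum_(a < n) (k%:R * (U * eta)) ^+ 2)).
  apply: ler_sum => a _; rewrite -expr2 -real_normK ?num_real //.
  by rewrite lerXn2r ?nnegrE // !mulr_ge0.
rewrite sumr_const card_ord -[leLHS]mulr_natl -enorm_sqr -/U -exprMn.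
have etaB : n%:R * (k%:R * eta) <= 2 `^ ((c1' + c2')%:R - tau).
  have -> : n%:R * (k%:R * eta) = c2'%:R * 2 `^ (- tau) by rewrite /c2' /eta !natrM; ring.
  rewrite natrD -addrA pow2D pow2D.
  apply: (@le_trans _ _ (2 `^ c2'%:R * 2 `^ (- tau))).
    by apply: ler_wpM2r; [exact/ltW/pow2_gt0|exact: pc].
  apply: ler_peMl; first by rewrite mulr_ge0 // ltW // pow2_gt0.
  by rewrite -[leLHS](powRr0 2) pow2_le.
have -> : n%:R * (k%:R * (U * eta)) ^+ 2 = n%:R * (k%:R * eta * U) ^+ 2 by ring.
apply: (@le_trans _ _ ((n%:R * (k%:R * eta) * U) ^+ 2)).
  rewrite -[n%:R * _ * U]mulrA [leRHS]exprMn ler_wpM2r ?sqr_ge0 // -natrX ler_nat.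
  by case: (n) => // a; rewrite expnS expn1 leq_pmulr.
rewrite lerXn2r ?nnegrE ?mulr_ge0 ?powR_ge0 //.
exact: ler_wpM2r.
Qed.

End Main.

(** * The exponent *)

Section ExponentValue.
Local Open Scope classical_set_scope.
Local Open Scope ring_scope.
Context {R : realType} {n : nat}.
Implicit Types A B : {vspace 'rV[R]_n}.

(** For x > 1 / S, the first hypothesis bounds the height of the spaces that are
    approximated with exponent x, so they are finitely many.  For x < 1 / S, the
    spaces given by the second one qualify when tau is large, and, again by the
    first one, their heights are unbounded. *)
Lemma mu_exponent_value A e j (S : R) : 0 < S ->
  (exists C, forall B, rational_spaces e B -> forall h p,
     height B <= 2 `^ h -> psi j A B <= 2 `^ (- p) -> p * S <= h + C) ->
  (exists C, forall tau0, exists2 tau, tau0 < tau &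
     exists B, [/\ rational_spaces e B, height B <= 2 `^ (tau * S + C) &
                   psi j A B <= 2 `^ (C - tau)]) ->
  mu_exponent A e j = (S^-1)%:E.
Proof.
move=> S0 [C1 lower] [C2 upper].
set E := [set x : R | 0 < x /\ infinite_set [set B | rational_spaces e B /\
  psi j A B <= height B `^ (- x)]].
have powh h x : (2 `^ h) `^ (- x) = 2 `^ (- (h * x)) :> R by rewrite -powRrM mulrN.
have above x : E x -> x <= S^-1.
  move=> [x0 inf]; rewrite leNgt; apply/negP => Sx; apply: inf.
  have xS : 0 < x * S - 1 by rewrite subr_gt0 -ltr_pdivrMr // mul1r.
  apply: (@sub_finite_set _ _ [set B | rational_spaces e B /\
     height B <= 2 `^ (C1 / (x * S - 1))]); last exact: finite_height_le.
  move=> B [rB Bx]; split => //.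
  have h1 := height_ge1 (proj1 rB).
  have [h hE] := pow2_log (lt_le_trans ltr01 h1).
  move: Bx; rewrite hE powh => Bx.
  have hB : height B <= 2 `^ h by rewrite hE.
  have := lower B rB h (h * x) hB Bx => low.
  rewrite pow2_le ler_pdivlMr // mulrBr mulr1 mulrA; lra.
have below x : 0 < x < S^-1 -> E x.
  move=> /andP[x0 xS]; split => // fin.
  have xS1 : 0 < 1 - x * S by rewrite subr_gt0 -ltr_pdivlMr // mul1r.
  have [M MP] : exists M, forall B, rational_spaces e B /\ psi j A B <= height B `^ (- x) ->
      height B <= 2 `^ M.
    have /finite_seqP[bs bsE] := fin.
    have [N NE] : exists N : nat, \sum_(B <- bs) `|height B| <= N%:R.
      exists (Num.truncn (\sum_(B <- bs) `|height B|)).+1; apply: ltW.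
      by have /andP[] := truncn_itv (sumr_ge0 bs (fun B _ => normr_ge0 (height B)) : 0 <= \sum_(B <- bs) `|height B|).
    exists N%:R => B BP; have : [set` bs] B by rewrite -bsE.
    move=> Bs; rewrite pow2_nat; apply: (@le_trans _ _ N%:R); last first.
      by rewrite -natrX ler_nat ltnW // ltn_expl.
    apply: le_trans NE; rewrite (big_rem B) //=; apply: le_trans (ler_norm _) _.
    by rewrite lerDl sumr_ge0.
  have [tau] := upper (`|C2| * (1 + x) / (1 - x * S) + `|C2| + (`|M| + `|C1|) / S).
  have t0 : 0 <= (`|M| + `|C1|) / S by rewrite divr_ge0 ?addr_ge0 // ltW.
  have t1 : 0 <= `|C2| * (1 + x) / (1 - x * S).
    by rewrite divr_ge0 ?mulr_ge0 //; lra.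
  have C20 := normr_ge0 C2; have C2n := ler_norm C2.
  move=> taul [B [rB hB pB]].
  have a1 : `|C2| * (1 + x) <= tau * (1 - x * S).
    rewrite -ler_pdivrMr //; lra.
  have Bx : psi j A B <= height B `^ (- x).
    apply: (le_trans pB).
    have h1 := height_ge1 (proj1 rB).
    have [h hE] := pow2_log (lt_le_trans ltr01 h1).
    move: hB; rewrite hE powh !pow2_le => hB.
    have : h * x <= (tau * S + C2) * x by rewrite ler_wpM2r // ltW.
    have : C2 * (1 + x) <= `|C2| * (1 + x) by rewrite ler_wpM2r //; lra.
    lra.
  have HM := MP B (conj rB Bx).
  have pB' : psi j A B <= 2 `^ (- (tau - C2)) by rewrite opprB.
  have low := lower B rB M (tau - C2) HM pB'.
  have : (`|M| + `|C1|) / S < tau - C2 by lra.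
  rewrite ltr_pdivrMr //; have := ler_norm M; have := ler_norm C1; lra.
have iS : 0 < S^-1 by rewrite invr_gt0.
have supE : ereal_sup [set x%:E | x in E] = (S^-1)%:E.
  apply/eqP; rewrite eq_le; apply/andP; split.
    by apply: ge_ereal_sup => _ [x Ex <-]; rewrite lee_fin above.
  apply/lee_addgt0Pr => eps e0.
  pose x := Num.max (S^-1 - eps) (S^-1 / 2).
  have xE : E x.
    apply: below; rewrite lt_max gt_max; apply/andP; split.
      by apply/orP; right; lra.
    by apply/andP; split; lra.
  apply: (@le_trans _ _ (x%:E + eps%:E)%E).
    rewrite -EFinD lee_fin -lerBlDr; by rewrite le_max lexx.
  by apply: leeD2r; apply: ereal_sup_ubound; exists x.
rewrite /mu_exponent supE max_r // lee_fin; exact: ltW.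
Qed.

End ExponentValue.

(** The period j of the exponents serves the pair (e, k) given by the digits of
    j, so that each pair is served infinitely often.  If A met a rational space
    B in a dimension k' >= k, then omega_k' (A, B) = 0 would be less than all the
    2 ^ - p, against the lower bound for the pair (e, k'). *)
Theorem theorem1p8 (R : realType) (d m n : nat) (c1 c2 : R)
  (beta : nat -> nat -> R)
  (hd : (1 <= d)%N) (hm : (1 <= m)%N) (hn : n = ((m + 1) * d)%N)
  (hc1 : c1 = (1 + 1 / m%:R) `^ (1 / d%:R))
  (hc2 : 1 < c2 < c1)
  (hbeta1 : min_upto m (beta 1%N) > (3 * d%:R) `^ (c2 / (c2 - 1)))
  (hbeta1' : min_upto m (beta 1%N) `^ c1 > max_upto m (beta 1%N) `^ c2)
  (hbeta : forall i : nat, (1 <= i <= d - 1)%N ->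
     min_upto m (beta i) `^ c1 > max_upto m (beta i.+1) /\
     min_upto m (beta i.+1) > max_upto m (beta i) `^ c2) :
  exists A : {vspace 'rV[R]_n},
    \dim A = d /\
    forall e k : nat, (1 <= e <= n - 1)%N ->
      (1 + gdef d e n <= k <= minn d e)%N -> (e < k * (m + 1))%N ->
      irrational_spaces d e (k - gdef d e n) A /\
      mu_exponent A e (k - gdef d e n) =
        (1 / \sum_(1 + maxn 0 (e - m * k) <= q < k.+1)
               1 / Kmax m beta (q + d - k) (vpart e k q))%:E.
Proof.
rewrite addn1 in hn *.
have [CK KC] := block_max_bounded hd hm hc1 hc2 hbeta1 hbeta1' hbeta.
set K := block_max d m beta in KC.
have [P [mP PK]] : exists P, (2 * m <= P)%N /\ CK <= 4 ^+ P.
  exists (2 * m + Num.truncn `|CK|)%N.+1; split; first by clear; lia.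
  apply: le_trans (ler_norm CK) _.
  have /andP[_ /ltW h] := truncn_itv (normr_ge0 CK); apply: (le_trans h).
  rewrite -natrX ler_nat; apply: (@leq_trans (2 * m + Num.truncn `|CK|)%N.+1).
    by rewrite ltnS leq_addl.
  by apply: ltnW; exact: ltn_expl.
(* The period j serves the pair (e, k) when j = (r (d + 1) + k) (n + 1) + e; the
   bounds 1 and m only matter for pairs that are not considered and for full
   blocks. *)
pose ej j := (j %% n.+1)%N; pose kj j := (j %/ n.+1 %% d.+1)%N.
pose v i j := minn m (maxn 1 (vpart (ej j) (kj j) (i - (d - kj j)).+1)).
have vm i j : (1 <= v i j <= m)%N by rewrite /v; move: hm; clear; lia.
have /choice[alpha alphaP] : forall i, exists alpha : nat -> R,
  [/\ alpha 0 = 1, forall N, 2 * alpha N <= alpha N.+1,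
      forall N w, (w <= m)%N -> alpha (N + w)%N <= K i w * alpha N &
      forall j, alpha (P * j.+1)%N = 8 ^+ (P * j.+1) /\
        alpha (P * j.+1)%N = K i (v i j) * alpha (P * j.+1 - v i j)%N].
  move=> i; have id : (minn i d.-1 < d)%N by move: hd; clear; lia.
  apply: (exponent_sequence hm) => //.
    exact: (min_upto_ge9 hd hm hc1 hc2 hbeta1 hbeta1' hbeta).
  by move=> w wm; apply: le_trans PK; exact: KC.
have alpha0 i : alpha i 0 = 1 by have [] := alphaP i.
have alpha2 i N : 2 * alpha i N <= alpha i N.+1 by have [] := alphaP i.
have alphaK i N w : (w <= m)%N -> alpha i (N + w)%N <= K i w * alpha i N.
  by have [_ _ h _] := alphaP i; exact: h.
have alphaS i j : alpha i (P * j.+1)%N = 8 ^+ (P * j.+1) /\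
    alpha i (P * j.+1)%N = K i (v i j) * alpha i (P * j.+1 - v i j)%N.
  by have [_ _ _ h] := alphaP i; exact: h.
have s_lt := exponent_lt alpha0 alpha2.
have /choice[sigma sigmaP] i := lacunary_limit R hm (s_lt i).
have sigma0 i : sigma i 0%N = 1 by have [] := sigmaP i.
have sigma_bd i l : 0 <= sigma i l <= 2 by have [] := sigmaP i.
have sigma_lb i N l : partial_sum R m (height_exponent alpha i) N l <= sigma i l.
  by have [] := sigmaP i.
have sigma_ub i N l : sigma i l <= partial_sum R m (height_exponent alpha i) N l +
    2 / 2 ^+ height_exponent alpha i N.+1.
  by have [] := sigmaP i.
have dA := dim_Aspace hm hn sigma0.
have low := omegaj_lower_bound hd hm hn hc1 hc2 hbeta1 hbeta1' hbeta alpha0 alpha2 alphaK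
  sigma0 sigma_bd sigma_lb sigma_ub.
have up := omegaj_upper_bound beta hm hn alpha0 alpha2 sigma0 sigma_bd sigma_lb sigma_ub.
set A := Aspace d m n sigma in dA low up.
exists A; split => // e k /andP[e1 en] /andP[gk kde] ekm.
have k0 : (0 < k)%N by move: gk; clear; lia.
have kde' : (0 < k <= minn d e)%N by rewrite k0.
have ke : (0 < k <= e)%N by move: kde'; clear; lia.
have top_gt0 k' : (0 < k' <= minn d e)%N -> (e < k' * m.+1)%N -> 0 < top_sum d m beta e k'.
  move=> kd' ek'; have k'0 : (0 < k' <= e)%N by move: kd'; clear; lia.
  have K1 := block_max_ge1 hd hm hc1 hc2 hbeta1 hbeta1' hbeta.
  have q0 : (k'.-1 < k')%N by move: k'0; clear; lia.
  have vq : (vpart e k' (Ordinal q0).+1 <= m)%N.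
    rewrite (vpart_le_cond k'0 ek') //= prednK; last by case/andP: k'0.
    by move: ek'; clear; nia.
  rewrite /top_sum (bigD1 (Ordinal q0)) //=; apply: ltr_pwDl.
    by rewrite invr_gt0; apply: lt_le_trans (K1 _ _ vq).
  by apply: sumr_ge0 => q /andP[vq' _]; rewrite invr_ge0; apply: le_trans (K1 _ _ vq').
have psiE B : rational_spaces e B -> psi (k - gdef d e n) A B = omegaj k A B.
  by move=> [_ eB]; rewrite /psi dA eB subnK //; move: gk; clear; lia.
split.
  split => // B [rB eB]; rewrite subnK; last by move: gk; clear; lia.
  rewrite ltnNge; apply/negP => kI; set k' := \dim (A :&: B) in kI.
  have k'd : (0 < k' <= minn d e)%N.
    rewrite (leq_trans k0 kI) leq_min -dA -eB.
    by rewrite !dimvS ?capvSl ?capvSr.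
  have ek' : (e < k' * m.+1)%N by apply: leq_trans ekm _; rewrite leq_mul2r kI orbT.
  have [C lowC] := low e k' k'd ek'.
  have S0 := top_gt0 k' k'd ek'.
  have [M [Mf MI]] := mem_mx (A :&: B)%VS.
  have MAB (u : 'rV[R]_k') : u *m M \in (A :&: B)%VS by rewrite MI submxMl.
  have om0 : omegaj k' A B <= 0.
    apply: (omegaj_le _ _ Mf) => //.
    - by rewrite dA eB.
    - by rewrite lexx ltr01.
    - by move=> u; have := MAB u; rewrite memv_cap => /andP[].
    - move=> u; exists (u *m M); first by have := MAB u; rewrite memv_cap => /andP[].
      by rewrite subrr dotp0l expr0n mul0r.
  have [h hE] := pow2_log (lt_le_trans ltr01 (height_ge1 rB)).
  have hB : height B <= 2 `^ h by rewrite hE.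
  have := lowC B (conj rB eB) h ((h + C + 1) / top_sum d m beta e k') hB.
  rewrite divfK ?gt_eqF // => /(_ _); have : omegaj k' A B <= 2 `^ (- ((h + C + 1) / top_sum d m beta e k')).
    by apply: (le_trans om0); exact: powR_ge0.
  move=> h1 /(_ h1); lra.
have S0 := top_gt0 k kde' ekm.
rewrite (@mu_exponent_value _ _ A e _ (top_sum d m beta e k)) //.
- congr (_%:E); rewrite div1r; congr (_^-1).
  rewrite max0n (@big_nat_widenl _ _ _ _ 1%N) //= big_add1 big_mkord /top_sum.
  apply: eq_big => [q|q vq].
    by rewrite ltnS (vpart_le_cond ke ekm).
  have qd : (q + (d - k) < d)%N by have := ltn_ord q; move: kde; clear; lia.
  rewrite block_maxE // div1r; congr (_^-1); congr (window_max m (beta _) _).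
  have kd : (k <= d)%N by move: kde; clear; lia.
  by rewrite -addSn addnBA.
- have [C lowC] := low e k kde' ekm; exists C => B rB h p hB.
  by rewrite psiE //; exact: lowC.
- have [C upC] := up e k kde' ekm; exists C => tau0.
  pose r := Num.truncn (`|tau0| + `|C|).
  pose j := ((r * d.+1 + k) * n.+1 + e)%N.
  have en' : (e < n.+1)%N by move: en; clear; lia.
  have kd' : (k < d.+1)%N by move: kde; clear; lia.
  have ejE : ej j = e by rewrite /ej /j modnMDl modn_small.
  have kjE : kj j = k.
    by rewrite /kj /j divnMDl // (divn_small en') addn0 modnMDl modn_small.
  have rj : (r <= j)%N by rewrite /j; clear; nia.
  have tau_gt : `|tau0| + `|C| < 8 ^+ (P * j.+1).
    have /andP[_ h] := truncn_itv (addr_ge0 (normr_ge0 tau0) (normr_ge0 C)).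
    apply: (lt_le_trans h); rewrite -natrX ler_nat.
    apply: (@leq_trans (P * j.+1)); last by apply: ltnW; exact: ltn_expl.
    have : (0 < P)%N by move: hm mP; clear; lia.
    by move: rj; rewrite -/r; clear; nia.
  exists (8 ^+ (P * j.+1)).
    apply: le_lt_trans tau_gt; have := ler_norm tau0; have := normr_ge0 C; lra.
  have [||B [rB hB oB]] := upC (8 ^+ (P * j.+1)) (fun i => (P * j.+1 - v i j)%N).
  - apply: le_lt_trans tau_gt; have := ler_norm C; have := normr_ge0 tau0; lra.
  - move=> q vq; have vE : v (q + (d - k))%N j = vpart e k q.+1.
      rewrite /v ejE kjE addnK; have /andP[v1 _] := vpart_bounds ke ekm q.+1.
      by move: v1 vq; clear; lia.
    have [h1 h2] := alphaS (q + (d - k))%N j; rewrite vE in h2 *.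
    rewrite subnK; last by move: vq mP; clear; nia.
    split => //; rewrite -h1 h2 mulrC mulKf // gt_eqF //.
    by apply: lt_le_trans (block_max_ge1 hd hm hc1 hc2 hbeta1 hbeta1' hbeta _ vq).
  by exists B; split; rewrite ?psiE.
Qed.
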